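(* Let $\Bbbk$ be a field of characteristic $0$, let $n\ge 1$, and let $\lambda$ be a partition of $r$, where $1\leq r\leq n$. Then, for the quasi-hereditary structure on $\Bbbk\mathfrak T_n$ described in the context, the indecomposable tilting module $T(\lambda)$ is, up to isomorphism, \[T(\lambda)=\begin{cases}L((1^n)), & \text{if }\lambda=(1^n);\\ I((1^{r+1})), & \text{if }\lambda=(1^r),\ 1\leq r\leq n-1;\\ I(\lambda), & \text{else.}\end{cases}\]
   Context: $\mathfrak T_n$ is the monoid of all self-maps of $[n]=\{1,\ldots,n\}$ under composition; modules are finite dimensional left modules. For $1\leq r\leq n$, $e_r\in\mathfrak T_n$ is the idempotent with $e_r(i)=i$ for $i\leq r$ and $e_r(i)=1$ for $i>r$; $G_{e_r}$ is the group of units of the monoid $e_r\mathfrak T_ne_r$, identified with the symmetric group $\mathfrak S_r$ via $g\mapsto g|_{[r]}$. Let $\Lambda$ be the set of all partitions of all integers $r$ with $1\leq r\leq n$, and write $|\lambda|=r$ if $\lambda$ is a partition of $r$. $S(\lambda)$ is the Specht module over $\Bbbk$ of $\mathfrak S_{|\lambda|}$, with the convention that $S((r))$ is trivial and $S((1^r))$ is the sign representation, where $(1^r)=(1,\ldots,1)$ with $r$ ones. For $\lambda\in\Lambda$ with $|\lambda|=r$, $L(\lambda)$ denotes the unique (up to isomorphism) simple $\Bbbk\mathfrak T_n$-module that is annihilated by all maps of rank (image size) less than $r$ and satisfies $e_rL(\lambda)\cong S(\lambda)$ as $\Bbbk G_{e_r}$-modules; the $L(\lambda)$, $\lambda\in\Lambda$,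 form a complete set of representatives of the isomorphism classes of simple $\Bbbk\mathfrak T_n$-modules. $P(\lambda)$ and $I(\lambda)$ are the projective cover and injective envelope of $L(\lambda)$. Order $\Lambda$ by $\lambda<\rho$ iff $|\lambda|>|\rho|$, and let $\leq$ be the union of $<$ and equality. The standard module $\Delta(\lambda)$ is the quotient of $P(\lambda)$ by the submodule generated by the images of all homomorphisms $P(\mu)\to P(\lambda)$ with $\mu\not\leq\lambda$; the costandard module $\nabla(\lambda)$ is the intersection of the kernels of all homomorphisms $I(\lambda)\to I(\mu)$ with $\mu\not\leq\lambda$. With this order $\Bbbk\mathfrak T_n$ is quasi-hereditary (a result of Putcha): each $\Delta(\lambda)$ has endomorphism algebra a division algebra and each $P(\lambda)$ has a standard filtration (a filtration whose subquotients are isomorphic to standard modules); equivalently, each $\nabla(\lambda)$ has endomorphism algebra a division algebra and each $I(\lambda)$ has a costandard filtration (a filtration with costandard subquotients). A tilting module is a module having both a standard filtration and a costandard filtration. For each $\lambda\in\Lambda$, $T(\lambda)$ is the unique (up to isomorphism) indecomposable tilting module that contains $\Delta(\lambda)$ in such a way that the cokernel of the inclusion $\Delta(\lambda)\hookrightarrow T(\lambda)$ has a standard filtration. *)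

(* Defs.v *)
From HB Require Import structures.
From mathcomp Require Export all_boot all_order all_fingroup all_algebra.

Set Implicit Arguments.
Unset Strict Implicit.
Unset Printing Implicit Defensive.

Import GRing.Theory.
Local Open Scope ring_scope.

(* The set [n] = {1, ..., n} is 'I_n = {0, ..., n-1}. *)
Definition trans (n : nat) : Type := {ffun 'I_n -> 'I_n}.

Definition tid (n : nat) : trans n := [ffun i => i].

Definition tcomp (n : nat) (f g : trans n) : trans n := [ffun i => f (g i)].

Definition trank (n : nat) (f : trans n) : nat := #|[set f i | i : 'I_n]|.

(* i |-> i for the first r points, and i |-> first point otherwise:
   [insubd i 0 : 'I_n] has value 0, as i : 'I_n forces 0 < n. *)
Definition eidem (n r : nat) : trans n :=
  [ffun i : 'I_n => if (i < r)%N then i else insubd i 0%N].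

Definition in_units (n : nat) (e g : trans n) : Prop :=
  tcomp e (tcomp g e) = g /\
  exists h : trans n,
    [/\ tcomp e (tcomp h e) = h, tcomp g h = e & tcomp h g = e].

Definition restricts_to (n r : nat) (g : trans n) (s : 'S_r) : Prop :=
  forall (i : 'I_r) (j : 'I_n), i = j :> nat -> s i = g j :> nat.

(* A finite dimensional left module over the monoid algebra k T_n, given as a
   linear representation of the monoid T_n. *)
Record tmod (k : fieldType) (n : nat) := TMod {
  tcar :> vectType k;
  tact : trans n -> 'End(tcar);
  tact1 : forall v, tact (tid n) v = v;
  tactM : forall f g v, tact (tcomp f g) v = tact f (tact g v)
}.

Section Modules.
Variables (k : fieldType) (n : nat).
Implicit Types M N P I : tmod k n.

Definition is_hom M N (f : 'Hom(M, N)) : Prop :=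
  forall g v, f (tact M g v) = tact N g (f v).

Definition inj_hom M N (f : 'Hom(M, N)) : Prop := is_hom f /\ lker f = 0%VS.

Definition surj_hom M N (f : 'Hom(M, N)) : Prop :=
  is_hom f /\ limg f = fullv.

Definition iso M N : Prop := exists f : 'Hom(M, N), inj_hom f /\ surj_hom f.

Definition submod M (U : {vspace M}) : Prop :=
  forall g, (tact M g @: U <= U)%VS.

Definition simple_mod M : Prop :=
  fullv != 0%VS :> {vspace M} /\
  forall U : {vspace M}, submod U -> U = 0%VS \/ U = fullv.

Definition indecomposable M : Prop :=
  fullv != 0%VS :> {vspace M} /\
  forall U V : {vspace M}, submod U -> submod V ->
    (U + V)%VS = fullv -> (U :&: V)%VS = 0%VS -> U = 0%VS \/ V = 0%VS.

Definition projective P : Prop :=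
  forall M N (p : 'Hom(M, N)) (f : 'Hom(P, N)), surj_hom p -> is_hom f ->
    exists2 h : 'Hom(P, M), is_hom h & (p \o h)%VF = f.

Definition injective_mod I : Prop :=
  forall M N (i : 'Hom(M, N)) (f : 'Hom(M, I)), inj_hom i -> is_hom f ->
    exists2 h : 'Hom(N, I), is_hom h & (h \o i)%VF = f.

Definition proj_cover M P : Prop :=
  projective P /\ exists2 p : 'Hom(P, M), surj_hom p &
    forall U : {vspace P}, submod U -> (U + lker p)%VS = fullv -> U = fullv.

Definition inj_envelope M I : Prop :=
  injective_mod I /\ exists2 i : 'Hom(M, I), inj_hom i &
    forall U : {vspace I}, submod U -> (U :&: limg i)%VS = 0%VS -> U = 0%VS.

(* For submodules A <= B of M: the quotient B/A is isomorphic to N. A linear map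
   B -> N is represented by one of its linear extensions to M; only its values
   on B are constrained. *)
Definition subquotient_iso M (A B : {vspace M}) N : Prop :=
  exists f : 'Hom(M, N),
    [/\ forall g v, v \in B -> f (tact M g v) = tact N g (f v),
        (f @: B)%VS = fullv & (B :&: lker f)%VS = A].

Definition filtered (F : tmod k n -> Prop) M : Prop :=
  exists (m : nat) (U : nat -> {vspace M}),
    [/\ U 0%N = 0%VS, U m = fullv,
        forall i, (i <= m)%N -> submod (U i) &
        forall i, (i < m)%N -> (U i <= U i.+1)%VS /\
          exists2 N, F N & subquotient_iso (U i) (U i.+1) N].

End Modules.

Definition is_part (r : nat) (lam : seq nat) : bool :=
  [&& sorted geq lam, 0%N \notin lam & sumn lam == r].

Section Specht.
Variables (k : fieldType) (lam : seq nat).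
Local Notation r := (sumn lam).

(* The cells of the Young diagram of lam are numbered 0, ..., r-1 row after row,
   cell x lying in row [reshape_index lam x] and column
   [reshape_offset lam x]. A tableau is t : 'S_r, with entry t x in cell x. *)
Definition cell_row (x : 'I_r) : nat := reshape_index lam x.
Definition cell_col (x : 'I_r) : nat := reshape_offset lam x.

(* A tabloid is recorded as the sequence of the sets of entries of its rows. *)
Definition rows : Type := {ffun 'I_(size lam) -> {set 'I_r}}.

Definition tabloid (t : 'S_r) : rows :=
  [ffun j : 'I_(size lam) => [set t x | x : 'I_r & cell_row x == j]].

Definition rows_act (s : 'S_r) (w : rows) : rows := [ffun j => s @: w j].

(* A space containing the permutation module M^lam: functions on [rows], the
   basis vector of w being its indicator function. *)
Definition perm_space : vectType k := {ffun rows -> k^o}.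

Definition basis_vec (w : rows) : perm_space := [ffun w' => (w' == w)%:R].

(* Left action for the composition (s s') i = s (s' i): basis_vec w is sent to
   basis_vec (rows_act s w). *)
Definition perm_act (s : 'S_r) (F : perm_space) : perm_space :=
  [ffun w => F (rows_act s^-1%g w)].

Definition col_stab (t s : 'S_r) : bool :=
  [forall x, cell_col ((t^-1)%g (s (t x))) == cell_col x].

Definition polytabloid (t : 'S_r) : perm_space :=
  \sum_(s : 'S_r | col_stab t s)
    (-1) ^+ s *: basis_vec (rows_act s (tabloid t)).

Definition specht : {vspace perm_space} :=
  <<[seq polytabloid t | t : 'S_r]>>%VS.

End Specht.

Definition in_Lambda (n : nat) (lam : seq nat) : bool :=
  is_part (sumn lam) lam && (1 <= sumn lam <= n)%N.

(* The order is reversed with respect to size. *)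
Definition Lambda_le (lam rho : seq nat) : bool :=
  (sumn lam > sumn rho)%N || (lam == rho).

Section QuasiHereditary.
Variables (k : fieldType) (n : nat).
Implicit Types (M D C N P Q I J T : tmod k n) (lam mu : seq nat).

(* Each predicate [is_X lam M] says that M belongs to the isomorphism class
   X(lam). *)

(* e_r M is isomorphic to S(lam) as a k G_{e_r}-module, where r = |lam|. As in
   [subquotient_iso], a linear map S(lam) -> M is represented by one of its
   linear extensions to [perm_space]. *)
Definition apex_specht lam M : Prop :=
  let e := eidem n (sumn lam) in
  exists phi : 'Hom(perm_space k lam, M),
    [/\ (specht k lam :&: lker phi)%VS = 0%VS,
        (phi @: specht k lam)%VS = limg (tact M e) &
        forall (g : trans n) (s : 'S_(sumn lam)) (x : perm_space k lam),
          in_units e g -> restricts_to g s -> x \in specht k lam ->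
          phi (perm_act s x) = tact M g (phi x)].

Definition is_L lam M : Prop :=
  [/\ simple_mod M,
      forall f : trans n, (trank f < sumn lam)%N -> tact M f = 0 &
      apex_specht lam M].

Definition is_P lam P : Prop := exists2 M, is_L lam M & proj_cover M P.

Definition is_I lam I : Prop := exists2 M, is_L lam M & inj_envelope M I.

Definition contains_images lam P (U : {vspace P}) : Prop :=
  forall mu Q (f : 'Hom(Q, P)), in_Lambda n mu -> ~~ Lambda_le mu lam ->
    is_P mu Q -> is_hom f -> (limg f <= U)%VS.

Definition is_Delta lam D : Prop :=
  exists P (p : 'Hom(P, D)),
    [/\ is_P lam P, surj_hom p, contains_images lam (lker p) &
        forall U : {vspace P}, submod U -> contains_images lam U ->
          (lker p <= U)%VS].

Definition is_Nabla lam N : Prop :=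
  exists I (i : 'Hom(N, I)),
    [/\ is_I lam I, inj_hom i &
        forall x : I, x \in limg i <->
          (forall mu J (f : 'Hom(I, J)), in_Lambda n mu ->
             ~~ Lambda_le mu lam -> is_I mu J -> is_hom f -> f x = 0)].

Definition standard D : Prop := exists2 mu, in_Lambda n mu & is_Delta mu D.

Definition costandard N : Prop := exists2 mu, in_Lambda n mu & is_Nabla mu N.

Definition tilting T : Prop := filtered standard T /\ filtered costandard T.

Definition is_T lam T : Prop :=
  [/\ indecomposable T, tilting T &
      exists D C (i : 'Hom(D, T)) (q : 'Hom(T, C)),
        [/\ is_Delta lam D, inj_hom i, surj_hom q, lker q = limg i &
            filtered standard C]].

End QuasiHereditary.

(* Main.v *)
Require Import Defs.
From HB Require Import structures.
From Stdlib Require Import Classical.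
From mathcomp Require Import all_solvable all_character.
Import GRing.Theory.
Local Open Scope ring_scope.

(** Standard modules are k Inj([r], [n]) (x) S(lam) over S_r, with the maps of rank
    [< r] acting as zero, and costandard modules are Hom(k Surj([n], [r]), S(lam)).
    By Maschke, standard modules are relatively projective and costandard ones
    relatively injective for modules killed by rank [< r], and ideals generated by
    idempotents make extensions of standard by costandard modules split; with
    Fitting's lemma this yields the uniqueness of T(lam).

    Injective envelopes I(mu) always have costandard filtrations. For [mu <> (1)]
    they are summands of the functions on T_n modulo constants; mixed difference
    operators show that this module is a direct sum over supports in each rank,
    which amounts to having a standard filtration. So I(mu) = T(lam), where
    Delta(lam) is the bottom layer of the filtration. Then Delta(lam) has simple
    socle L(mu), and the collapsing maps force [mu = lam], or [lam = (1^r)] and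
    [mu = (1^{r+1})]. In the sign case the second alternative holds because the
    boundary of an (r+1)-simplex embeds the sign module of rank [r.+1] in
    k Hom([r], [n]), so that I((1^{r+1})) is nonzero at [e_r]. *)

Set Implicit Arguments.
Unset Strict Implicit.
Unset Printing Implicit Defensive.

(** * Linear algebra and group actions *)

(** For n > 1, functions on [T_n] that depend on the value at one point meet, for different points,
    in the constants. The constants are supported on the empty set, which is the image of no map, so
    the decomposition over supports fails there; the quotient by constants repairs it. The price is
    the weight (1), whose envelope consists of constants. Its place is taken by (1^n): while mu runs
    over the weights other than (1), the bottom standard layers of the I(mu) run over the weights
    other than (1^n), the sign weights being shifted down by one. At size n all maps of smaller rank
    vanish, so L((1^n)) is standard and costandard at once and is its own tilting module.

    The two filtrations are built from opposite ends. At the smallest rank that acts nontrivially, a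
    standard layer splits off as a submodule and a costandard layer as a quotient, and in both cases
    what remains satisfies the same intrinsic condition, so induction on the dimension applies. *)

Section LinearAlgebra.
Variables (k : fieldType).

Lemma vspace0P (V : vectType k) (U : {vspace V}) :
  (forall x, x \in U -> x = 0) -> U = 0%VS.
Proof.
by move=> U0; apply/eqP; rewrite -subv0; apply/subvP => x /U0 ->; rewrite mem0v.
Qed.

Lemma vspace_neq0 (V : vectType k) (U : {vspace V}) :
  U != 0%VS -> exists2 x, x \in U & x != 0.
Proof. by move=> U0; exists (vpick U); rewrite ?memv_pick ?vpick0. Qed.

Lemma capv0P (V : vectType k) (U W : {vspace V}) :
  (forall x, x \in U -> x \in W -> x = 0) -> (U :&: W)%VS = 0%VS.
Proof. by move=> UW; apply: vspace0P => x; rewrite memv_cap => /andP[/UW h /h]. Qed.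

Lemma capv0E (V : vectType k) (U W : {vspace V}) x :
  (U :&: W)%VS = 0%VS -> x \in U -> x \in W -> x = 0.
Proof. by move=> UW xU xW; apply/eqP; rewrite -memv0 -UW memv_cap xU. Qed.

Lemma limg_fullP (V W : vectType k) (f : 'Hom(V, W)) :
  limg f = fullv <-> forall y, exists x, f x = y.
Proof.
split=> [ff y | fs].
  have /memv_imgP[x _ ->] : y \in limg f by rewrite ff memvf.
  by exists x.
apply/eqP; rewrite eqEsubv subvf; apply/subvP => y _.
by have [x <-] := fs y; rewrite memv_img ?memvf.
Qed.

Lemma lker0_inj (V W : vectType k) (f : 'Hom(V, W)) :
  lker f = 0%VS -> injective f.
Proof. by move=> f0; apply/lker0P; rewrite f0. Qed.

Lemma lfun_kerP (V W : vectType k) (f : 'Hom(V, W)) x : x \in lker f <-> f x = 0.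
Proof. by rewrite memv_ker; split=> /eqP. Qed.

Lemma lfun_factor (V W X : vectType k) (f : 'Hom(V, W)) (p : 'Hom(V, X)) :
  (lker f <= lker p)%VS -> forall x, (p \o f^-1)%VF (f x) = p x.
Proof.
move=> /subvP fp x; rewrite lfunE /=; apply/eqP.
rewrite -subr_eq0 -linearB /=; apply/eqP/lfun_kerP/fp/lfun_kerP.
by rewrite linearB /= limg_lfunVK ?memv_img ?memvf // subrr.
Qed.

Lemma lfunVK_inj (V W : vectType k) (f : 'Hom(V, W)) x :
  lker f = 0%VS -> (f^-1)%VF (f x) = x.
Proof. by move=> f0; apply: (lker0_inj f0); rewrite limg_lfunVK ?memv_img ?memvf. Qed.

Lemma dimv_ind (V : vectType k) (P : {vspace V} -> Prop) :
  (forall U, (forall W, (\dim W < \dim U)%N -> P W) -> P U) -> forall U, P U.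
Proof.
move=> IH U; have [m] := ubnP (\dim U); elim: m U => // m IHm U leUm.
by apply: IH => W ltWU; apply: IHm; apply: leq_trans ltWU _.
Qed.

Lemma ltn_dimv (V : vectType k) (U W : {vspace V}) :
  (U <= W)%VS -> U != W -> (\dim U < \dim W)%N.
Proof. by move=> sUW neUW; rewrite (ltn_leqif (dimv_leqif_eq sUW)). Qed.

Lemma memv_dir_uniq (V : vectType k) (U W : {vspace V}) x y x' y' :
  (U :&: W)%VS = 0%VS -> x \in U -> x' \in U -> y \in W -> y' \in W ->
  x + y = x' + y' -> x = x' /\ y = y'.
Proof.
move=> UW xU xU' yW yW' e; have e2 : x - x' = y' - y.
  by apply/eqP; rewrite subr_eq addrAC [y' + _]addrC -e addrK.
have d0 : x - x' = 0 by apply: (capv0E UW); [rewrite memvB | rewrite e2 memvB].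
split; first by apply/eqP; rewrite -subr_eq0 d0.
by apply/eqP; rewrite eq_sym -subr_eq0 -e2 d0.
Qed.

Lemma linear_hom (V W : vectType k) (f : V -> W) :
  linear f -> {F : 'Hom(V, W) | forall x, F x = f x}.
Proof.
move=> flin; pose fL := GRing.isLinear.Build k _ _ _ f flin.
pose F : {linear _ -> _} := HB.pack f fL.
by exists (linfun F) => x; rewrite lfunE.
Qed.

End LinearAlgebra.

(** * Finite group actions on subspaces, and Maschke's theorem *)

Section GroupModules.
Variables (k : fieldType) (gT : finGroupType).
Hypothesis k_char0 : [pchar k] =i pred0.

(** The action is given on all of [V] but trusted only on [U]: the spaces [e_r M] lie in modules [M]
    on which the unit of the local group acts as an idempotent, not as the identity. *)
Definition gstable (V : vectType k) (a : gT -> 'End(V)) (U : {vspace V}) : Prop :=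
  forall s x, x \in U -> a s x \in U.

(* The factors of [t * s] are ordered as for permutations: [(t * s) x = s (t x)]. *)
Definition grep (V : vectType k) (a : gT -> 'End(V)) (U : {vspace V}) : Prop :=
  [/\ gstable a U, forall x, x \in U -> a 1%g x = x &
      forall s t x, x \in U -> a s (a t x) = a (t * s)%g x].

Definition gsimple (V : vectType k) (a : gT -> 'End(V)) (U : {vspace V}) : Prop :=
  U != 0%VS /\
  forall W, (W <= U)%VS -> gstable a W -> W = 0%VS \/ W = U.

Definition giso (V V' : vectType k) (a : gT -> 'End(V)) (U : {vspace V})
    (b : gT -> 'End(V')) (W : {vspace V'}) : Prop :=
  exists phi : 'Hom(V, V'),
    [/\ (U :&: lker phi)%VS = 0%VS, (phi @: U)%VS = W &
        forall s x, x \in U -> phi (a s x) = b s (phi x)].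

Lemma grep_sub (V : vectType k) (a : gT -> 'End(V)) (U W : {vspace V}) :
  grep a U -> (W <= U)%VS -> gstable a W -> grep a W.
Proof.
move=> [_ a1 aM] /subvP sWU sW; split=> // [x /sWU | s t x /sWU]; [exact: a1|exact: aM].
Qed.

Lemma gsimple_gen (V : vectType k) (a : gT -> 'End(V)) (U W : {vspace V}) :
  gsimple a U -> (W <= U)%VS -> gstable a W -> W != 0%VS -> W = U.
Proof. by move=> [_ sU] sWU stW nzW; case: (sU W) => // W0; rewrite W0 eqxx in nzW. Qed.

Lemma exists_gsimple (V : vectType k) (a : gT -> 'End(V)) (U : {vspace V}) :
  gstable a U -> U != 0%VS ->
  exists W, [/\ (W <= U)%VS, gstable a W & gsimple a W].
Proof.
elim/dimv_ind: U => U IH stU nzU.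
have [sU | nsU] := classic (gsimple a U); first by exists U.
have [W /not_or_and[neW0 neWU] [sWU stW]] :
  exists2 W, ~ (W = 0%VS \/ W = U) & (W <= U)%VS /\ gstable a W.
  apply: NNPP => noW; apply: nsU; split=> // W sWU stW; apply: NNPP => hW.
  by apply: noW; exists W.
have /eqP nW0 := neW0; have /eqP nWU := neWU.
have [X [sXW stX sX]] := IH W (ltn_dimv sWU nWU) stW nW0.
by exists X; split=> //; apply: subv_trans sXW sWU.
Qed.

Lemma giso_trans (V1 V2 V3 : vectType k) (a : gT -> 'End(V1)) (b : gT -> 'End(V2))
    (c : gT -> 'End(V3)) U1 U2 U3 :
  giso a U1 b U2 -> giso b U2 c U3 -> giso a U1 c U3.
Proof.
move=> [f [fk fi fe]] [g [gk gi ge]].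
have fU x : x \in U1 -> f x \in U2 by move=> xU; rewrite -fi memv_img.
exists (g \o f)%VF; split.
- apply: capv0P => x xU /lfun_kerP; rewrite lfunE /= => gfx.
  by apply: (capv0E fk xU); apply/lfun_kerP/(capv0E gk (fU _ xU))/lfun_kerP.
- by rewrite limg_comp fi gi.
by move=> s x xU; rewrite !lfunE /= fe // ge // fU.
Qed.

Lemma giso_sym (V1 V2 : vectType k) (a : gT -> 'End(V1)) (b : gT -> 'End(V2)) U1 U2 :
  gstable a U1 -> giso a U1 b U2 -> giso b U2 a U1.
Proof.
move=> st1 [f [fk fi fe]].
pose g := (projv U1 \o (f \o projv U1)^-1)%VF.
have gf x : x \in U1 -> g (f x) = x.
  move=> xU; pose y := ((f \o projv U1)^-1)%VF (f x).
  have : (f \o projv U1)%VF y = f x.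
    apply: limg_lfunVK; apply/memv_imgP; exists x; rewrite ?memvf //.
    by rewrite lfunE /= projv_id.
  rewrite lfunE /= => e; have -> : g (f x) = projv U1 y by rewrite lfunE.
  apply/eqP; rewrite -subr_eq0; apply/eqP/(capv0E fk).
    by rewrite memvB // memv_proj.
  by apply/lfun_kerP; rewrite linearB /= e subrr.
exists g; split.
- apply: capv0P => y; rewrite -fi => /memv_imgP[x xU ->] /lfun_kerP.
  by rewrite gf // => ->; rewrite linear0.
- apply/eqP; rewrite eqEsubv -fi -limg_comp; apply/andP; split; apply/subvP => x.
    by move=> /memv_imgP[y yU ->]; rewrite lfunE /= gf.
  by move=> xU; apply/memv_imgP; exists x => //; rewrite lfunE /= gf.
move=> s y; rewrite -fi => /memv_imgP[x xU ->].
by rewrite -fe // !gf // st1.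
Qed.

Lemma giso_simple (V1 V2 : vectType k) (a : gT -> 'End(V1)) (b : gT -> 'End(V2)) U1 U2 :
  gstable a U1 -> giso a U1 b U2 -> gsimple a U1 -> gsimple b U2.
Proof.
move=> st1 iso12 [nz1 s1].
have [f [fk fi fe]] := iso12.
split.
  have [x xU nzx] := vspace_neq0 nz1; apply/eqP => U20; move/eqP: nzx; apply.
  by apply: (capv0E fk xU); apply/lfun_kerP/eqP; rewrite -memv0 -U20 -fi memv_img.
move=> W sWU stW; pose X := (U1 :&: f @^-1: W)%VS.
have fX : (f @: X)%VS = W.
  apply/eqP; rewrite eqEsubv; apply/andP; split; apply/subvP => y.
    by case/memv_imgP=> x; rewrite memv_cap -memv_preim => /andP[_ h] ->.
  move=> yW; have := subvP sWU _ yW; rewrite -fi => /memv_imgP[x xU e].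
  by rewrite e memv_img // memv_cap xU -memv_preim -e.
case: (s1 X); first exact: capvSl.
- move=> s x; rewrite !memv_cap -!memv_preim => /andP[xU fxW].
  by rewrite st1 //= fe // stW.
- by move=> X0; left; rewrite -fX X0 limg0.
by move=> XU; right; rewrite -fX XU fi.
Qed.

Lemma gsimple_giso_img (V1 V2 : vectType k) (a : gT -> 'End(V1)) (b : gT -> 'End(V2)) U1
    (f : 'Hom(V1, V2)) :
  gstable a U1 -> gsimple a U1 -> (forall s x, x \in U1 -> f (a s x) = b s (f x)) ->
  (f @: U1)%VS != 0%VS -> giso a U1 b (f @: U1)%VS.
Proof.
move=> st1 [nz1 s1] fe nzf; exists f; split=> //.
case: (s1 (U1 :&: lker f)%VS); rewrite ?capvSl //.
  move=> s x; rewrite !memv_cap => /andP[xU /lfun_kerP fx].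
  by rewrite st1 //=; apply/lfun_kerP; rewrite fe // fx linear0.
move=> e; case/negP: nzf; apply/eqP/vspace0P => y /memv_imgP[x xU ->].
by apply/lfun_kerP; move: xU; rewrite -e memv_cap => /andP[].
Qed.

Lemma natr_char0 m : (m.+1%:R != 0 :> k).
Proof.
by rewrite (proj1 (pcharf0P _) k_char0).
Qed.

Lemma card_gT_neq0 : (#|gT|%:R != 0 :> k).
Proof.
have : (0 < #|gT|)%N by apply/card_gt0P; exists 1%g.
by case: #|gT| => // m _; apply: natr_char0.
Qed.

Lemma maschke (V : vectType k) (a : gT -> 'End(V)) (U W : {vspace V}) :
  grep a U -> (W <= U)%VS -> gstable a W ->
  exists W' : {vspace V}, [/\ (W' <= U)%VS, gstable a W', (W + W')%VS = U &
    (W :&: W')%VS = 0%VS].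
Proof.
move=> [stU a1 aM] /subvP sWU stW.
pose T x := #|gT|%:R^-1 *: \sum_s a s (projv W (a s^-1%g x)).
pose avg : 'End(V) := #|gT|%:R^-1 *: \sum_s (a s \o projv W \o a s^-1%g)%VF.
have avgE x : avg x = T x.
  rewrite /avg /T !lfunE /=; congr (_ *: _); rewrite sum_lfunE.
  by apply: eq_bigr => s _; rewrite !lfunE /= lfunE.
have avgW x : avg x \in W.
  by rewrite avgE memvZ // memv_suml // => s _; rewrite stW // memv_proj.
have avg_id x : x \in W -> avg x = x.
  move=> xW; rewrite avgE /T (eq_bigr (fun=> x)).
    rewrite sumr_const -scaler_nat scalerA.
    by rewrite mulVf ?scale1r // card_gT_neq0.
  by move=> s _; rewrite projv_id ?stW // aM ?sWU // mulVg a1 ?sWU.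
have avg_eq t x : x \in U -> avg (a t x) = a t (avg x).
  move=> xU; rewrite !avgE /T [RHS]linearZ /= [in RHS]linear_sum /=; congr (_ *: _).
  rewrite (reindex_inj (mulIg t)) /=; apply: eq_bigr => s _.
  rewrite [a t (a s _)]aM ?sWU ?memv_proj //; congr (a _ (projv W _)).
  by rewrite aM // invMg mulKVg.
(* The average commutes with the group only on [U], so its kernel is cut down to [U]. *)
exists (U :&: lker avg)%VS; split; first exact: capvSl.
- move=> s x; rewrite !memv_cap => /andP[xU /lfun_kerP ax].
  by rewrite stU //=; apply/lfun_kerP; rewrite avg_eq // ax linear0.
- apply/eqP; rewrite eqEsubv subv_add capvSl andbT; apply/andP; split; first exact/subvP.
  apply/subvP => x xU; rewrite -(subrK (avg x) x) addrC memv_add //.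
  rewrite memv_cap; apply/andP; split; first by rewrite memvB // sWU.
  by apply/lfun_kerP; rewrite linearB /= [avg (avg x)]avg_id ?subrr.
apply: capv0P => x xW; rewrite memv_cap => /andP[_ /lfun_kerP].
by rewrite avg_id.
Qed.

End GroupModules.

(** * Specht modules *)

Section Tableaux.
Variable lam : seq nat.
Hypothesis lam_sorted : sorted geq lam.
Local Notation r := (sumn lam).
Implicit Types t : 'S_r.
Local Open Scope nat_scope.

Definition erow t (y : 'I_r) : nat := cell_row (t^-1%g y).
Definition ecol t (y : 'I_r) : nat := cell_col (t^-1%g y).

Lemma entry_inj t x y : erow t x = erow t y -> ecol t x = ecol t y -> x = y.
Proof.
rewrite /erow /ecol /cell_row /cell_col => er ec; apply: (@perm_inj _ t^-1%g).
by apply: val_inj; rewrite /= -(reshape_indexK lam (t^-1%g x)) er ec reshape_indexK.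
Qed.

Lemma entry_above t x i : i < erow t x -> exists2 y, erow t y = i & ecol t y = ecol t x.
Proof.
move=> ltix; have lc : ecol t x < nth 0 lam i.
  apply: leq_trans (reshape_offsetP (ltn_ord (t^-1%g x))) _.
  apply: (sorted_leq_nth (leT := geq)) => //; rewrite ?inE.
  - by move=> a b c /= ab bc; apply: leq_trans bc ab.
  - by move=> a /=.
  - by apply: ltn_trans ltix _; apply: reshape_indexP.
  - by apply: reshape_indexP.
  by apply: ltnW.
exists (t (Ordinal (flatten_indexP lc))); rewrite /erow /ecol permK.
  by rewrite /cell_row /= flatten_indexKl.
by rewrite /cell_col /= flatten_indexKr.
Qed.

Lemma ecol_lt t x : ecol t x < r.
Proof. by apply: leq_ltn_trans (leq_subr _ _) (ltn_ord _). Qed.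

(** [R'] stands for the row function of a second tableau, possibly of another shape: no two entries
    share a column of [t] and a row of that tableau. *)
Definition col_inj t (R' : 'I_r -> nat) :=
  forall x y, ecol t x = ecol t y -> R' x = R' y -> x = y.

Definition col_part t (R' : 'I_r -> nat) c j := [set x | (ecol t x == c) && (R' x < j)].

(** By injectivity a column has at most [j] entries with [R' < j], and of course no more than its
    length. The rows of [t] itself attain the smaller of these two bounds, since columns of a Young
    diagram have no gaps above a cell. *)
Lemma col_count t (R' : 'I_r -> nat) c j : col_inj t R' ->
  #|col_part t R' c j| <= #|col_part t (erow t) c j|.
Proof.
move=> injR; case: (pickP (fun x => (ecol t x == c) && (j <= erow t x))) => [x|no].
  case/andP=> /eqP ec lejx; apply: (@leq_trans j).
    rewrite cardE -(size_map R') -[leqRHS](size_iota 0); apply: uniq_leq_size.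
      rewrite map_inj_in_uniq ?enum_uniq // => y z; rewrite !mem_enum !inE.
      by move=> /andP[/eqP yc _] /andP[/eqP zc _]; apply: injR; rewrite yc zc.
    move=> _ /mapP[y + ->]; rewrite mem_enum inE => /andP[_ ltj].
    by rewrite mem_iota.
  rewrite cardE -(size_map (erow t)) -[leqLHS](size_iota 0); apply: uniq_leq_size.
    exact: iota_uniq.
  move=> i; rewrite mem_iota add0n /= => ltij.
  have [y er ey] := entry_above (leq_trans ltij lejx).
  by apply/mapP; exists y => //; rewrite mem_enum inE er ltij andbT ey ec.
apply/subset_leq_card/subsetP => x; rewrite !inE => /andP[xc _]; rewrite xc /=.
by have := no x; rewrite xc /= leqNgt => /negbFE.
Qed.

Lemma card_cols t (R' : 'I_r -> nat) j :
  #|[set x | R' x < j]| = \sum_(c < r) #|col_part t R' c j|.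
Proof.
rewrite -sum1_card (partition_big (fun x => Ordinal (ecol_lt t x)) predT) //=.
apply: eq_bigr => c _; rewrite -sum1_card; apply: eq_bigl => x.
by rewrite !inE andbC.
Qed.

Lemma row_count t (R' : 'I_r -> nat) j : col_inj t R' ->
  #|[set x | R' x < j]| <= #|[set x | erow t x < j]|.
Proof.
by move=> injR; rewrite !(card_cols t); apply: leq_sum => c _; apply: col_count.
Qed.

(** The totals are sums over columns of counts bounded termwise by [col_count], so equal totals
    force equality in every column. Hence each column of [t] has an entry with each [R'] value that
    its rows take, and matching these values is a column permutation. *)
Lemma col_sort t (R' : 'I_r -> nat) : col_inj t R' ->
  (forall j, #|[set x | R' x < j]| = #|[set x | erow t x < j]|) ->
  exists s : 'S_r, col_stab t s /\ forall x, R' (s x) = erow t x.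
Proof.
move=> injR eqc.
have eqcc c j : #|col_part t R' (c : 'I_r) j| = #|col_part t (erow t) c j|.
  have /leqif_sum := fun (i : 'I_r) (_ : true) => leqif_eq (col_count i j injR).
  move=> /= [_]; rewrite -!card_cols eqc eqxx => /esym/forallP/(_ c).
  by move/eqP.
have ex x : exists y, (ecol t y == ecol t x) && (R' y == erow t x).
  have ltcc : #|col_part t R' (ecol t x) (erow t x)| <
              #|col_part t R' (ecol t x) (erow t x).+1|.
    have := eqcc (Ordinal (ecol_lt t x)) => /= eqx; rewrite !eqx.
    apply/proper_card/properP; split; last first.
      by exists x; rewrite !inE eqxx /= ?ltnS ?leqnn ?ltnn.
    by apply/subsetP => y; rewrite !inE => /andP[-> /ltnW].
  have : ~~ (col_part t R' (ecol t x) (erow t x).+1 \subset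
             col_part t R' (ecol t x) (erow t x)).
    by apply: contraL ltcc => /subset_leq_card; rewrite leqNgt.
  case/subsetPn=> y; rewrite !inE => /andP[ey le1]; rewrite ey /= -leqNgt => le2.
  by exists y; rewrite ey eqn_leq le2 andbT -ltnS.
pose f x := xchoose (ex x).
have fP x : ecol t (f x) = ecol t x /\ R' (f x) = erow t x.
  by have /andP[/eqP ? /eqP ?] := xchooseP (ex x).
have finj : injective f.
  move=> x y e; have [c1 r1] := fP x; have [c2 r2] := fP y.
  by apply: (@entry_inj t); rewrite -?c1 -?c2 -?r1 -?r2 e.
exists (perm finj); split; last by move=> x; rewrite [perm finj _]permE; case: (fP x).
apply/forallP => x; have [c1 _] := fP (t x).
by rewrite [perm finj _]permE; move: c1; rewrite /ecol permK => ->.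
Qed.

Lemma tabloidE t j y : (y \in tabloid t j) = (erow t y == j :> nat).
Proof.
rewrite ffunE /erow; apply/imsetP/idP => [[x /[!inE] xj ->]|yj].
  by rewrite permK.
by exists (t^-1%g y); rewrite ?inE ?permKV.
Qed.

Lemma erow_lt t y : erow t y < size lam.
Proof. exact: reshape_indexP. Qed.

Lemma tabloid_eqP t t' (s : 'S_r) :
  (forall x, erow t' (s x) = erow t x) -> tabloid t' = rows_act s (tabloid t).
Proof.
move=> er; apply/ffunP => j; rewrite [RHS]ffunE; apply/setP => y.
rewrite tabloidE; apply/idP/imsetP => [yj|[x + ->]].
  by exists (s^-1%g y); rewrite ?permKV // tabloidE -er permKV.
by rewrite tabloidE er.
Qed.

Lemma card_erow t t' j : #|[set x | erow t' x < j]| = #|[set x | erow t x < j]|.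
Proof.
suffices h u : #|[set x | erow u x < j]| = #|[set x : 'I_r | cell_row x < j]| by rewrite !h.
rewrite -(card_imset _ (@perm_inj _ u^-1%g)); congr #|pred_of_set _|.
apply/setP => y; rewrite inE; apply/imsetP/idP => [[x + ->]|yj]; first by rewrite inE.
by exists (u y); rewrite ?inE /erow permK.
Qed.

End Tableaux.

(** * Polytabloids and simplicity of Specht modules *)

Section SpechtModules.
Variables (k : fieldType) (k_char0 : [pchar k] =i pred0).

Section Action.
Variables (r : nat) (V : vectType k) (a : 'S_r -> 'End(V)) (C : pred 'S_r).

(** The signed column sum, kept independent of a shape: [specht_dominance] applies the column group
    of a tableau of shape [lam] to the permutation module of [mu]. *)
Definition antisym (x : V) : V := \sum_(s | C s) (-1) ^+ s *: a s x.

Lemma antisym_linear : linear antisym.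
Proof.
move=> c x y; rewrite /antisym scaler_sumr -big_split /=; apply: eq_bigr => s _.
by rewrite linearP scalerDr !scalerA mulrC.
Qed.
HB.instance Definition _ := GRing.isLinear.Build k V V _ antisym antisym_linear.

Hypothesis CM : forall s t, C s -> C (t * s)%g = C t.
Variable U : {vspace V}.
Hypothesis repU : grep a U.

Lemma antisym_act u x : x \in U -> C u -> antisym (a u x) = (-1) ^+ u *: antisym x.
Proof.
move=> xU Cu; have [_ a1 aM] := repU.
rewrite /antisym scaler_sumr [RHS](reindex_inj (mulgI u)) /=.
have CuM s : C (u * s)%g = C s.
  have C1 : C 1%g by rewrite -(CM 1%g Cu) mul1g.
  have CV v : C v -> C v^-1%g by move=> Cv; rewrite -(CM v^-1%g Cv) mulVg.
  apply/idP/idP => h; last by rewrite CM.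
  by have := CV _ Cu; rewrite -(CM _ h) mulgA mulVg mul1g.
apply: eq_big => s; first by rewrite CuM.
move=> Cs; rewrite aM // scalerA odd_permM signr_addb mulrA -signr_addb.
by rewrite addbb mul1r.
Qed.

Lemma antisym_stable x : gstable a U -> x \in U -> antisym x \in U.
Proof. by move=> stU xU; apply: memv_suml => s _; rewrite memvZ // stU. Qed.

Lemma antisym_fixed x u : x \in U -> C u -> odd_perm u -> a u x = x -> antisym x = 0.
Proof.
move=> xU Cu ou fx; have := antisym_act xU Cu; rewrite fx ou scaleN1r.
move/eqP; rewrite -subr_eq0 opprK -mulr2n -scaler_nat scaler_eq0.
by rewrite (negPf (natr_char0 k_char0 1)) => /eqP.
Qed.

Lemma antisym_idem x : x \in U -> antisym (antisym x) = #|C|%:R *: antisym x.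
Proof.
move=> xU; rewrite {2}/antisym linear_sum /= (eq_bigr (fun=> antisym x)).
  by rewrite sumr_const scaler_nat.
by move=> s Cs; rewrite linearZ /= antisym_act // scalerA -signr_addb addbb scale1r.
Qed.
End Action.

Section Perm.
Variable lam : seq nat.
Local Notation r := (sumn lam).

Lemma perm_act_linear (s : 'S_r) : linear (@perm_act k lam s).
Proof. by move=> c x y; apply/ffunP => w; rewrite !ffunE. Qed.
HB.instance Definition _ (s : 'S_r) :=
  GRing.isLinear.Build k _ _ _ (@perm_act k lam s) (perm_act_linear s).

Definition pact (s : 'S_r) : 'End(perm_space k lam) := linfun (@perm_act k lam s).

Lemma rows_actM (s t : 'S_r) (w : rows lam) :
  rows_act s (rows_act t w) = rows_act (t * s)%g w.
Proof.
apply/ffunP => j; rewrite !ffunE -imset_comp; apply: eq_imset => x /=.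
by rewrite permM.
Qed.

Lemma rows_act1 (w : rows lam) : rows_act 1%g w = w.
Proof.
apply/ffunP => j; rewrite ffunE -[RHS]imset_id; apply: eq_imset => x.
by rewrite perm1.
Qed.

Lemma pactM (s t : 'S_r) x : pact s (pact t x) = pact (t * s)%g x.
Proof. by rewrite !lfunE /=; apply/ffunP => w; rewrite !ffunE rows_actM invMg. Qed.

Lemma pact1 x : pact 1%g x = x.
Proof. by rewrite !lfunE /=; apply/ffunP => w; rewrite !ffunE invg1 rows_act1. Qed.

Lemma pact_basis (s : 'S_r) w : pact s (basis_vec k w) = basis_vec k (rows_act s w).
Proof.
rewrite lfunE /=; apply/ffunP => w'; rewrite !ffunE; congr (_ %:R); congr nat_of_bool.
apply/eqP/eqP => [<-|->]; rewrite rows_actM ?mulVg ?mulgV rows_act1 //.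
Qed.

Lemma pact_rep U : gstable pact U -> grep pact U.
Proof. by move=> stU; split=> // *; rewrite ?pact1 ?pactM. Qed.

Lemma tabloidM (s t : 'S_r) : rows_act s (tabloid t) = tabloid (t * s)%g.
Proof.
apply/ffunP => j; rewrite !ffunE -imset_comp; apply: eq_imset => x /=.
by rewrite permM.
Qed.

Lemma polytabloidE (t : 'S_r) :
  polytabloid k t = antisym pact (col_stab t) (basis_vec k (tabloid t)).
Proof. by apply: eq_bigr => s _; rewrite pact_basis. Qed.

Lemma col_stabE (t s : 'S_r) : col_stab t s = [forall x, ecol t (s x) == ecol t x].
Proof.
apply/forallP/forallP => h x; last by have := h (t x); rewrite /ecol permK.
by have := h (t^-1%g x); rewrite /ecol permKV.
Qed.

Lemma col_stabM (t u s : 'S_r) : col_stab t s -> col_stab t (u * s)%g = col_stab t u.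
Proof.
rewrite !col_stabE => /forallP hs; apply: eq_forallb => x.
by rewrite permM (eqP (hs _)).
Qed.

Lemma pact_polytabloid (s t : 'S_r) : pact s (polytabloid k t) = polytabloid k (t * s)%g.
Proof.
rewrite /polytabloid linear_sum /= [RHS](reindex_inj (conjg_inj s)) /=.
apply: eq_big => u.
  rewrite !col_stabE; apply/forallP/forallP => h x.
    by have := h (s^-1%g x); rewrite /ecol conjgE !invMg !permM permK.
  by have := h (s x); rewrite /ecol conjgE !invMg !permM !permK.
move=> _; rewrite linearZ /= pact_basis tabloidM odd_permJ; congr (_ *: _).
congr (basis_vec _ _); rewrite !tabloidM; congr (tabloid _).
by rewrite conjgE !mulgA mulgK.
Qed.

Lemma specht_stable : gstable pact (specht k lam).
Proof.
move=> s x; rewrite /specht => xS.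
have : pact s x \in (pact s @: <<[seq polytabloid k t | t : 'S_r]>>)%VS by rewrite memv_img.
rewrite limg_span; apply: subvP; apply/span_subvP => y /mapP[z /mapP[t _ ->] ->].
by rewrite pact_polytabloid memv_span // map_f // mem_enum.
Qed.

Lemma polytabloid_mem t : polytabloid k t \in specht k lam.
Proof. by rewrite memv_span // map_f // mem_enum. Qed.

Lemma specht_gen U : gstable pact U -> forall t, polytabloid k t \in U ->
  (specht k lam <= U)%VS.
Proof.
move=> stU t tU; apply/span_subvP => x /mapP[u _ ->].
by rewrite -(mulKVg t u) -pact_polytabloid stU.
Qed.

(** The genuine permutation module M^lam; [perm_space] also has basis vectors for sequences of sets
    that are not tabloids, and on those the signed column sum is not controlled. *)
Definition tabloids := <<[seq basis_vec k (tabloid t) | t : 'S_r]>>%VS.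

Lemma tabloid_mem (t : 'S_r) : basis_vec k (tabloid t) \in tabloids.
Proof.
by rewrite memv_span //; apply/mapP; exists t; rewrite ?mem_enum.
Qed.

Lemma specht_tabloids : (specht k lam <= tabloids)%VS.
Proof.
apply/span_subvP => x /mapP[t _ ->]; apply: memv_suml => s _; rewrite memvZ //.
by rewrite tabloidM tabloid_mem.
Qed.

Lemma polytabloid_neq0 (t : 'S_r) : polytabloid k t != 0.
Proof.
apply/eqP => /ffunP/(_ (tabloid t)).
rewrite sum_ffunE (bigID (fun s : 'S_r => rows_act s (tabloid t) == tabloid t)) /=.
rewrite [X in _ + X]big1 ?addr0; last first.
  by move=> s /andP[_ ne]; rewrite !ffunE eq_sym (negPf ne) scaler0.
(* a column permutation fixing the tabloid fixes every entry *)
rewrite (big_pred1 1%g) => [|s].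
  by rewrite odd_perm1 !ffunE rows_act1 eqxx scale1r => /eqP; rewrite oner_eq0.
apply/andP/eqP => [[]|->]; last first.
  by rewrite rows_act1; split=> //; apply/forallP => x; rewrite perm1 permK.
rewrite col_stabE => /forallP cs /eqP fx; apply/permP => x; rewrite perm1.
apply: (@entry_inj lam t); last exact/eqP.
have : x \in tabloid t (Ordinal (erow_lt t x)) by rewrite tabloidE.
move/(imset_f s); have := congr1 (fun w : rows lam => w (Ordinal (erow_lt t x))) fx.
rewrite [in LHS]ffunE => ->.
by rewrite tabloidE => /eqP.
Qed.

Hypothesis lam_sorted : sorted geq lam.

Lemma card_col_stab_neq0 (t : 'S_r) : #|col_stab t|%:R != 0 :> k.
Proof.
have : (0 < #|col_stab t|)%N.
  by apply/card_gt0P; exists 1%g; rewrite unfold_in; apply/forallP => x; rewrite perm1 permK.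
by case: #|_| => // m _; apply: natr_char0.
Qed.

Lemma fullv_grep : grep pact fullv.
Proof. by apply: pact_rep => s x _; rewrite memvf. Qed.

(** If two entries share a column of [t] and a row of [t'], their transposition is an odd column
    permutation fixing the tabloid, and the sum vanishes. Otherwise [col_sort] moves the tabloid of
    [t] to that of [t'] by a column permutation, and the sum is the polytabloid up to sign. *)
Lemma antisym_tabloid (t t' : 'S_r) :
  antisym pact (col_stab t) (basis_vec k (tabloid t')) \in <[polytabloid k t]>%VS.
Proof.
have CM := @col_stabM t.
have [/existsP[x /existsP[y /and3P[/eqP ec /eqP er ne]]] | no] := boolP
  [exists x, exists y, [&& ecol t x == ecol t y, erow t' x == erow t' y & x != y]].
  rewrite (antisym_fixed (fun s u => @CM u s) fullv_grep (u := tperm x y)) ?mem0v ?memvf //.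
  - rewrite col_stabE; apply/forallP => z.
    by case: tpermP => [->|->|_ _]; rewrite ?ec.
  - by rewrite odd_tperm ne.
  rewrite pact_basis -(@tabloid_eqP lam t' t' (tperm x y)) // => z.
  by case: tpermP => [->|->|_ _]; rewrite ?er.
have [| |s [Cs /tabloid_eqP ->]] := col_sort lam_sorted (t := t) (R' := erow t').
  - move=> x y ec er; apply: contraNeq no => ne; apply/existsP; exists x.
    by apply/existsP; exists y; rewrite ec er ne !eqxx.
  - by move=> j; apply: card_erow.
rewrite -pact_basis (antisym_act (fun s u => @CM u s) fullv_grep) ?memvf //.
by rewrite -polytabloidE memvZ // memv_line.
Qed.

Lemma antisym_tabloids (t : 'S_r) x : x \in tabloids ->
  antisym pact (col_stab t) x \in <[polytabloid k t]>%VS.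
Proof.
move=> /(memv_img (linfun (antisym pact (col_stab t)))); rewrite lfunE /=.
rewrite limg_span; apply: subvP; apply/span_subvP => y /mapP[z /mapP[t' _ ->] ->].
by rewrite lfunE /= antisym_tabloid.
Qed.

Lemma antisym_polytabloid (t : 'S_r) :
  antisym pact (col_stab t) (polytabloid k t) = #|col_stab t|%:R *: polytabloid k t.
Proof.
by rewrite {1}polytabloidE (antisym_idem (fun s u => @col_stabM t u s) fullv_grep) ?memvf -?polytabloidE.
Qed.

(** A form of James's argument with Maschke in place of the bilinear form. Split a polytabloid along
    [W] and a complement. The signed column sum multiplies the polytabloid by a nonzero number, so
    it cannot kill both parts; it sends the surviving part to a nonzero multiple of the polytabloid,
    which generates everything. *)
Lemma specht_simple : gsimple pact (specht k lam).
Proof.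
split.
  apply/eqP => S0; have := polytabloid_mem (1%g : 'S_r).
  by rewrite S0 memv0 (negPf (polytabloid_neq0 _)).
move=> W sWS stW; have [W' [sWS' stW' WW' dWW']] :=
  maschke k_char0 (pact_rep specht_stable) sWS stW.
pose t : 'S_r := 1%g; pose K := antisym pact (col_stab t).
have mem (U : {vspace _}) u : (U <= specht k lam)%VS -> gstable pact U -> u \in U ->
    K u != 0 -> U = specht k lam.
  move=> sU stU uU nz; apply/eqP; rewrite eqEsubv sU; apply: (specht_gen stU (t := t)).
  have := antisym_tabloids t (subvP specht_tabloids _ (subvP sU _ uU)).
  case/vlineP=> c e; have : K u \in U by apply: antisym_stable.
  move: nz; rewrite /K e scaler_eq0 negb_or => /andP[nzc _] ceU.
  by rewrite -[polytabloid k t]scale1r -(mulVf nzc) -scalerA memvZ.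
have : polytabloid k t \in (W + W')%VS by rewrite WW' polytabloid_mem.
case/memv_addP=> u uW [u' uW' e].
have [Ku0 | nzu] := eqVneq (K u) 0; last by right; apply: mem nzu.
left; have -> : W = (W :&: W')%VS; last by [].
rewrite (mem W' u') ?(capv_idPl _) //; apply: contraNneq (card_col_stab_neq0 t) => Ku'0.
have := antisym_polytabloid t; rewrite {1}e linearD /= -/(K u) -/(K u') Ku0 Ku'0 addr0.
by move/esym/eqP; rewrite scaler_eq0 (negPf (polytabloid_neq0 _)) orbF.
Qed.

End Perm.
End SpechtModules.

(** * Partial sums of partitions *)

Section PartitionCounts.
Local Open Scope nat_scope.

Lemma leq_sumn_take (lam : seq nat) i j : i <= j -> sumn (take i lam) <= sumn (take j lam).
Proof.
move=> /subnKC <-; elim: {j}(j - i) => [|m IH]; first by rewrite addn0.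
apply: leq_trans IH _; rewrite addnS; have [lt|ge] := ltnP (i + m) (size lam).
  by rewrite (take_nth 0) // sumn_rcons leq_addr.
by rewrite !take_oversize // ltnW.
Qed.

(** Cells are numbered row after row, so the first [j] rows form an initial segment. *)
Lemma reshape_index_lt (lam : seq nat) c j : c < sumn lam ->
  (reshape_index lam c < j) = (c < sumn (take j lam)).
Proof.
move=> ltc; have := reshape_offsetP ltc; have := reshape_indexP ltc.
have := reshape_indexK lam c; rewrite /flatten_index.
set i := reshape_index lam c; move: (reshape_offset lam c) => o eqc lti lto.
rewrite -eqc; have [ltij|leji] := ltnP i j.
  by rewrite (leq_trans _ (leq_sumn_take lam ltij)) // (take_nth 0) // sumn_rcons ltn_add2l.
by apply/esym/negbTE; rewrite -leqNgt (leq_trans (leq_sumn_take lam leji)) // leq_addr.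
Qed.

Lemma card_cell_row (lam : seq nat) j :
  #|[set c : 'I_(sumn lam) | cell_row c < j]| = sumn (take j lam).
Proof.
have le : sumn (take j lam) <= sumn lam.
  by rewrite -{2}(cat_take_drop j lam) sumn_cat leq_addr.
have winj : injective (widen_ord le) by move=> x y /(congr1 val) /= /val_inj.
rewrite -[RHS]card_ord -(card_imset _ winj).
congr #|pred_of_set _|; apply/setP => c; rewrite inE /cell_row reshape_index_lt ?ltn_ord //.
apply/idP/imsetP => [ltc | [x _ ->]]; last by rewrite /= ltn_ord.
by exists (Ordinal ltc) => //; apply: val_inj.
Qed.

Lemma part_eq (lam mu : seq nat) : 0 \notin lam -> 0 \notin mu ->
  (forall j, sumn (take j lam) = sumn (take j mu)) -> lam = mu.
Proof.
have nthE (s : seq nat) i : sumn (take i s) + nth 0 s i = sumn (take i.+1 s).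
  have [lt|ge] := ltnP i (size s); first by rewrite (take_nth 0) // sumn_rcons.
  by rewrite nth_default // addn0 !take_oversize // ltnW.
move=> l0 m0 eqs; have eqn i : nth 0 lam i = nth 0 mu i.
  by apply/eqP; rewrite -(eqn_add2l (sumn (take i lam))) nthE (eqs i) nthE eqs.
have sz s t : 0 \notin s -> (forall i, nth 0 s i = nth 0 t i) -> size s <= size t.
  move=> s0 e; rewrite leqNgt; apply: contra s0 => lt.
  by rewrite -(@nth_default _ 0 t (size t)) // -e mem_nth.
apply: (@eq_from_nth _ 0) => //.
by apply/eqP; rewrite eqn_leq !sz.
Qed.
End PartitionCounts.

(** * Specht modules of different shapes, and the sign representation *)

Section SpechtClassification.
Variables (k : fieldType) (k_char0 : [pchar k] =i pred0).

(** Transport along [sumn lam = d] turns Specht modules of different shapes into modules of one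
    group ['S_d]; the types ['S_(sumn lam)] and ['S_(sumn mu)] are not convertible. *)
Definition sact (lam : seq nat) (d : nat) (e : sumn lam = d) (s : 'S_d) :
    'End(perm_space k lam) :=
  pact k (cast_perm (esym e) s).

Lemma sact_id lam (s : 'S_(sumn lam)) : sact erefl s = pact k s.
Proof. by rewrite /sact cast_perm_id. Qed.

Lemma sact_rep lam d (e : sumn lam = d) : grep (sact e) (specht k lam).
Proof.
case: d / e; split=> [s x|x _|s t x _]; rewrite !sact_id ?pact1 ?pactM //.
exact: specht_stable.
Qed.

Lemma sact_simple lam d (e : sumn lam = d) : sorted geq lam ->
  gsimple (sact e) (specht k lam).
Proof.
move=> sl; case: d / e; have [nz s] := specht_simple k_char0 sl.
split=> // W sW stW; apply: s => // u x xW; rewrite -sact_id; exact: stW.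
Qed.

(** The signed column sum of a tableau of shape [lam] is nonzero on its polytabloid, hence on the
    image in M^mu, hence on some tabloid of shape [mu]. No transposition of the column group can
    then fix that tabloid, which is the injectivity that [row_count] needs. *)
Lemma specht_dominance lam mu (e : sumn mu = sumn lam) : sorted geq lam ->
  giso (pact k (lam := lam)) (specht k lam) (sact e) (specht k mu) ->
  forall j, (sumn (take j mu) <= sumn (take j lam))%N.
Proof.
move=> sl [phi [phik phii phie]] j.
pose t : 'S_(sumn lam) := 1%g; pose C := col_stab t.
have repmu : grep (sact e) fullv.
  split=> [s x _|x _|s u x _]; rewrite ?memvf // /sact ?pactM ?cast_perm_morphM //.
  rewrite -[RHS](pact1 x); congr (pact k _ x).
  by apply/permP => y; rewrite cast_permE !perm1; apply: val_inj.
have CM s u : C s -> C (u * s)%g = C u by apply: col_stabM.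
have etS := polytabloid_mem k t.
have phi_anti x : x \in specht k lam ->
    phi (antisym (pact k (lam := lam)) C x) = antisym (sact e) C (phi x).
  move=> xS; rewrite linear_sum /=; apply: eq_bigr => s _.
  by rewrite linearZ /= phie.
have nz : antisym (sact e) C (phi (polytabloid k t)) != 0.
  rewrite -phi_anti // antisym_polytabloid linearZ /= scaler_eq0 negb_or.
  rewrite card_col_stab_neq0 //=; apply/eqP => /lfun_kerP h.
  by move/eqP: (polytabloid_neq0 k t); apply; apply: (capv0E phik).
have [t' nzt'] : exists t' : 'S_(sumn mu),
    antisym (sact e) C (basis_vec k (tabloid t')) != 0.
  apply/existsP; apply: contraNT nz => /existsPn h.
  have : phi (polytabloid k t) \in tabloids k mu.
    by apply: (subvP (specht_tabloids k mu)); rewrite -phii memv_img.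
  move=> /(memv_img (linfun (antisym (sact e) C))); rewrite lfunE /= limg_span => xin.
  rewrite -memv0; apply: subvP xin; apply/span_subvP => y /mapP[z /mapP[u _ ->] ->].
  by have /negbNE := h u; rewrite lfunE /= memv0.
pose R' (x : 'I_(sumn lam)) := erow t' (cast_ord (esym e) x).
have injR : col_inj t R'.
  move=> x y ec er; apply: contraNeq nzt' => ne; apply/eqP.
  apply: (antisym_fixed k_char0 CM repmu (u := tperm x y)); rewrite ?memvf //.
  - by rewrite /C col_stabE; apply/forallP => z; case: tpermP => [->|->|_ _]; rewrite ?ec.
  - by rewrite odd_tperm ne.
  rewrite /sact pact_basis -(@tabloid_eqP mu t' t') // => z.
  rewrite cast_permE esymK; case: tpermP => [zx|zy|_ _]; last by rewrite cast_ordK.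
    by rewrite -[RHS](congr1 (erow t') (cast_ordK e z)) zx; exact/esym.
  by rewrite -[RHS](congr1 (erow t') (cast_ordK e z)) zy.
have := row_count sl j injR.
rewrite [leqRHS](_ : _ = sumn (take j lam)); last first.
  rewrite -card_cell_row; apply: eq_card => x.
  by rewrite !inE /erow invg1 perm1.
suff -> : #|[set x | (R' x < j)%N]| = sumn (take j mu) by [].
rewrite -card_cell_row -(card_imset _ (inj_comp (@perm_inj _ t'^-1%g) (@cast_ord_inj _ _ (esym e)))).
congr #|pred_of_set _|; apply/setP => c; rewrite inE.
apply/imsetP/idP => [[x + ->]|ltc]; first by rewrite inE.
exists (cast_ord e (t' c)); last by rewrite /= cast_ordK permK.
by rewrite inE /R' cast_ordK /erow permK.
Qed.

Lemma specht_dominance_cast d lam mu (e1 : sumn lam = d) (e2 : sumn mu = d) :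
  sorted geq lam -> giso (sact e1) (specht k lam) (sact e2) (specht k mu) ->
  forall j, (sumn (take j mu) <= sumn (take j lam))%N.
Proof.
move=> sl; case: d / e1 e2 => e2 [phi [phik phii phie]].
by apply: (specht_dominance sl (e := e2)); exists phi; split=> // s x xS; rewrite -phie ?sact_id.
Qed.

Lemma specht_distinct lam mu d (e1 : sumn lam = d) (e2 : sumn mu = d) :
  is_part d lam -> is_part d mu ->
  giso (sact e1) (specht k lam) (sact e2) (specht k mu) -> lam = mu.
Proof.
move=> /and3P[sl l0 _] /and3P[sm m0 _].
move=> iso12; have [st1 _ _] := sact_rep e1.
apply: part_eq => // j; apply/eqP; rewrite eqn_leq.
by rewrite (specht_dominance_cast sm (giso_sym st1 iso12)) (specht_dominance_cast sl iso12).
Qed.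

Lemma sumn_nseq1 d : sumn (nseq d 1%N) = d.
Proof. by rewrite sumn_nseq mul1n. Qed.

Lemma nseq1_part d : is_part d (nseq d 1%N).
Proof.
rewrite /is_part sumn_nseq1 eqxx andbT mem_nseq andbF andbT.
by elim: d => // -[|d] //= ->.
Qed.

(** The diagram of (1^d) is a single column, so every permutation is a column permutation. *)
Lemma specht_sign_line d (t : 'S_(sumn (nseq d 1%N))) x : x \in specht k (nseq d 1%N) ->
  pact k t x = (-1) ^+ t *: x /\ x \in <[polytabloid k (1%g : 'S_(sumn (nseq d 1%N)))]>%VS.
Proof.
have col0 (u s : 'S_(sumn (nseq d 1%N))) : col_stab u s.
  have c0 c : cell_col (c : 'I_(sumn (nseq d 1%N))) = 0%N.
    have := reshape_offsetP (ltn_ord c); rewrite nth_nseq; case: ifP => // _.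
    by rewrite ltnS leqn0 => /eqP.
  by apply/forallP => y; rewrite !c0.
have pE s : polytabloid k (s : 'S_(sumn (nseq d 1%N))) = (-1) ^+ s *: polytabloid k 1%g.
  rewrite -{1}(mul1g s) polytabloidE -tabloidM -pact_basis.
  rewrite (antisym_act (fun u v => @col_stabM _ (1 * s)%g v u) (fullv_grep k _)) ?memvf //.
  by congr (_ *: _); rewrite polytabloidE; apply: eq_bigl => u; rewrite !col0.
move=> xS; have /vlineP[c ->] : x \in <[polytabloid k (1%g : 'S_(sumn (nseq d 1%N)))]>%VS.
  apply: subvP xS; apply/span_subvP => y /mapP[u _ ->].
  by rewrite pE memvZ // memv_line.
split; last by rewrite memvZ // memv_line.
by rewrite linearZ /= pact_polytabloid mul1g pE !scalerA mulrC.
Qed.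

Lemma odd_cast_perm m n (e : m = n) (s : 'S_m) : odd_perm (cast_perm e s) = odd_perm s.
Proof. by case: n / e; rewrite cast_perm_id. Qed.

Lemma sact_sign d (e : sumn (nseq d 1%N) = d) (s : 'S_d) x : x \in specht k (nseq d 1%N) ->
  sact e s x = (-1) ^+ s *: x.
Proof.
move=> xS; rewrite /sact (specht_sign_line _ xS).1; congr (_ *: _); congr (_ ^+ nat_of_bool _).
exact: odd_cast_perm.
Qed.

Lemma sign_of_tperm (V : vectType k) d (a : 'S_d -> 'End(V)) (U : {vspace V}) v :
  grep a U -> v \in U -> (forall i j, i != j -> a (tperm i j) v = - v) ->
  forall s : 'S_d, a s v = (-1) ^+ s *: v.
Proof.
move=> [stU a1 aM] vU sgn s; have [ts -> ats] := prod_tpermP s.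
elim: ts ats => [_|[i j] ts IH /= /andP[ne /IH{}IH]].
  by rewrite big_nil odd_perm1 scale1r a1.
rewrite big_cons -aM // sgn // linearN /= IH odd_permM odd_tperm ne signr_addb.
by rewrite expr1 mulN1r scaleNr.
Qed.

Lemma sign_giso (V : vectType k) d (a : 'S_d -> 'End(V)) (U : {vspace V}) v
    (e : sumn (nseq d 1%N) = d) :
  grep a U -> gsimple a U -> v \in U -> v != 0 ->
  (forall i j, i != j -> a (tperm i j) v = - v) ->
  giso (sact e) (specht k (nseq d 1%N)) a U.
Proof.
move=> repU simU vU nzv sgn; have as_ := sign_of_tperm repU vU sgn.
have Uv : U = <[v]>%VS.
  apply/esym/(gsimple_gen simU); first by rewrite -memvE.
    by move=> s x /vlineP[c ->]; rewrite linearZ /= as_ !memvZ ?memv_line.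
  by apply: contraNneq nzv => v0; rewrite -memv0 -v0 memv_line.
pose w := polytabloid k (1%g : 'S_(sumn (nseq d 1%N))).
have [w0 nw0] : exists w0, w w0 != 0.
  apply: NNPP => no; case/negP: (polytabloid_neq0 k (1%g : 'S_(sumn (nseq d 1%N)))).
  apply/eqP/ffunP => w0; rewrite ffunE; apply: NNPP => /eqP nz; apply: no; by exists w0.
(* The Specht module is the line through [w]; the coordinate at a point [w0] where [w] does not
   vanish identifies it with the line through [v]. *)
pose f (x : perm_space k (nseq d 1%N)) := x w0 *: v.
have flin : linear f by move=> c x y; rewrite /f !ffunE scalerDl scalerA.
have [F fE] := linear_hom flin; rewrite /f in fE.
exists F; split.
- apply: capv0P => x xS /lfun_kerP; rewrite fE => /eqP.
  rewrite scaler_eq0 (negPf nzv) orbF; have [_ /vlineP[c ->]] := specht_sign_line 1%g xS.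
  by rewrite ffunE mulf_eq0 (negPf nw0) orbF => /eqP ->; rewrite scale0r.
- apply/eqP; rewrite eqEsubv Uv; apply/andP; split; apply/subvP => x.
    by case/memv_imgP=> y _ ->; rewrite fE memvZ ?memv_line.
  case/vlineP=> c ->; apply/memv_imgP; exists (c / w w0 *: w).
    by rewrite memvZ // polytabloid_mem.
  by rewrite fE ffunE; congr (_ *: _); rewrite /GRing.scale /= mulfVK.
by move=> s x xS; rewrite sact_sign // !fE ffunE linearZ /= as_ scalerA mulrC.
Qed.

End SpechtClassification.

(** * Specht modules exhaust the simple modules *)

Section CycleType.
Variable T : finType.
Implicit Types s t : {perm T}.
Local Open Scope nat_scope.

Definition cycle_type s : seq nat := sort geq (map (fun O : {set T} => #|O|) (enum (porbits s))).

Lemma cycle_type_part s : is_part #|T| (cycle_type s).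
Proof.
rewrite /is_part sort_sorted ?mem_sort => [/=|x y]; last exact: leq_total.
apply/andP; split.
  apply/mapP => -[O]; rewrite mem_enum => /imsetP[x _ ->] /esym/eqP.
  by rewrite (negPf (card_porbit_neq0 s x)).
rewrite (perm_sumn (s2 := (map (fun O : {set T} => #|O|) (enum (porbits s))))) ?perm_sort //.
rewrite sumnE big_map big_enum /= -[X in _ == X]sum1_card.
rewrite [X in _ == X](partition_big (porbit s) [in porbits s]) => [|x _]; last exact: imset_f.
apply/eqP/eq_bigr => _ /imsetP[y _ ->]; rewrite -sum1_card; apply: eq_bigl => x.
by rewrite eq_porbit_mem.
Qed.

Lemma perm_expE s i j x : ((s ^+ i) x == (s ^+ j) x)%g = (i == j %[mod #|porbit s x|]).
Proof.
set m := #|_|; have m_gt0 : 0 < m by rewrite lt0n card_porbit_neq0.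
have red l : ((s ^+ l) x = (s ^+ (l %% m)) x)%g.
  rewrite {1}(divn_eq l m) addnC expgD permM mulnC expgM.
  suff fx : ((s ^+ m) ((s ^+ (l %% m)) x) = (s ^+ (l %% m)) x)%g.
    by elim: (l %/ m) => [|q IH]; rewrite ?expg0 ?perm1 // expgSr permM IH fx.
  by rewrite -permM -expgD addnC expgD permM; congr ((s ^+ _)%g _); rewrite permX iter_porbit.
have lt l : l %% m < size (traject s x m) by rewrite size_traject ltn_mod.
rewrite (red i) (red j) !permX -!(nth_traject _ (n := m)) ?ltn_mod //.
by rewrite nth_uniq ?lt // uniq_traject_porbit.
Qed.

(** Orbits are matched by their position in lists sorted by size. With a representative [y] of an
    orbit and [z] of its partner, [s^j y] goes to [s'^j z]; this is independent of [j] because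
    matched orbits have the same length. *)
Lemma cycle_type_conj s s' : cycle_type s = cycle_type s' -> exists t, s' = (s ^ t)%g.
Proof.
case: (pickP T) => [x0 _|T0 _]; last by exists 1%g; apply/permP => x; have := T0 x.
pose E u := sort (relpre (fun O : {set T} => #|O|) geq) (enum (porbits u)).
rewrite /cycle_type !sort_map => eqE; rewrite -/(E s) -/(E s') in eqE.
have szE : size (E s) = size (E s') by rewrite -(size_map (fun O : {set T} => #|O|)) eqE size_map.
have memE u O : (O \in E u) = (O \in porbits u) by rewrite mem_sort mem_enum.
have unE u : uniq (E u) by rewrite sort_uniq enum_uniq.
pose f O := nth set0 (E s') (index O (E s)).
have fP O : O \in porbits s -> f O \in porbits s' /\ #|f O| = #|O|.
  rewrite -!memE => OE; have lt : index O (E s) < size (E s') by rewrite -szE index_mem.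
  split; first exact: mem_nth.
  rewrite -(nth_map set0 0 (fun O : {set T} => #|O|)) // -eqE.
  by rewrite (nth_map set0) ?index_mem // nth_index.
have finj : {in porbits s &, injective f}.
  move=> O O'; rewrite -!memE => OE OE' /eqP.
  rewrite /f nth_uniq ?unE -?szE ?index_mem // => /eqP e.
  by rewrite -(nth_index set0 OE) e nth_index.
pose rep (O : {set T}) := odflt x0 [pick y in O].
have repP u x : rep (porbit u x) \in porbit u x.
  by rewrite /rep; case: pickP => //= /(_ x); rewrite porbit_id.
pose y x := rep (porbit s x); pose z x := rep (f (porbit s x)).
have jex x : exists j, x == (s ^+ j)%g (y x).
  have := repP s x; rewrite -/(y x) porbit_sym => /porbitP[j e]; exists j.
  by apply/eqP.
pose jx x := xchoose (jex x); have jxP x : x = (s ^+ jx x)%g (y x).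
  by apply/eqP/(xchooseP (jex x)).
have zP x : porbit s' (z x) = f (porbit s x) /\ #|porbit s' (z x)| = #|porbit s (y x)|.
  have [/imsetP[w _ fw] cf] := fP (porbit s x) (imset_f _ isT).
  have -> : porbit s (y x) = porbit s x by apply/eqP; rewrite eq_porbit_mem repP.
  have -> : porbit s' (z x) = porbit s' w.
    by apply/eqP; rewrite /z fw eq_porbit_mem repP.
  by rewrite -fw.
pose g x := (s' ^+ jx x)%g (z x).
have gE x j : x = (s ^+ j)%g (y x) -> g x = (s' ^+ j)%g (z x).
  move=> e; apply/eqP; rewrite perm_expE (zP x).2 -perm_expE -e.
  by rewrite -jxP.
have ginj : injective g.
  move=> x x' e; have eqf : f (porbit s x) = f (porbit s x').
    rewrite -(zP x).1 -(zP x').1 -(porbit_perm s' (jx x)) -/(g x) e.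
    by rewrite porbit_perm.
  have eqO := finj _ _ (imset_f _ isT) (imset_f _ isT) eqf.
  have yy : y x = y x' by rewrite /y eqO.
  have zz : z x = z x' by rewrite /z eqO.
  move: e; rewrite /g zz => /eqP.
  by rewrite perm_expE (zP x').2 -perm_expE -{1}yy -!jxP => /eqP.
exists (perm ginj); apply/permP => w; rewrite conjgE !permM.
rewrite -{1}(permKV (perm ginj) w); move: ((perm ginj)^-1%g w) => x.
rewrite !(permE ginj) {1}/g -permM -expgSr.
have ysx : porbit s (s x) = porbit s x by rewrite -[RHS](porbit_perm s 1).
rewrite (gE (s x) (jx x).+1) /z /y ysx //.
by rewrite expgSr permM -/(y x) -jxP.
Qed.
End CycleType.

(** * Stable subspaces as matrix representations *)

Section MatrixRepresentation.
Variables (k : fieldType) (gT : finGroupType) (V : vectType k).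
Variables (a : gT -> 'End(V)) (U : {vspace V}) (repU : grep a U).
Local Notation m := (\dim U).

Definition rowvec (v : 'rV[k]_m) : V := \sum_i v 0 i *: (vbasis U)`_i.

Lemma rowvec_linear : linear rowvec.
Proof.
move=> c x y; rewrite /rowvec scaler_sumr -big_split /=; apply: eq_bigr => i _.
by rewrite !mxE scalerDl scalerA.
Qed.
HB.instance Definition _ := GRing.isLinear.Build k _ _ _ rowvec rowvec_linear.

Lemma vbasis_in i : (vbasis U)`_(i : 'I_m) \in U.
Proof. by rewrite vbasis_mem // mem_nth // size_tuple. Qed.

Lemma rowvec_mem v : rowvec v \in U.
Proof. by apply: memv_suml => i _; rewrite memvZ // vbasis_in. Qed.

Definition coordvec (x : V) : 'rV[k]_m := \row_i coord (vbasis U) i x.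

Lemma coordvecK x : x \in U -> rowvec (coordvec x) = x.
Proof.
by move=> xU; rewrite {2}(coord_vbasis xU); apply: eq_bigr => i _; rewrite mxE.
Qed.

Lemma rowvecK v : coordvec (rowvec v) = v.
Proof.
apply/rowP => i; rewrite mxE /rowvec coord_sum_free //.
exact: basis_free (vbasisP U).
Qed.

(** Row vectors are acted on from the right, so the order of factors in [grep] makes this
    multiplicative. *)
Definition repmx (s : gT) : 'M[k]_m := \matrix_i coordvec (a s (vbasis U)`_i).

Lemma repmxE s v : rowvec (v *m repmx s) = a s (rowvec v).
Proof.
have [st _ _] := repU.
rewrite mulmx_sum_row !linear_sum /=; apply: eq_bigr => i _.
by rewrite !linearZ /= rowK coordvecK // st // vbasis_in.
Qed.

Lemma repmx_repr : mx_repr [set: gT] repmx.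
Proof.
have [st a1 aM] := repU.
have ext (A B : 'M[k]_m) : (forall v : 'rV_m, rowvec (v *m A) = rowvec (v *m B)) -> A = B.
  move=> e; apply/row_matrixP => i; rewrite !rowE.
  by rewrite -[LHS]rowvecK e rowvecK.
split; first by apply: ext => v; rewrite repmxE mulmx1 a1 // rowvec_mem.
move=> s t _ _; apply: ext => v.
by rewrite mulmxA !repmxE aM // rowvec_mem.
Qed.

Definition vrep := MxRepresentation repmx_repr.

Lemma vrep_irr : gsimple a U -> mx_irreducible vrep.
Proof.
move=> [nzU sU]; apply/mx_irrP; split.
  by rewrite lt0n; apply: contra nzU; rewrite dimv_eq0.
move=> W /mxmoduleP modW nzW.
pose f (c : 'rV[k]_m) := rowvec (c *m W).
have flin : linear f by move=> c x y; rewrite /f mulmxDl -scalemxAl linearP.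
have [F FE] := linear_hom flin; pose W' := limg F.
have W'P x : x \in W' -> exists2 v : 'rV_m, (v <= W)%MS & x = rowvec v.
  by case/memv_imgP=> c _ ->; exists (c *m W); rewrite ?FE ?submxMl.
have W'I (v : 'rV_m) : (v <= W)%MS -> rowvec v \in W'.
  by case/submxP=> c ->; apply/memv_imgP; exists c; rewrite ?memvf ?FE.
case: (sU W').
- by apply/subvP => x /W'P[v _ ->]; apply: rowvec_mem.
- move=> s x /W'P[v vW ->]; rewrite -repmxE; apply: W'I.
  by apply: submx_trans (modW s (in_setT s)); apply: submxMr.
- move=> W'0; case/negP: nzW; apply/eqP/row_matrixP => i; rewrite row0.
  have := W'I _ (row_sub i W); rewrite W'0 memv0 => /eqP e.
  by rewrite -[LHS]rowvecK e -(linear0 rowvec) rowvecK.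
move=> W'U; rewrite -sub1mx; apply/row_subP => i.
have : rowvec (row i 1%:M) \in W' by rewrite W'U rowvec_mem.
by case/W'P=> v vW e; rewrite -[X in (X <= _)%MS]rowvecK e rowvecK.
Qed.
End MatrixRepresentation.

(** * Counting the simple modules of symmetric groups *)

Section Completeness.
Variables (k : fieldType) (k_char0 : [pchar k] =i pred0).

Lemma rsim_giso (gT : finGroupType) (V V' : vectType k) (a : gT -> 'End(V))
    (b : gT -> 'End(V')) (U : {vspace V}) (U' : {vspace V'})
    (repU : grep a U) (repU' : grep b U') :
  mx_rsim (vrep repU) (vrep repU') -> giso a U b U'.
Proof.
case=> B eqm freeB hom.
pose f x : V' := rowvec (coordvec U x *m B).
have flin : linear f.
  move=> c x y; rewrite /f -linearP scalemxAl -mulmxDl; congr (rowvec (_ *m B)).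
  by apply/rowP => i; rewrite !mxE linearP.
have [F fE] := linear_hom flin.
have fullB : row_full B by rewrite /row_full (eqP freeB) eqm.
exists F; split.
- apply: capv0P => x xU /lfun_kerP; rewrite fE /f => e.
  have e2 : coordvec U x *m B = 0.
    by rewrite -[LHS]rowvecK e -(linear0 (@rowvec _ _ U')) rowvecK.
  rewrite -(coordvecK xU) (_ : coordvec U x = 0) ?linear0 //.
  by apply: (row_free_inj freeB); rewrite e2 mul0mx.
- apply/eqP; rewrite eqEsubv; apply/andP; split; apply/subvP => y.
    by case/memv_imgP=> x _ ->; rewrite fE rowvec_mem.
  move=> yU; have /submxP[v e] : (coordvec U' y <= B)%MS by apply: submx_full.
  apply/memv_imgP; exists (rowvec v); first exact: rowvec_mem.
  by rewrite fE /f rowvecK -e coordvecK.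
move=> s x xU; rewrite !fE /f -repmxE //; congr rowvec.
have := hom s (in_setT s); rewrite /= => e.
rewrite -mulmxA -e mulmxA; congr (_ *m _).
by rewrite -{1}(coordvecK xU) -(repmxE repU) rowvecK.
Qed.

Lemma pchar0_group (gT : finGroupType) (G : {group gT}) : ([pchar k]^'.-group G)%g.
Proof.
rewrite /pgroup; apply/pnatP; first exact: cardG_gt0.
by move=> p _ _; rewrite inE /= k_char0.
Qed.

(** The class sums are a basis of the centre, and each Wedderburn component contributes its own
    identity to the centre. Only an inequality is claimed, as [k] is not assumed to be a splitting
    field. *)
Lemma card_irr_leq (gT : finGroupType) (G : {group gT}) (sG : irrType k G) :
  (#|sG| <= #|classes G|)%N.
Proof.
have F'G := pchar0_group G.
rewrite -(eqnP (classg_base_free k G)) classg_base_center.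
rewrite (mxdirect_sums_center (Wedderburn_sum_pchar sG F'G) (Wedderburn_direct sG)
  (Wedderburn_ideal (sG := sG))).
rewrite (mxdirectP _) /=; last first.
  apply/mxdirect_sumsP=> i _; apply/eqP; rewrite -submx0.
  rewrite -{2}(mxdirect_sumsP (Wedderburn_direct sG) i) // capmxS ?capmxSl //=.
  by apply/sumsmx_subP=> j neji; rewrite (sumsmx_sup j) ?capmxSl.
rewrite -sum1_card; apply: leq_sum => i _.
have [nz_e Re ideR idRe] := Wedderburn_is_id_pchar F'G i.
have Ze : (mxvec (Wedderburn_id i) <= 'Z(Wedderburn_subring i))%MS.
  rewrite sub_capmx [(_ <= _)%MS]Re.
  by apply/cent_mxP=> A R_A; rewrite ideR // idRe.
apply: leq_trans (mxrankS Ze).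
by rewrite lt0n mxrank_eq0 mxvec_eq0.
Qed.

Lemma sumn_cycle_type d (s : 'S_d) : sumn (cycle_type s) = d.
Proof. by have /and3P[_ _ /eqP] := cycle_type_part s; rewrite card_ord. Qed.

(* Specht modules of cycle types give as many simple modules as there are conjugacy
   classes, and the number of simple modules is at most the dimension of the
   centre of the group algebra. *)
Theorem specht_complete d (V : vectType k) (a : 'S_d -> 'End(V)) (U : {vspace V}) :
  grep a U -> gsimple a U ->
  exists lam (e : sumn lam = d), is_part d lam /\ giso (sact k e) (specht k lam) a U.
Proof.
move=> repU simU; apply: NNPP => no.
(* The socle exists only under [classically]; with the goal turned into [False] it may be used
   freely. *)
have /(_ false) := @socle_exists _ _ _ _ (regular_repr k [set: 'S_d]%G).
suff h : socleType (regular_repr k [set: 'S_d]%G) -> False by move=> /(_ (fun sG => False_ind _ (h sG))).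
move=> sG; have F'G := pchar0_group [set: 'S_d]%G.
pose rho s := vrep (sact_rep k (sumn_cycle_type (s : 'S_d))).
have part s : is_part d (cycle_type (s : 'S_d)) by have := cycle_type_part s; rewrite card_ord.
have irr_rho s : mx_irreducible (rho s).
  by apply/vrep_irr/sact_simple => //; have /and3P[] := part s.
(* A class goes to the simple module given by its cycle type. Injectivity and [card_irr_leq] make
   this map surjective, so the given module is hit. *)
pose Phi (C : {set 'S_d}) := irr_comp (sG : irrType k _) (rho (repr C)).
have rcomp s : mx_rsim (rho s) (irr_repr (irr_comp (sG : irrType k _) (rho s))).
  exact: rsim_irr_comp_pchar.
have Phi_inj : {in classes [set: 'S_d] &, injective Phi}.
  move=> C C' CG CG' e; have := rcomp (repr C); rewrite -/(Phi C) e => rs.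
  have := rsim_giso (mx_rsim_trans rs (mx_rsim_sym (rcomp (repr C')))).
  move/(specht_distinct k_char0 (part _) (part _))/cycle_type_conj => [t et].
  have [_ eC] := repr_classesP CG; have [_ eC'] := repr_classesP CG'.
  by rewrite [LHS]eC [RHS]eC' et; apply/esym/class_eqP/memJ_class/in_setT.
have img : Phi @: classes [set: 'S_d] = setT.
  apply/eqP; rewrite eqEcard subsetT cardsT /= card_in_imset //.
  exact: card_irr_leq.
have : irr_comp (sG : irrType k _) (vrep repU) \in Phi @: classes [set: 'S_d] by rewrite img inE.
case/imsetP=> C _ e; apply: no.
exists (cycle_type (repr C)), (sumn_cycle_type (repr C)); split=> //.
apply: (rsim_giso (repU := sact_rep k _) (repU' := repU)).
apply: mx_rsim_trans (rcomp _) _.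
rewrite -/(Phi C) -e; apply: mx_rsim_sym.
by apply: rsim_irr_comp_pchar => //; apply: vrep_irr.
Qed.

End Completeness.

(** * Transformations and their modules *)

Section Transformations.
Variable n : nat.
Local Notation N := n.+1.
Implicit Types (f g h : trans N) (i j : 'I_N).
Local Open Scope nat_scope.

Definition tim (f : trans N) : {set 'I_N} := [set f i | i : 'I_N].

Lemma tcompE f g i : tcomp f g i = f (g i).
Proof. by rewrite ffunE. Qed.

Lemma tcompA f g h : tcomp f (tcomp g h) = tcomp (tcomp f g) h.
Proof. by apply/ffunP => i; rewrite !tcompE. Qed.

Lemma mem_tim f i : f i \in tim f.
Proof. exact: imset_f. Qed.

Lemma tim_comp f g : tim (tcomp f g) = f @: tim g.
Proof. by rewrite /tim -imset_comp; apply: eq_imset => i; rewrite tcompE. Qed.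

Lemma trankE f : trank f = #|tim f|. Proof. by []. Qed.

Lemma trank_compr f g : trank (tcomp f g) <= trank g.
Proof. by rewrite !trankE tim_comp leq_imset_card. Qed.

Lemma trank_compl f g : trank (tcomp f g) <= trank f.
Proof.
by rewrite !trankE subset_leq_card //; apply/subsetP => _ /imsetP[i _ ->]; rewrite tcompE mem_tim.
Qed.

Lemma trank_gt0 f : 0 < trank f.
Proof. by rewrite trankE; apply/card_gt0P; exists (f ord0); apply: mem_tim. Qed.

Definition pref (r : nat) : {set 'I_N} := [set i : 'I_N | i < r].

Lemma card_pref r : r <= N -> #|pref r| = r.
Proof.
move=> le; have winj : injective (widen_ord le) by move=> x y /(congr1 val) /= /val_inj.
rewrite -[RHS]card_ord -(card_imset _ winj); congr #|pred_of_set _|.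
apply/setP => i; rewrite inE; apply/idP/imsetP => [lt|[x _ ->]]; last by rewrite /= ltn_ord.
by exists (Ordinal lt) => //; apply: val_inj.
Qed.

Lemma eidemE r i : eidem N r i = if i < r then i else ord0.
Proof. by rewrite ffunE; case: ifP => // _; apply: val_inj; rewrite val_insubd. Qed.

Lemma eidem_id r i : i < r -> eidem N r i = i.
Proof. by rewrite eidemE => ->. Qed.

Lemma eidem_lt r i : 0 < r -> eidem N r i < r.
Proof. by rewrite eidemE; case: ifP. Qed.

Lemma eidem_comp r f : (forall i, f i < r) -> tcomp (eidem N r) f = f.
Proof. by move=> h; apply/ffunP => i; rewrite tcompE eidem_id. Qed.

Lemma eidem_idem r : 0 < r -> tcomp (eidem N r) (eidem N r) = eidem N r.
Proof. by move=> r0; apply: eidem_comp => i; apply: eidem_lt. Qed.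

Lemma eidemK r i : 0 < r -> eidem N r (eidem N r i) = eidem N r i.
Proof. by move=> r0; rewrite -tcompE eidem_idem. Qed.

Lemma eidem_full : eidem N N = tid N.
Proof. by apply/ffunP => i; rewrite eidemE ltn_ord ffunE. Qed.

Lemma tim_eidem r : 0 < r -> tim (eidem N r) = pref r.
Proof.
move=> r0; apply/setP => i; rewrite inE; apply/imsetP/idP => [[j _ ->]|lt].
  exact: eidem_lt.
by exists i; rewrite ?eidem_id.
Qed.

Lemma trank_eidem r : 0 < r <= N -> trank (eidem N r) = r.
Proof. by case/andP=> r0 rN; rewrite trankE tim_eidem // card_pref. Qed.

(* The element of G_{e_r} restricting to [s]: points outside the first [r] are
   sent where the first point is sent. *)
Definition up r (s : 'S_r) : trans N :=
  [ffun i : 'I_N => if insub (val (eidem N r i)) is Some x then inord (s x : 'I_r) else ord0].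

Section Up.
Variable r : nat.
Hypothesis r_bounds : 0 < r <= N.
Let r0 : 0 < r. Proof. by case/andP: r_bounds. Qed.
Let rN : r <= N. Proof. by case/andP: r_bounds. Qed.
Implicit Types (s t : 'S_r) (S : {set 'I_N}).

Lemma up_val s (x : 'I_r) i : x = i :> nat -> up s i = s x :> nat.
Proof.
move=> e; have lt : i < r by rewrite -e.
rewrite ffunE eidem_id // insubT /= inordK; last exact: leq_trans (ltn_ord _) rN.
by congr (val (s _)); apply: val_inj.
Qed.

Lemma up_lt s i : up s i < r.
Proof.
rewrite ffunE insubT ?eidem_lt //= => lt.
by rewrite inordK ?ltn_ord //; apply: leq_trans (ltn_ord _) rN.
Qed.

Lemma up_eidem s i : up s (eidem N r i) = up s i.
Proof. by rewrite [LHS]ffunE [RHS]ffunE eidemK. Qed.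

Lemma upP s g : (forall i, g (eidem N r i) = g i) ->
  (forall (x : 'I_r) i, x = i :> nat -> g i = s x :> nat) -> g = up s.
Proof.
move=> ge gs; apply/ffunP => i; rewrite -ge -up_eidem; apply: val_inj.
have lt : eidem N r i < r by apply: eidem_lt.
by rewrite /= (gs (Ordinal lt)) // (up_val s (x := Ordinal lt)).
Qed.

Lemma up1 : up (1%g : 'S_r) = eidem N r.
Proof.
apply/esym/upP => [i|x i e]; first by rewrite eidemK.
by rewrite perm1 eidem_id -?e.
Qed.

Lemma upM s t : tcomp (up s) (up t) = up (t * s)%g.
Proof.
apply: upP => [i|x i e]; first by rewrite !tcompE up_eidem.
by rewrite tcompE permM (up_val s (x := t x)) // (up_val t e).
Qed.

Lemma eidem_up s : tcomp (eidem N r) (up s) = up s.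
Proof. by apply: eidem_comp => i; apply: up_lt. Qed.

Lemma up_eidemr s : tcomp (up s) (eidem N r) = up s.
Proof. by apply/ffunP => i; rewrite tcompE up_eidem. Qed.

Lemma up_of g : (forall i, g (eidem N r i) = g i) -> (forall i, g i < r) ->
  r <= trank g -> exists s, g = up s.
Proof.
move=> ge glt rk.
pose f (x : 'I_r) : 'I_r := Ordinal (glt (widen_ord rN x)).
have finj : injective f.
  apply/injectiveP/card_uniqP => /=; rewrite size_map -cardT card_ord; apply/eqP.
  rewrite eqn_leq; apply/andP; split; first by rewrite -[leqRHS]card_ord max_card.
  apply: leq_trans rk _.
  have h : forall y, y \in tim g -> exists2 x : 'I_r, y = widen_ord rN x & x \in codom f.
    move=> _ /imsetP[i _ ->]; exists (Ordinal (glt i)); first exact: val_inj.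
    apply/codomP; exists (Ordinal (eidem_lt i r0)); apply: val_inj => /=.
    by rewrite -ge; congr (val (g _)); apply: val_inj.
  rewrite trankE; apply: leq_trans (leq_imset_card (widen_ord rN) _).
  by apply/subset_leq_card/subsetP => y /h[x -> xf]; apply: imset_f.
exists (perm finj); apply: upP => // x i e; rewrite permE /=; congr (val (g _)).
by apply: val_inj; rewrite /= e.
Qed.

(** The monoid [e_r T_n e_r] consists of its units and of maps of smaller rank, so on a module
    killed by rank below [r] it acts on the image of [e_r] through the symmetric group. *)
Lemma local_unit g : trank (tcomp (eidem N r) (tcomp g (eidem N r))) < r \/
  exists s, tcomp (eidem N r) (tcomp g (eidem N r)) = up s.
Proof.
set f := tcomp _ _; have [|ge] := ltnP (trank f) r; [by left|right; apply: up_of => //].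
  by move=> i; rewrite /f !tcompE eidemK.
by move=> i; rewrite /f tcompE eidem_lt.
Qed.

Lemma in_units_up g s : in_units (eidem N r) g -> restricts_to g s -> g = up s.
Proof.
move=> [ege _] gs; apply: upP; last by move=> x i e; rewrite (gs x i).
by move=> i; rewrite -{1 2}ege !tcompE eidemK.
Qed.

Lemma up_in_units s : in_units (eidem N r) (up s).
Proof.
split; first by rewrite up_eidemr eidem_up.
by exists (up s^-1%g); rewrite up_eidemr eidem_up !upM mulVg mulgV up1.
Qed.

Lemma up_restricts s : restricts_to (up s) s.
Proof. by move=> x i e; rewrite (up_val s e). Qed.

(* For [#|S| = r]: mutually inverse bijections [S -> [r]] and [[r] -> S], extended
   to all points. *)
Definition kap (S : {set 'I_N}) : trans N :=
  [ffun i => eidem N r (inord (index i (enum S)))].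

Definition iot (S : {set 'I_N}) : trans N := [ffun i : 'I_N => nth i (enum S) i].

Lemma kap_lt S i : kap S i < r.
Proof. by rewrite ffunE eidem_lt. Qed.

Lemma eidem_kap S : tcomp (eidem N r) (kap S) = kap S.
Proof. by apply: eidem_comp => i; apply: kap_lt. Qed.

Lemma iotK S i : #|S| = r -> i \in S -> iot S (kap S i) = i.
Proof.
move=> cS iS; have lt : index i (enum S) < r by rewrite -cS cardE index_mem mem_enum.
have e : @inord n (index i (enum S)) = index i (enum S) :> nat.
  by apply: inordK; apply: leq_trans lt rN.
by rewrite [kap S i]ffunE eidem_id ?e // [LHS]ffunE e nth_index ?mem_enum.
Qed.

(** As [kap] absorbs [e_r] on the left, this places every map of rank [r] in the two-sided ideal
    generated by [e_r]. *)
Lemma factor_rank f : trank f = r -> f = tcomp (iot (tim f)) (tcomp (kap (tim f)) f).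
Proof. by move=> rf; apply/ffunP => i; rewrite !tcompE iotK ?mem_tim. Qed.

End Up.
End Transformations.

(** * Submodules, quotients, direct sums and sections *)

Section ModuleConstructions.
Variables (k : fieldType) (n : nat).
Implicit Types M N P Q : tmod k n.

Lemma submodP M (U : {vspace M}) :
  submod U <-> forall g x, x \in U -> tact M g x \in U.
Proof.
split=> h g; first by move=> x xU; apply: (subvP (h g)); rewrite memv_img.
by apply/subvP => _ /memv_imgP[x xU ->]; apply: h.
Qed.

Lemma submod_ker M N (f : 'Hom(M, N)) : is_hom f -> submod (lker f).
Proof.
by move=> hf; apply/submodP => g x /lfun_kerP fx; apply/lfun_kerP; rewrite hf fx linear0.
Qed.

Lemma submod_img M N (f : 'Hom(M, N)) U : is_hom f -> submod U -> submod (f @: U)%VS.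
Proof.
move=> hf /submodP sU; apply/submodP => g _ /memv_imgP[x xU ->].
by rewrite -hf memv_img // sU.
Qed.

Lemma submod_preim M N (f : 'Hom(M, N)) U : is_hom f -> submod U -> submod (f @^-1: U)%VS.
Proof.
move=> hf /submodP sU; apply/submodP => g x; rewrite -!memv_preim => xU.
by rewrite hf sU.
Qed.

Lemma submod_full M : submod (fullv : {vspace M}).
Proof. by apply/submodP => g x _; rewrite memvf. Qed.

Lemma submod_0 M : submod (0%VS : {vspace M}).
Proof. by apply/submodP => g x; rewrite memv0 => /eqP ->; rewrite linear0 mem0v. Qed.

Lemma submod_cap M (U W : {vspace M}) : submod U -> submod W -> submod (U :&: W)%VS.
Proof.
move=> /submodP sU /submodP sW; apply/submodP => g x; rewrite !memv_cap.
by case/andP=> xU xW; rewrite sU // sW.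
Qed.

Lemma is_hom_comp M N P (f : 'Hom(M, N)) (g : 'Hom(N, P)) :
  is_hom f -> is_hom g -> is_hom (g \o f)%VF.
Proof. by move=> hf hg s x; rewrite !lfunE /= hf hg. Qed.

Lemma is_hom_id M : is_hom (\1%VF : 'Hom(M, M)).
Proof. by move=> s x; rewrite !id_lfunE. Qed.

Lemma inj_homP M N (f : 'Hom(M, N)) : inj_hom f -> injective f.
Proof. by case=> _; apply: lker0_inj. Qed.

Lemma surj_homP M N (f : 'Hom(M, N)) : surj_hom f -> forall y, exists x, f x = y.
Proof. by case=> _ /limg_fullP. Qed.

Lemma inj_homI M N (f : 'Hom(M, N)) : is_hom f -> (forall x, f x = 0 -> x = 0) -> inj_hom f.
Proof. by move=> hf f0; split=> //; apply: vspace0P => x /lfun_kerP /f0. Qed.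

Lemma surj_homI M N (f : 'Hom(M, N)) : is_hom f -> (forall y, exists x, f x = y) -> surj_hom f.
Proof. by move=> hf fs; split=> //; apply/limg_fullP. Qed.

Lemma inj_hom_comp M N P (f : 'Hom(M, N)) (g : 'Hom(N, P)) :
  inj_hom f -> inj_hom g -> inj_hom (g \o f)%VF.
Proof.
move=> jf jg; have [hf _] := jf; have [hg _] := jg.
apply: inj_homI; first exact: is_hom_comp.
move=> x; rewrite lfunE /= -(linear0 g) => /(inj_homP jg).
by rewrite -(linear0 f) => /(inj_homP jf).
Qed.

Lemma surj_hom_comp M N P (f : 'Hom(M, N)) (g : 'Hom(N, P)) :
  surj_hom f -> surj_hom g -> surj_hom (g \o f)%VF.
Proof.
move=> jf jg; have [hf _] := jf; have [hg _] := jg.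
apply: surj_homI; first exact: is_hom_comp.
move=> y; have [z <-] := surj_homP jg y; have [x <-] := surj_homP jf z.
by exists x; rewrite lfunE.
Qed.

Lemma exists_action_img M (V : vectType k) (p : 'Hom(M, V)) :
  limg p = fullv -> submod (lker p) ->
  exists N : tmod k n, exists q : 'Hom(M, N), surj_hom q /\ lker q = lker p.
Proof.
move=> /limg_fullP ps /submodP sK.
pose act g : 'End(V) := (p \o tact M g \o p^-1)%VF.
have actE g x : act g (p x) = p (tact M g x).
  rewrite /act !lfunE /= !lfunE /=; apply/eqP; rewrite -subr_eq0 -!linearB /=.
  apply/eqP/lfun_kerP/sK/lfun_kerP; rewrite linearB /= limg_lfunVK ?subrr //.
  by rewrite memv_img ?memvf.
have act1 v : act (tid n) v = v.
  by have [x <-] := ps v; rewrite actE tact1.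
have actM f g v : act (tcomp f g) v = act f (act g v).
  by have [x <-] := ps v; rewrite !actE tactM.
exists (TMod act1 actM), p; split=> //; exact: surj_homI.
Qed.

Lemma exists_quot M (U : {vspace M}) : submod U ->
  exists N : tmod k n, exists p : 'Hom(M, N), surj_hom p /\ lker p = U.
Proof.
(* The quotient is modelled on the image of the projector complementary to [U]. *)
move=> sU; pose p0 : 'End(M) := (\1 - projv U)%VF.
pose p : 'Hom(M, subvs_of (limg p0)) := (linfun (vsproj (limg p0)) \o p0)%VF.
have pE x : vsval (p x) = p0 x.
  by rewrite lfunE /= lfunE /= vsprojK // memv_img ?memvf.
have kerp : lker p = U.
  apply/eqP; rewrite eqEsubv; apply/andP; split; apply/subvP => x.
    move=> /lfun_kerP px; have := pE x; rewrite px linear0 /p0 !lfunE /= !lfunE /=.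
    by move/esym/eqP; rewrite subr_eq0 => /eqP ->; rewrite memv_proj.
  move=> xU; apply/lfun_kerP/val_inj; rewrite /= pE /p0 !lfunE /= !lfunE /=.
  by rewrite projv_id // subrr.
have := @exists_action_img M _ p; rewrite kerp; apply=> //.
apply/limg_fullP => y; have /memv_imgP[x _ e] := subvsP y.
by exists x; apply: val_inj; rewrite /= pE.
Qed.

Lemma exists_sub M (U : {vspace M}) : submod U ->
  exists N : tmod k n, exists i : 'Hom(N, M), inj_hom i /\ limg i = U.
Proof.
move=> /submodP sU.
pose val : 'Hom(subvs_of U, M) := linfun vsval.
pose act g : 'End(subvs_of U) := (linfun (vsproj U) \o tact M g \o val)%VF.
have actE g v : vsval (act g v) = tact M g (vsval v).
  by rewrite /act !lfunE /= !lfunE /= lfunE /= vsprojK // sU // subvsP.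
have act1 v : act (tid n) v = v.
  by apply: val_inj; rewrite /= actE tact1.
have actM f g v : act (tcomp f g) v = act f (act g v).
  by apply: val_inj; rewrite /= !actE tactM.
exists (TMod act1 actM), val; split.
  have valE v : val v = vsval v by rewrite lfunE.
  apply: inj_homI => [g x|x]; first by rewrite !valE /= actE.
  by rewrite valE => e; apply: val_inj.
apply/eqP; rewrite eqEsubv; apply/andP; split; apply/subvP => x.
  by case/memv_imgP=> y _ ->; rewrite lfunE subvsP.
by move=> xU; apply/memv_imgP; exists (vsproj U x); rewrite ?memvf // lfunE /= vsprojK.
Qed.

Lemma exists_dsum M N : exists Q : tmod k n,
  exists (i1 : 'Hom(M, Q)) (i2 : 'Hom(N, Q)) (p1 : 'Hom(Q, M)) (p2 : 'Hom(Q, N)),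
  [/\ [/\ is_hom i1, is_hom i2, is_hom p1 & is_hom p2],
      (forall x, p1 (i1 x) = x) /\ (forall x, p2 (i2 x) = x),
      (forall x, p1 (i2 x) = 0) /\ (forall x, p2 (i1 x) = 0) &
      forall x, x = i1 (p1 x) + i2 (p2 x)].
Proof.
pose V : vectType k := (M * N)%type.
have l1 : linear (fun x : M => (x, 0) : V).
  by move=> c x y; apply/pair_equal_spec; rewrite /= scaler0 addr0.
have l2 : linear (fun x : N => (0, x) : V).
  by move=> c x y; apply/pair_equal_spec; rewrite /= scaler0 addr0.
have [i1 i1E] := linear_hom l1; have [i2 i2E] := linear_hom l2.
have [p1 p1E] : {F : 'Hom(V, M) | forall x, F x = x.1} by exact: linear_hom.
have [p2 p2E] : {F : 'Hom(V, N) | forall x, F x = x.2} by exact: linear_hom.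
have split_ x : x = i1 (p1 x) + i2 (p2 x).
  by rewrite i1E i2E p1E p2E; case: x => a b; apply/pair_equal_spec; rewrite /= addr0 add0r.
pose act g : 'End(V) := ((i1 \o tact M g \o p1) + (i2 \o tact N g \o p2))%VF.
have actE g x : act g x = (tact M g x.1, tact N g x.2).
  rewrite /act !lfunE /= !lfunE /= !lfunE /= i1E i2E p1E p2E.
  by apply/pair_equal_spec; rewrite /= addr0 add0r.
have act1 v : act (tid n) v = v by rewrite actE !tact1; case: v.
have actM f g v : act (tcomp f g) v = act f (act g v) by rewrite !actE !tactM.
exists (TMod act1 actM), i1, i2, p1, p2; split=> //; split.
- by move=> g x; rewrite /= actE !i1E /= linear0.
- by move=> g x; rewrite /= actE !i2E /= linear0.
- by move=> g x; rewrite /= actE !p1E.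
- by move=> g x; rewrite /= actE !p2E.
- by move=> x; rewrite i1E p1E.
- by move=> x; rewrite i2E p2E.
- by move=> x; rewrite i2E p1E.
by move=> x; rewrite i1E p2E.
Qed.

Lemma hom_factor M N P (p : 'Hom(M, P)) (f : 'Hom(M, N)) :
  surj_hom p -> is_hom f -> (lker p <= lker f)%VS ->
  exists2 g : 'Hom(P, N), is_hom g & forall x, g (p x) = f x.
Proof.
move=> sp hf le; have e := lfun_factor le; exists (f \o p^-1)%VF => // g y.
have [x <-] := surj_homP sp y; have [hp _] := sp.
by rewrite -hp !e hf.
Qed.

Lemma hom_corestrict M N P (i : 'Hom(P, N)) (f : 'Hom(M, N)) :
  inj_hom i -> is_hom f -> (forall x, f x \in limg i) ->
  exists2 g : 'Hom(M, P), is_hom g & forall x, i (g x) = f x.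
Proof.
move=> ji hf im; have [hi _] := ji; have e x : i ((i^-1 \o f)%VF x) = f x.
  by rewrite lfunE /= limg_lfunVK.
exists (i^-1 \o f)%VF => // g x; apply: (inj_homP ji).
by rewrite hi !e hf.
Qed.

Lemma iso_sym M N : iso M N -> iso N M.
Proof.
case=> f [jf sf]; have [hf kf] := jf.
have fK x : (f^-1)%VF (f x) = x by apply: lfunVK_inj.
exists (f^-1)%VF; split.
  apply: inj_homI => [g y|y]; have [x <-] := surj_homP sf y.
    by rewrite -hf !fK.
  by rewrite fK => ->; rewrite linear0.
apply: surj_homI => [g y|y]; first by have [x <-] := surj_homP sf y; rewrite -hf !fK.
by exists (f y); rewrite fK.
Qed.

Lemma compl_section M N (q : 'Hom(M, N)) (Z : {vspace M}) :
  surj_hom q -> submod Z -> (Z :&: lker q)%VS = 0%VS -> (q @: Z)%VS = fullv ->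
  exists s : 'Hom(N, M), [/\ is_hom s, forall y, q (s y) = y & limg s = Z].
Proof.
move=> sq sZ ZK qZ; have [hq _] := sq.
have [P [i [ji imi]]] := exists_sub sZ; have [hi _] := ji.
have hqi : inj_hom (q \o i)%VF /\ surj_hom (q \o i)%VF.
  split.
    apply: inj_homI; first exact: is_hom_comp.
    move=> x; rewrite lfunE /= => qx; apply: (inj_homP ji); rewrite linear0.
    by apply: (capv0E ZK); [rewrite -imi memv_img ?memvf | apply/lfun_kerP].
  apply: surj_homI; first exact: is_hom_comp.
  move=> y; have : y \in (q @: Z)%VS by rewrite qZ memvf.
  case/memv_imgP=> z; rewrite -imi => /memv_imgP[x _ ->] ->.
  by exists x; rewrite lfunE.
have [jqi sqi] := hqi; have [hqi' kqi] := jqi.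
have ti : (forall x, x \in lker (q \o i)%VF -> x \in lker i).
  by move=> x; rewrite kqi memv0 => /eqP ->; apply: mem0v.
have [s hs se] := hom_factor sqi hi (introT subvP ti).
exists s; split=> //.
  move=> y; have [x <-] := surj_homP sqi y.
  by rewrite se lfunE.
rewrite -imi; apply/eqP; rewrite eqEsubv; apply/andP; split; apply/subvP => y.
  case/memv_imgP=> z _ ->; have [x <-] := surj_homP sqi z.
  by rewrite se memv_img ?memvf.
by case/memv_imgP=> x _ ->; apply/memv_imgP; exists ((q \o i)%VF x); rewrite ?memvf ?se.
Qed.

Lemma simple_hom_inj (L M : tmod k n) (f : 'Hom(L, M)) : simple_mod L -> is_hom f ->
  (exists x, f x != 0) -> inj_hom f.
Proof.
move=> [_ sL] hf [x nz]; split=> //; case: (sL _ (submod_ker hf)) => // e.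
by move: nz; have /lfun_kerP -> : x \in lker f; rewrite ?e ?memvf ?eqxx.
Qed.

Lemma simple_hom_surj (L M : tmod k n) (f : 'Hom(M, L)) : simple_mod L -> is_hom f ->
  (exists x, f x != 0) -> surj_hom f.
Proof.
move=> [_ sL] hf [x nz]; split=> //; case: (sL _ (submod_img hf (submod_full M))) => // e.
by move: nz; rewrite -memv0 -e memv_img ?memvf.
Qed.

Lemma simple_in (L M : tmod k n) (i : 'Hom(L, M)) (U : {vspace M}) : simple_mod L -> is_hom i ->
  submod U -> (U :&: limg i)%VS != 0%VS -> (limg i <= U)%VS.
Proof.
move=> [_ sL] hi sU nz; case: (sL _ (submod_preim hi sU)) => e.
  case/negP: nz; apply/eqP/capv0P => x xU /memv_imgP[y _ ey]; subst x.
  have : y \in (i @^-1: U)%VS by rewrite -memv_preim.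
  by rewrite e memv0 => /eqP ->; rewrite linear0.
apply/subvP => _ /memv_imgP[y _ ->].
by rewrite memv_preim e memvf.
Qed.

End ModuleConstructions.

(** * Supports, ranks and the local group *)

Section Supports.
Variables (k : fieldType) (n : nat).
Local Notation N := n.+1.
Implicit Types (M X Y D E : tmod k N) (S : {set 'I_N}) (f g h : trans N).

(* The value at [S] of [M], viewed as a functor on the nonempty subsets of [n]. *)
Definition supp M S : {vspace M} := (\sum_(h | tim h \subset S) limg (tact M h))%VS.

Lemma supp_img M h S x : tim h \subset S -> tact M h x \in supp M S.
Proof. by move=> hS; apply: subvP (memv_img _ (memvf x)); apply: (sumv_sup h). Qed.

Lemma supp_sub M S (U : {vspace M}) :
  (forall h x, tim h \subset S -> tact M h x \in U) -> (supp M S <= U)%VS.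
Proof.
move=> sU; apply/subv_sumP => h hS; apply/subvP => _ /memv_imgP[x _ ->]; exact: sU.
Qed.

Lemma supp_act M S g x : x \in supp M S -> tact M g x \in supp M (g @: S).
Proof.
move=> xS; have : (supp M S <= tact M g @^-1: supp M (g @: S))%VS.
  apply: supp_sub => h y hS; rewrite -memv_preim -tactM supp_img //.
  by rewrite tim_comp imsetS.
by move/subvP/(_ x xS); rewrite -memv_preim.
Qed.

(** On the part supported in [S] a map acts through its restriction to [S], since [tcomp g h] only
    sees [g] on the image of [h]. *)
Lemma supp_eq M S g g' x : x \in supp M S -> {in S, g =1 g'} -> tact M g x = tact M g' x.
Proof.
move=> xS e; apply/eqP; rewrite -subr_eq0.
have : (supp M S <= lker (tact M g - tact M g')%R)%VS.
  apply: supp_sub => h y hS; apply/lfun_kerP; rewrite !lfunE /= lfunE /= -!tactM.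
  apply/eqP; rewrite subr_eq0; apply/eqP; congr (tact M _ y); apply/ffunP => i.
  by rewrite !tcompE e // (subsetP hS) // mem_tim.
by move/subvP/(_ x xS)/lfun_kerP; rewrite !lfunE /= lfunE /= => ->.
Qed.

Lemma supp_id M S g x : x \in supp M S -> {in S, forall i, g i = i} -> tact M g x = x.
Proof.
by move=> xS e; rewrite -[RHS]tact1; apply: (supp_eq xS) => i iS; rewrite e // ffunE.
Qed.

Lemma supp_hom M X (f : 'Hom(M, X)) S x : is_hom f -> x \in supp M S -> f x \in supp X S.
Proof.
move=> hf xS; have : (supp M S <= f @^-1: supp X S)%VS.
  by apply: supp_sub => h y hS; rewrite -memv_preim hf supp_img.
by move/subvP/(_ x xS); rewrite -memv_preim.
Qed.

Lemma supp_surj M X (f : 'Hom(M, X)) S y : surj_hom f -> y \in supp X S ->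
  exists2 x, x \in supp M S & f x = y.
Proof.
move=> sf yS; have [hf _] := sf; have : (supp X S <= f @: supp M S)%VS.
  apply: supp_sub => h z hS; have [x <-] := surj_homP sf z.
  by rewrite -hf memv_img // supp_img.
by move/subvP/(_ y yS)/memv_imgP => [x xS ->]; exists x.
Qed.

Definition kil r M : Prop := forall f x, (trank f < r)%N -> tact M f x = 0.

Lemma kil_sub r M X (i : 'Hom(X, M)) : inj_hom i -> kil r M -> kil r X.
Proof.
move=> ji kM f x lt; have [hi _] := ji; apply: (inj_homP ji).
by rewrite hi kM // linear0.
Qed.

Lemma kil_quot r M X (p : 'Hom(M, X)) : surj_hom p -> kil r M -> kil r X.
Proof.
move=> sp kM f y lt; have [hp _] := sp; have [x <-] := surj_homP sp y.
by rewrite -hp kM // linear0.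
Qed.

Lemma kil_le r s M : (s <= r)%N -> kil r M -> kil s M.
Proof. by move=> le kM f x lt; apply: kM; apply: leq_trans le. Qed.

Lemma kil1 M : kil 1 M.
Proof. by move=> f x; rewrite ltnNge trank_gt0. Qed.

Lemma supp_kil r M S x : kil r M -> (#|S| < r)%N -> x \in supp M S -> x = 0.
Proof.
move=> kM lt xS; have : (supp M S <= 0)%VS.
  apply: supp_sub => h y hS; rewrite kM ?mem0v //; apply: leq_ltn_trans lt.
  exact: subset_leq_card.
by move/subvP/(_ x xS); rewrite memv0 => /eqP.
Qed.

Lemma factor_act M f x : tact M f x =
  tact M (iot (tim f)) (tact M (kap (trank f) (tim f)) (tact M f x)).
Proof.
have rf : (0 < trank f <= N)%N by rewrite trank_gt0 /= trankE -[leqRHS]card_ord max_card.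
by rewrite {1}(factor_rank rf (erefl _)) !tactM.
Qed.

Lemma kil_of_eidem r M : (forall x, (0 < r)%N -> tact M (eidem N r) x = 0) -> kil r M ->
  kil r.+1 M.
Proof.
move=> e0 kM f x; rewrite ltnS leq_eqVlt => /orP[/eqP rf|]; last exact: kM.
have rr : (0 < r <= N)%N by rewrite -rf trank_gt0 /= trankE -[leqRHS]card_ord max_card.
rewrite factor_act rf -(eidem_kap rr) [tact M (tcomp (eidem N r) _) _]tactM e0 ?linear0 //.
by case/andP: rr.
Qed.

(* Acting as zero is inherited by extensions because the ideal of maps of rank
   less than [r] is generated by idempotents. *)
Lemma kil_ext r M X E (i : 'Hom(X, E)) (q : 'Hom(E, M)) :
  is_hom i -> is_hom q -> (lker q <= limg i)%VS -> kil r X -> kil r M -> kil r E.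
Proof.
move=> hi hq /subvP ex; elim: r => [|r IH] kX kM; first by move=> f x; rewrite ltn0.
apply: kil_of_eidem; last by apply: IH; [apply: kil_le kX | apply: kil_le kM].
move=> x r0; have lt : (trank (eidem N r) < r.+1)%N.
  rewrite ltnS; have [le|gt] := leqP r N; first by rewrite trank_eidem // r0.
  by apply: leq_trans (ltnW gt); rewrite trankE -[leqRHS]card_ord max_card.
rewrite -(eidem_idem n r0) tactM.
have /memv_imgP[y _ ->] : tact E (eidem N r) x \in limg i.
  by apply/ex/lfun_kerP; rewrite hq kM.
by rewrite -hi kX // linear0.
Qed.

(** [r] is the apex of [M]. A largest [r] with [kil r M] exists because [kil N.+1] would make the
    identity act as zero. *)
Lemma exists_apex M : fullv != 0%VS :> {vspace M} ->
  exists r, [/\ (0 < r <= N)%N, kil r M & exists x, tact M (eidem N r) x != 0].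
Proof.
move=> nz; have nkN : ~ kil N.+1 M.
  move=> kM; case/negP: nz; apply/eqP/vspace0P => x _; rewrite -[x]tact1 kM //.
  by rewrite ltnS trankE -[leqRHS]card_ord max_card.
have k0 : kil 0 M by move=> f x; rewrite ltn0.
have ex m : (m <= N.+1)%N -> ~ kil m M -> exists r, [/\ (r <= N)%N, kil r M & ~ kil r.+1 M].
  elim: m => [|m IH] lem nkm; first by case: nkm.
  by have [km|nkm'] := classic (kil m M); [exists m | apply: IH => //; apply: ltnW].
have [r [le kr nkr]] := ex _ (leqnn _) nkN.
have r0 : (0 < r)%N by case: r kr nkr {le} => // _ []; apply: kil1.
exists r; split=> //; first by rewrite r0.
apply: NNPP => no; apply: nkr; apply: kil_of_eidem => // x _.
by apply: NNPP => /eqP nx; apply: no; exists x.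
Qed.

Definition eim r M : {vspace M} := limg (tact M (eidem N r)).

Lemma eim_surj r M X (p : 'Hom(M, X)) : surj_hom p -> (p @: eim r M)%VS = eim r X.
Proof.
move=> sp; have [hp _] := sp; apply/eqP; rewrite eqEsubv; apply/andP; split; apply/subvP => y.
  by case/memv_imgP=> _ /memv_imgP[x _ ->] ->; rewrite hp memv_img ?memvf.
case/memv_imgP=> z _ ->; have [x <-] := surj_homP sp z.
by rewrite -hp !memv_img ?memvf.
Qed.

Lemma eim_hom r M X (p : 'Hom(M, X)) x : is_hom p -> x \in eim r M -> p x \in eim r X.
Proof. by move=> hp /memv_imgP[y _ ->]; rewrite hp memv_img ?memvf. Qed.

Definition gact r M (s : 'S_r) : 'End(M) := tact M (up n s).

Section Local.
Variable r : nat.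
Hypothesis rb : (0 < r <= N)%N.
Let r0 : (0 < r)%N. Proof. by case/andP: rb. Qed.

Lemma eimP M x : x \in eim r M <-> tact M (eidem N r) x = x.
Proof.
split=> [/memv_imgP[y _ ->] | <-]; last by rewrite memv_img ?memvf.
by rewrite -tactM eidem_idem.
Qed.

Lemma eim_supp M : eim r M = supp M (pref n r).
Proof.
apply/eqP; rewrite eqEsubv; apply/andP; split.
  by apply/subvP => _ /memv_imgP[y _ ->]; rewrite supp_img // tim_eidem.
apply: supp_sub => h x hr; apply/eimP; rewrite -tactM eidem_comp // => i.
by have := subsetP hr _ (mem_tim h i); rewrite inE.
Qed.

Lemma kil_eim s M x : kil s M -> (r < s)%N -> x \in eim r M -> x = 0.
Proof. by move=> ks lt /memv_imgP[y _ ->]; rewrite ks // trank_eidem. Qed.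

Lemma up_eim M (s : 'S_r) x : gact M s x \in eim r M.
Proof. by apply/eimP; rewrite /gact -tactM eidem_up. Qed.

Lemma kap_eim M S x : tact M (kap r S) x \in eim r M.
Proof. by apply/eimP; rewrite -tactM eidem_kap. Qed.

Lemma gact_rep M : grep (@gact r M) (eim r M).
Proof.
split=> [s x _|x|s t x _]; first exact: up_eim.
  by move=> /eimP xe; rewrite /gact up1.
by rewrite /gact -tactM upM.
Qed.

Lemma gact_hom M X (p : 'Hom(M, X)) s x : is_hom p -> p (@gact r M s x) = gact X s (p x).
Proof. by move=> hp; rewrite hp. Qed.

Lemma submod_gstable M U : submod U -> gstable (@gact r M) (U :&: eim r M)%VS.
Proof.
move=> /submodP sU s x; rewrite !memv_cap => /andP[xU xe].
by rewrite up_eim sU.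
Qed.

Lemma local_act M (W : {vspace M}) g x : kil r M -> (W <= eim r M)%VS ->
  gstable (@gact r M) W -> x \in W -> tact M (eidem N r) (tact M g x) \in W.
Proof.
move=> kM /subvP We stW xW; have /eimP <- := We _ xW; rewrite -tactM -tactM -tcompA.
have [lt|[s ->]] := local_unit rb g; first by rewrite kM ?mem0v.
exact: stW.
Qed.

Definition gen M (W : {vspace M}) : {vspace M} := (\sum_h (tact M h @: W))%VS.

Lemma gen_mem M (W : {vspace M}) h x : x \in W -> tact M h x \in gen W.
Proof. by move=> xW; apply: subvP (memv_img _ xW); apply: (sumv_sup h). Qed.

Lemma gen_sub M (W : {vspace M}) : (W <= gen W)%VS.
Proof. by apply/subvP => x xW; rewrite -[x]tact1 gen_mem. Qed.

Lemma gen_le M (W U : {vspace M}) : submod U -> (W <= U)%VS -> (gen W <= U)%VS.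
Proof.
move=> /submodP sU /subvP WU; apply/subv_sumP => h _; apply/subvP => _ /memv_imgP[x xW ->].
by apply/sU/WU.
Qed.

Lemma gen_submod M (W : {vspace M}) : submod (gen W).
Proof.
apply/submodP => g x xg; rewrite memv_preim; apply: subvP xg.
apply/subv_sumP => h _; apply/subvP => _ /memv_imgP[y yW ->].
by rewrite -memv_preim -tactM gen_mem.
Qed.

Lemma gen_img M X (p : 'Hom(M, X)) (W : {vspace M}) : is_hom p ->
  (p @: gen W)%VS = gen (p @: W)%VS.
Proof.
move=> hp; apply/eqP; rewrite eqEsubv; apply/andP; split.
  apply/subvP => _ /memv_imgP[x xg ->]; rewrite memv_preim; apply: subvP xg.
  apply: gen_le; last by apply/subvP => y yW; rewrite -memv_preim (subvP (gen_sub _)) ?memv_img.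
  by apply: submod_preim => //; apply: gen_submod.
apply: gen_le; last by apply: limgS; apply: gen_sub.
by apply: submod_img => //; apply: gen_submod.
Qed.

Lemma gen_eim M (W : {vspace M}) : kil r M -> (W <= eim r M)%VS -> gstable (@gact r M) W ->
  (gen W :&: eim r M)%VS = W.
Proof.
move=> kM We stW; apply/eqP; rewrite eqEsubv subv_cap gen_sub We !andbT.
apply/subvP => x; rewrite memv_cap => /andP[xg /eimP <-].
rewrite memv_preim; apply: subvP xg; apply/subv_sumP => h _.
apply/subvP => _ /memv_imgP[y yW ->]; rewrite -memv_preim.
exact: local_act.
Qed.

(** The generators [h e_r w] are grouped by the image of [h e_r]; those of rank below [r] vanish.
    The condition on [kap] remembers that each component is a transported copy of an element of
    [W]. *)
Lemma gen_decomp M (W : {vspace M}) x : kil r M -> (W <= eim r M)%VS ->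
  gstable (@gact r M) W -> x \in gen W ->
  exists z : {set 'I_N} -> M,
    (forall S, #|S| = r -> z S \in supp M S /\ tact M (kap r S) (z S) \in W) /\
    x = \sum_(S : {set 'I_N} | #|S| == r) z S.
Proof.
move=> kM We stW /memv_sumP[v vP ->].
have wP h : exists2 w, w \in W & v h = tact M (tcomp h (eidem N r)) w.
  have /memv_imgP[w wW ->] := vP h isT; exists w => //.
  by rewrite tactM; have /eimP -> := subvP We _ wW.
pose he h := tcomp h (eidem N r).
exists (fun S => \sum_(h | tim (he h) == S) v h); split.
  move=> S cS; split.
    apply: memv_suml => h /eqP hS; have [w _ ->] := wP h.
    by rewrite supp_img // -hS.
  rewrite linear_sum /=; apply: memv_suml => h _; have [w wW ->] := wP h.
  rewrite [tact M (tcomp h _) w]tactM; have /eimP -> := subvP We _ wW.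
  by rewrite -(eidem_kap rb) tactM -[tact M _ (tact M h w)]tactM; apply: local_act.
rewrite (bigID (fun h => trank (he h) == r)) /= [X in _ + X]big1 ?addr0.
  rewrite (partition_big (fun h => tim (he h)) (fun S => #|S| == r)) //=.
  apply: eq_bigr => S /eqP cS; apply: eq_bigl => h.
  by apply/andP/idP => [[]//|/eqP e]; rewrite trankE e cS !eqxx.
move=> h ne; have [w _ ->] := wP h; apply: kM.
rewrite ltn_neqAle ne /=; apply: leq_trans (trank_compr _ _) _.
by rewrite trank_eidem.
Qed.

Lemma kap_inj M S x : #|S| = r -> x \in supp M S -> tact M (iot S) (tact M (kap r S) x) = x.
Proof.
move=> cS xS; rewrite -tactM; apply: (supp_id xS) => i iS.
by rewrite tcompE iotK.
Qed.

Definition direct M : Prop := forall z : {set 'I_N} -> M,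
  (forall S, #|S| = r -> z S \in supp M S) ->
  \sum_(S : {set 'I_N} | #|S| == r) z S = 0 -> forall S, #|S| = r -> z S = 0.

(* Modules of the form k Inj([r], [n]) (x)_{S_r} V. *)
Definition induced M : Prop := [/\ kil r M, gen (eim r M) = fullv & direct M].

End Local.
End Supports.

(** * Standard and costandard modules *)

Section InducedCoinduced.
Variables (k : fieldType) (n : nat).
Hypothesis k_char0 : [pchar k] =i pred0.
Local Notation N := n.+1.
Implicit Types (M X Y D E C : tmod k N) (S : {set 'I_N}) (f g h : trans N).

Section Fixed.
Variable r : nat.
Hypothesis rb : (0 < r <= N)%N.

Lemma eim_gstable M : gstable (@gact k n r M) (eim r M).
Proof. by have [st _ _] := gact_rep rb M. Qed.

(* Lift the local module by Maschke and generate. *)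
Lemma induced_split D E (q : 'Hom(E, D)) : induced r D -> kil r E -> surj_hom q ->
  exists Z : {vspace E}, [/\ submod Z, (Z :&: lker q)%VS = 0%VS & (q @: Z)%VS = fullv].
Proof.
move=> [kD gD dD] kE sq; have [hq _] := sq.
have [W [sWe stW KW dKW]] := maschke k_char0 (gact_rep rb E)
  (capvSr (lker q) (eim r E)) (submod_gstable rb (submod_ker hq)).
exists (gen W); split; first exact: gen_submod.
  (* By directness of [D] each component of [x] lies in the kernel of [q]. Transported to [[r]] it
     lies in [W] as well, hence is zero, and transport back by [iot] loses nothing. *)
  apply: capv0P => x xg /lfun_kerP qx.
  have [z [zP ex]] := gen_decomp rb kE sWe stW xg.
  have qz S : #|S| = r -> q (z S) = 0.
    apply: (dD (fun S => q (z S))).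
      by move=> T cT; apply: supp_hom => //; case: (zP T cT).
    by rewrite -linear_sum -ex.
  rewrite ex big1 // => S /eqP cS; have [zS zW] := zP S cS.
  rewrite -(kap_inj rb cS zS) (capv0E dKW _ zW) ?linear0 //.
  by rewrite memv_cap (kap_eim rb) andbT; apply/lfun_kerP; rewrite hq qz // linear0.
rewrite gen_img // -gD; congr gen; apply/eqP; rewrite eqEsubv -(eim_surj r sq).
rewrite limgS //=; apply/subvP => _ /memv_imgP[x + ->]; rewrite -{1}KW.
case/memv_addP=> u; rewrite memv_cap => /andP[/lfun_kerP qu _] [w wW ->].
by rewrite linearD /= qu add0r memv_img.
Qed.

(** The maps [h] with [e_r h = h] and rank [r] are the surjections onto [[r]], and [Y] is an
    equivariant family of local vectors indexed by them. Every such family is required to come from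
    one vector [x] by evaluation. [U] is the whole module for [coinduced] and [ann d X] for
    [ngood]. *)
Definition cofree_at X (U : {vspace X}) : Prop := forall Y : trans N -> X,
  (forall h, Y h \in (eim r X :&: U)%VS) ->
  (forall h s, tcomp (eidem N r) h = h -> trank h = r ->
     Y (tcomp (up n s) h) = @gact k n r X s (Y h)) ->
  exists2 x, x \in U & forall h, tcomp (eidem N r) h = h -> trank h = r -> tact X h x = Y h.

(* Modules of the form Hom_{S_r}(k Surj([n], [r]), V). *)
Definition coinduced X : Prop :=
  [/\ kil r X, forall x, (forall g, tact X (eidem N r) (tact X g x) = 0) -> x = 0 &
      cofree_at (fullv : {vspace X})].

(** The largest submodule that [e_r] maps into [W]; for [W = 0], the largest submodule killed by
    [e_r]. *)
Definition coker_in X (W : {vspace X}) : {vspace X} :=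
  (\bigcap_g (tact X (tcomp (eidem N r) g) @^-1: W))%VS.

Lemma coker_inP X (W : {vspace X}) x : x \in coker_in W <->
  forall g, tact X (eidem N r) (tact X g x) \in W.
Proof.
rewrite /coker_in memvE; split=> [/subv_bigcapP h g | h].
  by have := h g isT; rewrite -memvE -memv_preim tactM.
by apply/subv_bigcapP => g _; rewrite -memvE -memv_preim tactM.
Qed.

Lemma coker_in_submod X (W : {vspace X}) : submod (coker_in W).
Proof.
by apply/submodP => g x /coker_inP h; apply/coker_inP => f; rewrite -[tact X f _]tactM.
Qed.

Lemma local_cases M g x : kil r M -> tact M (tcomp (eidem N r) g) x != 0 ->
  tcomp (eidem N r) (tcomp (eidem N r) g) = tcomp (eidem N r) g /\
  trank (tcomp (eidem N r) g) = r.
Proof.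
move=> kM nz; rewrite tcompA eidem_idem; last by case/andP: rb.
split=> //; apply/eqP; rewrite eqn_leq; apply/andP; split.
  by apply: leq_trans (trank_compl _ _) _; rewrite trank_eidem.
by rewrite leqNgt; apply: contra nz => lt; rewrite kM.
Qed.

(** Dual to [induced_split]. Maschke gives a complement [W] of the local part of [X]. The components
    in [X] of the vectors [e_r h x] form an equivariant family, hence come from some [x'] in [X],
    and [x - i x'] lies in [coker_in W]. *)
Lemma coinduced_split X E (i : 'Hom(X, E)) : coinduced X -> kil r E -> inj_hom i ->
  exists Z : {vspace E}, [/\ submod Z, (Z :&: limg i)%VS = 0%VS & (Z + limg i)%VS = fullv].
Proof.
move=> [kX sepX cofX] kE ji; have [hi _] := ji.
have iE : (i @: eim r X <= eim r E)%VS.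
  by apply/subvP => _ /memv_imgP[x xe ->]; apply: eim_hom.
have sti : gstable (@gact k n r E) (i @: eim r X)%VS.
  move=> s _ /memv_imgP[x xe ->]; rewrite -gact_hom // memv_img //.
  exact: eim_gstable.
have [W [sWe stW iW diW]] := maschke k_char0 (gact_rep rb E) iE sti.
exists (coker_in W); split; first exact: coker_in_submod.
  apply: capv0P => y /coker_inP h /memv_imgP[x _ e]; subst y.
  rewrite (sepX x) ?linear0 // => g; apply: (inj_homP ji); rewrite linear0.
  apply: (capv0E diW); last by rewrite !hi.
  by rewrite memv_img // memv_img ?memvf.
have dec x g : exists yw : X * E, [/\ yw.1 \in eim r X, yw.2 \in W &
    tact E (tcomp (eidem N r) g) x = i yw.1 + yw.2].
  have : tact E (tcomp (eidem N r) g) x \in eim r E by rewrite tactM memv_img ?memvf.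
  rewrite -iW => /memv_addP[_ /memv_imgP[y ye ->] [w wW ->]].
  by exists (y, w).
apply/eqP; rewrite eqEsubv subvf; apply/subvP => x _.
have [yw ywP] := fin_all_exists (dec x).
have [||x' _ x'P] := cofX (fun h => (yw h).1).
- move=> h; rewrite capvf; by case: (ywP h).
- move=> h s eh rh; have [a1 a2 a3] := ywP (tcomp (up n s) h).
  have [b1 b2 b3] := ywP h; apply: (inj_homP ji).
  have /= := memv_dir_uniq diW (memv_img i a1) (memv_img i (eim_gstable s b1)) a2 (stW s _ b2).
  case=> //; rewrite -a3 tcompA eidem_up // tactM -/(gact E s).
  by rewrite gact_hom // -linearD -b3 eh.
rewrite -(subrK (i x') x) memv_add ?memv_img ?memvf //; apply/coker_inP => g.
rewrite -tactM; have [-> | nz] := eqVneq (tact E (tcomp (eidem N r) g) (x - i x')) 0.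
  exact: mem0v.
have [eg rg] := local_cases kE nz; have [a1 a2 a3] := ywP (tcomp (eidem N r) g).
rewrite linearB /= -hi x'P // -{1}eg a3.
by rewrite addrAC subrr add0r.
Qed.

End Fixed.

(** Vanishing of Ext^1(C, X). *)
Definition splits C X : Prop := forall E (i : 'Hom(X, E)) (q : 'Hom(E, C)),
  inj_hom i -> surj_hom q -> lker q = limg i ->
  exists Z : {vspace E}, [/\ submod Z, (Z :&: lker q)%VS = 0%VS & (q @: Z)%VS = fullv].

(** Any extension is killed by rank below the minimum of [r] and [s]. At that level [D] is
    relatively projective if [r <= s], and [X] is relatively injective otherwise. *)
Lemma splits_induced_coinduced r s D X : (0 < r <= N)%N -> (0 < s <= N)%N ->
  induced r D -> coinduced s X -> splits D X.
Proof.
move=> rb sb iD cX E i q ji sq ex; have [hi _] := ji; have [hq _] := sq.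
have [kX _ _] := cX; have [kD _ _] := iD.
have [le|/ltnW le] := leqP r s.
  apply: (induced_split rb) => //; apply: (kil_ext hi hq); rewrite ?ex ?subvv //.
  exact: kil_le kX.
have [||Z [sZ dZ fZ]] := coinduced_split sb (i := i) cX => //.
  by apply: (kil_ext hi hq); rewrite ?ex ?subvv //; apply: kil_le kD.
exists Z; split=> //; rewrite ?ex //.
apply/eqP; rewrite eqEsubv subvf; apply/subvP => y _.
have [x <-] := surj_homP sq y; have : x \in (Z + limg i)%VS by rewrite fZ memvf.
case/memv_addP=> u uZ [v]; rewrite -ex => /lfun_kerP qv ->.
by rewrite linearD /= qv addr0 memv_img.
Qed.

(** The quotient by [rad r M] is the largest one killed by rank below [r]; dually, [ann r M] below
    is the largest such submodule. *)
Definition rad r M : {vspace M} := (\sum_(f : trans N | (trank f < r)%N) limg (tact M f))%VS.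

Lemma rad_img r M f x : (trank f < r)%N -> tact M f x \in rad r M.
Proof. by move=> lt; apply: subvP (memv_img _ (memvf x)); apply: (sumv_sup f). Qed.

Lemma rad_sub r M (U : {vspace M}) :
  (forall f x, (trank f < r)%N -> tact M f x \in U) -> (rad r M <= U)%VS.
Proof.
move=> sU; apply/subv_sumP => h hS; apply/subvP => _ /memv_imgP[x _ ->]; exact: sU.
Qed.

Lemma rad_submod r M : submod (rad r M).
Proof.
apply/submodP => g x xr; rewrite memv_preim; apply: subvP xr; apply: rad_sub => f y lt.
by rewrite -memv_preim -tactM rad_img // (leq_ltn_trans (trank_compr _ _)).
Qed.

Lemma rad_kil r M x : kil r M -> x \in rad r M -> x = 0.
Proof.
move=> kM; have /subvP h : (rad r M <= 0)%VS.
  by apply: rad_sub => f y lt; rewrite kM ?mem0v.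
by move/h; rewrite memv0 => /eqP.
Qed.

Lemma rad_hom r M X (p : 'Hom(M, X)) x : is_hom p -> x \in rad r M -> p x \in rad r X.
Proof.
move=> hp xr; rewrite memv_preim; apply: subvP xr; apply: rad_sub => f y lt.
by rewrite -memv_preim hp rad_img.
Qed.

Lemma rad_surj r M X (p : 'Hom(M, X)) y : surj_hom p -> y \in rad r X ->
  exists2 x, x \in rad r M & p x = y.
Proof.
move=> sp yr; have [hp _] := sp; have : (rad r X <= p @: rad r M)%VS.
  apply: rad_sub => f z lt; have [x <-] := surj_homP sp z.
  by rewrite -hp memv_img // rad_img.
by move/subvP/(_ y yr)/memv_imgP => [x xr ->]; exists x.
Qed.

Definition ann r M : {vspace M} := (\bigcap_(f : trans N | (trank f < r)%N) lker (tact M f))%VS.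

Lemma annP r M x : x \in ann r M <-> forall f, (trank f < r)%N -> tact M f x = 0.
Proof.
rewrite /ann memvE; split=> [/subv_bigcapP h f lt | h].
  by apply/lfun_kerP; rewrite memvE h.
by apply/subv_bigcapP => f lt; rewrite -memvE; apply/lfun_kerP/h.
Qed.

Lemma ann_submod r M : submod (ann r M).
Proof.
apply/submodP => g x /annP h; apply/annP => f lt.
by rewrite -tactM h // (leq_ltn_trans (trank_compl _ _)).
Qed.

Lemma ann_kil r M x : kil r M -> x \in ann r M.
Proof. by move=> kM; apply/annP => f lt; apply: kM. Qed.

(* Intrinsic conditions equivalent to the existence of a filtration with induced,
   resp. coinduced, subquotients; unlike filtrations, they visibly pass to direct
   summands. *)
Definition dgood X : Prop := forall d, (0 < d <= N)%N -> forall z : {set 'I_N} -> X,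
  (forall S, #|S| = d -> z S \in supp X S) ->
  \sum_(S : {set 'I_N} | #|S| == d) z S \in rad d X ->
  forall S, #|S| = d -> z S \in rad d X.

Definition ngood X : Prop := forall d, (0 < d <= N)%N -> cofree_at d (ann d X).

(** A concrete model that avoids projective covers; [is_DeltaP] identifies it with the standard
    module. *)
Definition std lam D : Prop :=
  [/\ induced (sumn lam) D, (0 < sumn lam <= N)%N &
      giso (pact k (lam := lam)) (specht k lam) (@gact k n (sumn lam) D) (eim (sumn lam) D)].

Definition costd lam X : Prop :=
  [/\ coinduced (sumn lam) X, (0 < sumn lam <= N)%N &
      giso (pact k (lam := lam)) (specht k lam) (@gact k n (sumn lam) X) (eim (sumn lam) X)].

Lemma local_specht r X (W : {vspace X}) : (0 < r <= N)%N -> (W <= eim r X)%VS ->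
  gstable (@gact k n r X) W -> gsimple (@gact k n r X) W ->
  exists lam (e : sumn lam = r), is_part r lam /\
    giso (sact k e) (specht k lam) (@gact k n r X) W.
Proof.
move=> rb sW stW simW; apply: specht_complete => //.
exact: grep_sub (gact_rep rb X) sW stW.
Qed.

Lemma sub_gen r X D (W : {vspace X}) (i : 'Hom(D, X)) : (0 < r <= N)%N -> kil r X ->
  (W <= eim r X)%VS -> gstable (@gact k n r X) W -> inj_hom i -> limg i = gen W ->
  [/\ kil r D, (i @: eim r D)%VS = W & gen (eim r D) = fullv].
Proof.
move=> rb kX sW stW ji imi; have [hi ki] := ji; have kD := kil_sub ji kX.
have e : (i @: eim r D)%VS = W.
  rewrite -[RHS](gen_eim rb kX sW stW) -imi; apply/eqP; rewrite eqEsubv.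
  apply/andP; split; apply/subvP => y.
    by case/memv_imgP=> x xe ->; rewrite memv_cap memv_img ?memvf ?eim_hom.
  rewrite memv_cap => /andP[/memv_imgP[x _ ->] /(eimP rb) ie].
  by rewrite memv_img //; apply/(eimP rb)/(inj_homP ji); rewrite hi.
split=> //; apply/eqP; rewrite eqEsubv subvf; apply/subvP => x _.
have : i x \in (i @: gen (eim r D))%VS by rewrite gen_img // e -imi memv_img ?memvf.
by case/memv_imgP=> y yg /(inj_homP ji) ->.
Qed.

Lemma dgood_direct r X : (0 < r <= N)%N -> kil r X -> dgood X -> direct r X.
Proof.
move=> rb kX gX z zS z0 S cS; apply: (rad_kil kX); apply: gX => //.
by rewrite z0 mem0v.
Qed.

Lemma sub_direct r X D (i : 'Hom(D, X)) : inj_hom i -> direct r X -> direct r D.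
Proof.
move=> ji dX z zS z0 S cS; have [hi _] := ji; apply: (inj_homP ji); rewrite linear0.
apply: (dX (fun S => i (z S))) => // [T cT|]; first exact/supp_hom/zS.
by rewrite -linear_sum z0 linear0.
Qed.

Lemma sub_std r lam (e : sumn lam = r) X D (W : {vspace X}) (i : 'Hom(D, X)) :
  (0 < r <= N)%N -> kil r X -> direct r X -> (W <= eim r X)%VS ->
  gstable (@gact k n r X) W -> giso (sact k e) (specht k lam) (@gact k n r X) W ->
  inj_hom i -> limg i = gen W -> std lam D.
Proof.
move=> rb kX dX sW stW isoW ji imi.
have [kD iD gD] := sub_gen rb kX sW stW ji imi; have [hi ki] := ji.
have isoD : giso (sact k e) (specht k lam) (@gact k n r D) (eim r D).
  apply: giso_trans isoW _; apply: giso_sym; first exact: eim_gstable.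
  exists i; rewrite iD ki capv0; split=> // s x _; exact: gact_hom.
case: r / e rb kX dX {sW stW isoW iD} kD gD isoD => rb kX dX kD gD isoD.
split=> //; first by split=> //; exact: sub_direct ji dX.
Qed.

(** At the apex [r], a simple submodule of the local module generates a standard submodule, as
    directness is inherited from [X]. The point is that the quotient satisfies [dgood] again. *)
Lemma peel_dgood X : dgood X -> fullv != 0%VS :> {vspace X} ->
  exists lam D C (i : 'Hom(D, X)) (q : 'Hom(X, C)),
    [/\ is_part (sumn lam) lam, std lam D, kil (sumn lam) X &
    [/\ inj_hom i, surj_hom q, lker q = limg i & dgood C]].
Proof.
move=> gX nzX; have [r [rb kX [x0 nzx0]]] := exists_apex nzX.
have nze : eim r X != 0%VS.
  by apply: contraNneq nzx0 => e0; rewrite -memv0 -e0 memv_img ?memvf.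
have [W [sW stW simW]] := exists_gsimple (eim_gstable rb (M:=X)) nze.
have [lam [e [part isoW]]] := local_specht rb sW stW simW.
have [D [i [ji imi]]] := exists_sub (gen_submod W).
have [C [q [sq kq]]] := exists_quot (gen_submod W).
have dX := dgood_direct rb kX gX.
exists lam, D, C, i, q; split; rewrite ?e //.
  exact: (sub_std (e := e) rb kX dX sW stW isoW ji imi).
split=> //; first by rewrite kq imi.
move=> d db z zS zrad; have [hq _] := sq; have kC := kil_quot sq kX.
have lift S : exists y, #|S| = d -> y \in supp X S /\ q y = z S.
  have [cS|nS] := eqVneq #|S| d; last by exists 0 => cS; rewrite cS eqxx in nS.
  by have [y yS ey] := supp_surj sq (zS S cS); exists y.
have [y yP] := fin_all_exists lift.
have [u urad qu] := rad_surj sq zrad.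
have sumq : q (\sum_(S : {set 'I_N} | #|S| == d) y S - u) = 0.
  rewrite linearB /= qu linear_sum /= (eq_bigr z) ?subrr // => S /eqP cS.
  by case: (yP S cS).
move/lfun_kerP: sumq; rewrite kq => sumg S cS.
(* Below [r] supports are zero. Above [r] the submodule divided out lies in [rad d], being generated
   by vectors in the image of [e_r]. At [d = r] the radical is zero, and directness of [X] compares
   the lifts with the decomposition from [gen_decomp]. *)
have [lt|lt|eqd] := ltngtP d r.
- by rewrite (supp_kil kC _ (zS S cS)) ?mem0v // cS.
- have [yS <-] := yP S cS; apply: rad_hom => //; apply: gX => // [T cT|].
    by case: (yP T cT).
  rewrite -(subrK u (\sum_(S : {set 'I_N} | #|S| == d) y S)) memvD //.
  apply: subvP sumg; apply: gen_le; first exact: rad_submod.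
  apply: subv_trans sW _; apply/subvP => _ /memv_imgP[x _ ->].
  by rewrite rad_img // trank_eidem.
move: sumg urad; rewrite eqd => sumg /(rad_kil kX) u0; rewrite u0 subr0 in sumg.
have [w [wP ew]] := gen_decomp rb kX sW stW sumg.
have yw : y S - w S = 0.
  apply: (dX (fun S => y S - w S)) => [T cT||]; last by rewrite cS.
    by rewrite memvB //; [case: (yP T); rewrite ?cT ?eqd | case: (wP T)].
  by rewrite big_split /= sumrN -ew subrr.
have cSr : #|S| = r by rewrite cS.
have [wS wW] := wP S cSr; have [_ <-] := yP S cS.
have -> : y S = w S by apply/eqP; rewrite -subr_eq0 yw.
have /lfun_kerP -> : w S \in lker q by rewrite kq -(kap_inj rb cSr wS) gen_mem.
exact: mem0v.
Qed.

(** Dually, the costandard layer is a quotient: with [V] a Maschke complement of a simple [W] in the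
    local module, dividing by [coker_in r V] leaves a coinduced module with local part [W]. *)
Lemma peel_ngood X : ngood X -> fullv != 0%VS :> {vspace X} ->
  exists lam C X' (i : 'Hom(X', X)) (q : 'Hom(X, C)),
    [/\ is_part (sumn lam) lam, costd lam C &
    [/\ inj_hom i, surj_hom q, lker q = limg i & ngood X']].
Proof.
move=> gX nzX; have [r [rb kX [x0 nzx0]]] := exists_apex nzX.
have nze : eim r X != 0%VS.
  by apply: contraNneq nzx0 => e0; rewrite -memv0 -e0 memv_img ?memvf.
have [W [sW stW simW]] := exists_gsimple (eim_gstable rb (M:=X)) nze.
have [lam [e [part isoW]]] := local_specht rb sW stW simW.
have [V [sV stV WV dWV]] := maschke k_char0 (gact_rep rb X) sW stW.
have KV x : x \in eim r X -> x \in coker_in r V <-> x \in V.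
  move=> /(eimP rb) xe; split=> [/coker_inP/(_ (tid N)) | xV].
    by rewrite tact1 xe.
  by apply/coker_inP => g; apply: local_act.
have [X' [i [ji imi]]] := exists_sub (coker_in_submod r V).
have [C [q [sq kq]]] := exists_quot (coker_in_submod r V).
have [hi _] := ji; have [hq _] := sq; have kC := kil_quot sq kX.
have isoC : giso (@gact k n r X) W (@gact k n r C) (eim r C).
  exists q; split; last by move=> s x _; apply: gact_hom.
    apply: capv0P => x xW; rewrite kq => /(KV _ (subvP sW _ xW)).
    exact: (capv0E dWV xW).
  rewrite -(eim_surj r sq) -WV limgD; apply/eqP; rewrite eqEsubv addvSl subv_add subvv /=.
  apply/subvP => _ /memv_imgP[x xV ->].
  by have /lfun_kerP -> : x \in lker q; rewrite ?mem0v // kq; apply/(KV x (subvP sV _ xV)).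
have coC : coinduced r C.
  split=> //.
    move=> y; have [x <-] := surj_homP sq y => h; apply/lfun_kerP; rewrite kq.
    apply/coker_inP => g; apply/KV; first by rewrite memv_img ?memvf.
    by rewrite -kq; apply/lfun_kerP; rewrite !hq h.
  move=> Y Ye Yeq; have lift h : exists w, w \in W /\ q w = Y h.
    have [phi [a b c]] := isoC; have := Ye h; rewrite capvf => /memv_imgP[z _ eY].
    have [x ex] := surj_homP sq z.
    have : tact X (eidem N r) x \in eim r X by rewrite memv_img ?memvf.
    rewrite -WV => /memv_addP[w wW [v vV ev]]; exists w; split=> //.
    rewrite eY -ex -hq ev linearD /=.
    have /lfun_kerP -> : v \in lker q; last by rewrite addr0.
    by rewrite kq; apply/(KV v (subvP sV _ vV)).
  have [w wP] := fin_all_exists lift.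
  have wuniq w1 w2 : w1 \in W -> w2 \in W -> q w1 = q w2 -> w1 = w2.
    move=> w1W w2W eq12; apply/eqP; rewrite -subr_eq0; apply/eqP.
    have mW : w1 - w2 \in W by rewrite memvB.
    apply: (capv0E dWV mW); apply/(KV _ (subvP sW _ mW)); rewrite -kq.
    by apply/lfun_kerP; rewrite linearB /= eq12 subrr.
  have [||x _ xP] := gX r rb w.
  - by move=> h; rewrite memv_cap ann_kil // andbT (subvP sW) //; case: (wP h).
  - move=> h s eh rh; have [a1 a2] := wP h; have [b1 b2] := wP (tcomp (up n s) h).
    by apply: wuniq => //; [exact: stW | rewrite b2 gact_hom // a2 Yeq].
  exists (q x); first exact: memvf.
  by move=> h eh rh; rewrite -hq xP //; case: (wP h).
exists lam, C, X', i, q; split.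
- by rewrite e.
- have isoL := giso_trans isoW isoC.
  case: r / e rb isoL coC {isoW isoC nzx0 nze sW stW simW sV stV WV dWV KV kX part imi kq kC W V}
    => rb isoL coC.
  by split.
split=> //; first by rewrite kq imi.
have kX' := kil_sub ji kX.
move=> d db Y Ye Yeq; have [lt|le] := ltnP d r.
  exists 0; rewrite ?mem0v // => h eh rh; rewrite linear0.
  have := Ye h; rewrite memv_cap => /andP[+ _].
  by move=> /(kil_eim db kX' lt) ->.
have [||x xann xP] := gX d db (fun h => i (Y h)).
- move=> h; have := Ye h; rewrite !memv_cap => /andP[he /annP ha].
  by rewrite eim_hom //=; apply/annP => f lt; rewrite -hi ha // linear0.
- by move=> h s eh rh; rewrite Yeq // gact_hom.
(* For [d > r] the vector [x] is killed by all maps of rank [r]. For [d = r] its values on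
   surjections are the prescribed ones, which lie in the local part of [X'], that is, in [V]. *)
have : x \in limg i.
  rewrite imi; apply/coker_inP => g; rewrite -tactM.
  have [-> | nz] := eqVneq (tact X (tcomp (eidem N r) g) x) 0; first exact: mem0v.
  have [eg rg] := local_cases rb kX nz.
  move: le; rewrite leq_eqVlt => /orP[/eqP dr|lt]; last first.
    by case/negP: nz; move/annP: xann => ->; rewrite ?rg.
  subst d; rewrite xP //; have := Ye (tcomp (eidem N r) g); rewrite memv_cap => /andP[he _].
  by apply/(KV _ (eim_hom hi he)); rewrite -imi memv_img ?memvf.
case/memv_imgP=> x' _ ex; exists x'.
  apply/annP => f lt; apply: (inj_homP ji); rewrite hi -ex linear0.
  by move/annP: xann; apply.
by move=> h eh rh; apply: (inj_homP ji); rewrite hi -ex xP.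
Qed.

End InducedCoinduced.

(** * The simple modules L(lam) *)

Section SimpleModules.
Variables (k : fieldType) (n : nat).
Hypothesis k_char0 : [pchar k] =i pred0.
Local Notation N := n.+1.
Implicit Types (M X Y D E C L : tmod k N) (S : {set 'I_N}) (f g h : trans N).

Lemma apexP lam M : (0 < sumn lam <= N)%N ->
  apex_specht lam M <->
  giso (pact k (lam := lam)) (specht k lam) (@gact k n (sumn lam) M) (eim (sumn lam) M).
Proof.
move=> rb; split=> -[phi [a b c]]; exists phi; split=> //.
- move=> s x xS; rewrite [pact _ _ _]lfunE /=; apply: c => //.
    exact: up_in_units.
  exact: up_restricts.
move=> g s x gu gs xS; have := c s x xS; rewrite [pact _ _ _]lfunE /= => ->.
by rewrite /gact (in_units_up rb gu gs).
Qed.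

Lemma is_L_kil lam L : is_L lam L -> kil (sumn lam) L.
Proof. by case=> _ k0 _ f x lt; rewrite k0 // lfunE. Qed.

Lemma is_LP lam L : (0 < sumn lam <= N)%N -> is_L lam L <->
  [/\ simple_mod L, kil (sumn lam) L &
   giso (pact k (lam := lam)) (specht k lam) (@gact k n (sumn lam) L) (eim (sumn lam) L)].
Proof.
move=> rb; split=> [LL|[sL kL iL]].
  by have [sL _ /(apexP _ rb) iL] := LL; split=> //; apply: is_L_kil.
split=> //; last exact/apexP.
by move=> f lt; apply/lfunP => x; rewrite kL // lfunE.
Qed.

Lemma specht_neq0 lam : specht k lam != 0%VS.
Proof.
apply/eqP => e; have := polytabloid_mem k (1%g : 'S_(sumn lam)).
by rewrite e memv0 (negPf (polytabloid_neq0 _ _)).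
Qed.

Lemma giso_neq0 lam r M (W : {vspace M}) (e : sumn lam = r) :
  giso (sact k e) (specht k lam) (@gact k n r M) W -> W != 0%VS.
Proof.
case=> phi [a b c]; apply/eqP => W0; have [x xS nx] := vspace_neq0 (specht_neq0 lam).
move/eqP: nx; apply; apply: (capv0E a xS); apply/lfun_kerP/eqP.
by rewrite -memv0 -W0 -b memv_img.
Qed.

Lemma is_L_apex lam L : (0 < sumn lam <= N)%N -> is_L lam L ->
  exists x, tact L (eidem N (sumn lam)) x != 0.
Proof.
move=> rb /(is_LP _ rb)[_ _ iL]; have nz := @giso_neq0 lam _ L _ erefl.
have /nz /vspace_neq0[_ /memv_imgP[x _ ->] nx] :
    giso (sact k (erefl (sumn lam))) (specht k lam) (@gact k n _ L) (eim (sumn lam) L).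
  by case: iL => phi [a b c]; exists phi; split=> // s x xS; rewrite sact_id c.
by exists x.
Qed.

Lemma eim_simple lam M : (0 < sumn lam <= N)%N -> is_part (sumn lam) lam ->
  giso (pact k (lam := lam)) (specht k lam) (@gact k n (sumn lam) M) (eim (sumn lam) M) ->
  gsimple (@gact k n (sumn lam) M) (eim (sumn lam) M).
Proof.
move=> rb /and3P[sl _ _] iM; apply: giso_simple iM _; first exact: specht_stable.
exact: specht_simple.
Qed.

(** Goursat's argument: the graph of the isomorphism of local modules generates a submodule of the
    direct sum whose local part is still that graph, so by simplicity it is itself the graph of an
    isomorphism. *)
Lemma iso_L lam L L' : (0 < sumn lam <= N)%N -> is_L lam L -> is_L lam L' -> iso L L'.
Proof.
move=> rb LL LL'; have [sL kL iL] := proj1 (is_LP _ rb) LL.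
have [sL' kL' iL'] := proj1 (is_LP _ rb) LL'.
have [phi [phik phii phie]] := giso_trans (giso_sym (@specht_stable k lam) iL) iL'.
have [Q [i1 [i2 [p1 [p2 [[h1 h2 hp1 hp2] [i1K i2K] [p12 p21] Qsplit]]]]]] := exists_dsum L L'.
pose j : 'Hom(L, Q) := (i1 + (i2 \o phi))%VF.
have jE y : j y = i1 y + i2 (phi y) by rewrite /j !lfunE /= lfunE.
have kQ : kil (sumn lam) Q by move=> f x lt; rewrite (Qsplit x) linearD /= -h1 -h2 kL // kL' // !linear0 addr0.
have phiE y : y \in eim (sumn lam) L -> phi y \in eim (sumn lam) L' by move=> ye; rewrite -phii memv_img.
pose W := (j @: eim (sumn lam) L)%VS.
have WP x : x \in W -> exists2 y, y \in eim (sumn lam) L & x = i1 y + i2 (phi y).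
  by case/memv_imgP=> y ye ->; exists y; rewrite ?jE.
have sW : (W <= eim (sumn lam) Q)%VS.
  by apply/subvP => x /WP[y ye ->]; rewrite memvD // eim_hom // phiE.
have stW : gstable (@gact k n (sumn lam) Q) W.
  move=> s x /WP[y ye ->]; rewrite linearD /= -(gact_hom _ _ h1) -(gact_hom _ _ h2).
  by rewrite -phie // -jE memv_img //; apply: eim_gstable.
have GW x : x \in gen W -> x \in eim (sumn lam) Q -> x \in W.
  by move=> xg xe; rewrite -(gen_eim rb kQ sW stW) memv_cap xg.
have sG := gen_submod W.
have [y0 y0e nzy0] : exists2 y, y \in eim (sumn lam) L & y != 0.
  have [x nx] := is_L_apex rb LL; exists (tact L (eidem N (sumn lam)) x) => //.
  by rewrite memv_img ?memvf.
have d0 : (gen W :&: lker p1)%VS = 0%VS.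
  have [_ sL'2] := sL'.
  case: (sL'2 _ (submod_img hp2 (submod_cap sG (submod_ker hp1)))) => e.
    apply: capv0P => x xg xk; rewrite (Qsplit x); have /lfun_kerP -> := xk.
    rewrite linear0 add0r; suff -> : p2 x = 0 by rewrite linear0.
    by apply/eqP; rewrite -memv0 -e memv_img // memv_cap xg.
  have [z0 nz] := is_L_apex rb LL'; pose z := tact L' (eidem N (sumn lam)) z0.
  have ze : z \in eim (sumn lam) L' by rewrite memv_img ?memvf.
  have : z \in (p2 @: (gen W :&: lker p1))%VS by rewrite e memvf.
  case/memv_imgP=> x; rewrite memv_cap => /andP[xg /lfun_kerP px] ez.
  have xi : x = i2 z by rewrite (Qsplit x) px linear0 add0r -ez.
  have /WP[y ye ey] : x \in W by apply: GW => //; rewrite xi eim_hom.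
  move: px; rewrite ey linearD /= i1K p12 addr0 => y0'.
  by move: nz; rewrite -/z ez ey y0' !linear0 addr0 linear0 eqxx.
have p1G : (p1 @: gen W)%VS = fullv.
  have [_ sL2] := sL; case: (sL2 _ (submod_img hp1 sG)) => // e.
  case/eqP: nzy0; apply/eqP; rewrite -memv0 -e; apply/memv_imgP; exists (j y0).
    by rewrite (subvP (gen_sub W)) // memv_img.
  by rewrite jE linearD /= i1K p12 addr0.
have sp1 : surj_hom p1 by apply: surj_homI => // y; exists (i1 y).
have [s [hs sK simg]] := compl_section sp1 sG d0 p1G.
have nzf : exists x, (p2 \o s)%VF x != 0.
  exists y0; rewrite lfunE /=; have /WP[y ye ey] : s y0 \in W.
    by apply: GW; [rewrite -simg memv_img ?memvf | apply: eim_hom].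
  have := sK y0; rewrite ey linearD /= i1K p12 addr0 => yy0.
  rewrite linearD /= p21 i2K add0r yy0; apply: contraNneq nzy0 => /lfun_kerP pk.
  by rewrite (capv0E phik y0e pk).
have hf := is_hom_comp hs hp2.
by exists (p2 \o s)%VF; split; [apply: simple_hom_inj | apply: simple_hom_surj].
Qed.

(** [L] is the quotient of [gen W] by the largest submodule killed by [e_r]. A submodule not killed
    by [e_r] contains the whole local module, which is simple, and thus everything. *)
Lemma L_of_gen r lam (e : sumn lam = r) X (W : {vspace X}) : (0 < r <= N)%N ->
  is_part r lam -> kil r X ->
  (W <= eim r X)%VS -> gstable (@gact k n r X) W ->
  giso (sact k e) (specht k lam) (@gact k n r X) W ->
  exists D L (i : 'Hom(D, X)) (p : 'Hom(D, L)),
    [/\ is_L lam L, inj_hom i, limg i = gen W & surj_hom p].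
Proof.
move=> rb part kX sW stW isoW; have [D [i [ji imi]]] := exists_sub (gen_submod W).
have [kD iD gD] := sub_gen rb kX sW stW ji imi; have [hi ki] := ji.
have isoD : giso (sact k e) (specht k lam) (@gact k n r D) (eim r D).
  apply: giso_trans isoW _; apply: giso_sym; first exact: eim_gstable.
  exists i; rewrite iD ki capv0; split=> // s x _; exact: gact_hom.
have [L [p [sp kp]]] := exists_quot (coker_in_submod r (0%VS : {vspace D})).
have [hp _] := sp; exists D, L, i, p; split=> //.
have K0 x : x \in eim r D -> x \in lker p -> x = 0.
  rewrite kp => /(eimP rb) xe /coker_inP/(_ (tid N)).
  by rewrite tact1 xe memv0 => /eqP.
have isoL : giso (sact k e) (specht k lam) (@gact k n r L) (eim r L).
  apply: giso_trans isoD _; exists p; rewrite (eim_surj r sp); split=> //.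
    exact: capv0P.
  by move=> s x _; apply: gact_hom.
have kL := kil_quot sp kD.
have simL : simple_mod L.
  split.
    have [y ye ny] := vspace_neq0 (giso_neq0 isoL).
    by apply: contraNneq ny => e0; rewrite -memv0 -e0 memvf.
  move=> U sU; have sU' := submod_preim hp sU.
  have [le|/subvPn[x xU]] := boolP (p @^-1: U <= lker p)%VS.
    left; apply: vspace0P => y yU; have [x ex] := surj_homP sp y.
    by rewrite -ex; apply/lfun_kerP; apply: (subvP le); rewrite -memv_preim ex.
  rewrite kp => nx; right.
  have [g ng] : exists g, tact D (eidem N r) (tact D g x) != 0.
    apply: NNPP => no; move/negP: nx; apply; apply/coker_inP => g; rewrite memv0.
    by apply/negPn/negP => ng; apply: no; exists g.
  have simD : gsimple (@gact k n r D) (eim r D).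
    apply: giso_simple isoD _; first by have [] := sact_rep k e.
    by apply: sact_simple => //; case/and3P: part.
  have eU : (eim r D <= p @^-1: U)%VS.
    rewrite -(gsimple_gen simD (capvSr (p @^-1: U)%VS _)) ?capvSl //.
      exact: submod_gstable.
    apply: contraNneq ng => e0; rewrite -memv0 -e0 memv_cap.
    rewrite memv_img ?memvf // andbT; move/submodP: sU' => sU'.
    by rewrite !sU'.
  apply/eqP; rewrite eqEsubv subvf; apply/subvP => y _; have [z <-] := surj_homP sp y.
  rewrite memv_preim; have := gen_le sU' eU; rewrite gD => /subvP; apply.
  exact: memvf.
case: r / e rb kL isoL {part kX sW stW isoW kD iD gD isoD K0 kp} => rb kL isoL.
by apply/is_LP.
Qed.

(** Used to detect weights: a module on which some map of rank below [r] acts nontrivially has a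
    subquotient L(mu) with [mu] of size below [r]. *)
Lemma L_subquot M : fullv != 0%VS :> {vspace M} ->
  exists lam D L (i : 'Hom(D, M)) (p : 'Hom(D, L)),
    [/\ in_Lambda N lam, kil (sumn lam) M, is_L lam L & inj_hom i /\ surj_hom p].
Proof.
move=> nz; have [r [rb kX [x0 nzx0]]] := exists_apex nz.
have nze : eim r M != 0%VS.
  by apply: contraNneq nzx0 => e0; rewrite -memv0 -e0 memv_img ?memvf.
have [W [sW stW simW]] := exists_gsimple (eim_gstable rb (M := M)) nze.
have [lam [e [part isoW]]] := local_specht k_char0 rb sW stW simW.
have [D [L [i [p [LL ji _ sp]]]]] := L_of_gen rb part kX sW stW isoW.
exists lam, D, L, i, p; split=> //; last by rewrite e.
by rewrite /in_Lambda e part.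
Qed.

End SimpleModules.

(** * Injective and projective modules *)

Section FunctionModule.
Variables (k : fieldType) (n : nat).
Implicit Types (f g h t : trans n).

(* The dual of the right regular module: functions on T_n, with
   (g F)(f) = F(f g). *)
Definition fmod_car : vectType k := {ffun trans n -> k^o}.

Definition fmod_act0 g (F : fmod_car) : fmod_car := [ffun f => F (tcomp f g)].

Lemma fmod_act_linear g : linear (fmod_act0 g).
Proof. by move=> c x y; apply/ffunP => f; rewrite !ffunE. Qed.
HB.instance Definition _ g := GRing.isLinear.Build k _ _ _ (fmod_act0 g) (fmod_act_linear g).

Definition fmod_act g : 'End(fmod_car) := linfun (fmod_act0 g).

Lemma fmod_actE g F f : fmod_act g F f = F (tcomp f g).
Proof. by rewrite lfunE ffunE. Qed.

Lemma tcomp_assoc f g h : tcomp f (tcomp g h) = tcomp (tcomp f g) h.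
Proof. by apply/ffunP => i; rewrite !ffunE. Qed.

Lemma tcomp1 f : tcomp f (tid n) = f.
Proof. by apply/ffunP => i; rewrite !ffunE. Qed.

Lemma tcomp_1 f : tcomp (tid n) f = f.
Proof. by apply/ffunP => i; rewrite !ffunE. Qed.

Lemma fmod_act1 F : fmod_act (tid n) F = F.
Proof. by apply/ffunP => f; rewrite fmod_actE tcomp1. Qed.

Lemma fmod_actM f g F : fmod_act (tcomp f g) F = fmod_act f (fmod_act g F).
Proof. by apply/ffunP => h; rewrite !fmod_actE tcomp_assoc. Qed.

Definition fmod : tmod k n := TMod fmod_act1 fmod_actM.

(** Every functional comes from a homomorphism into [fmod] by evaluation at the identity. So [fmod]
    is cofree, and extending homomorphisms into it amounts to extending functionals. *)
Lemma fmod_hom (M : tmod k n) (phi : 'Hom(M, k^o)) :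
  exists2 h : 'Hom(M, fmod), is_hom h & forall x f, h x f = phi (tact M f x).
Proof.
have l : linear (fun x : M => [ffun f => phi (tact M f x)] : fmod_car).
  by move=> c x y; apply/ffunP => f; rewrite !ffunE !linearP.
have [h hE] := linear_hom l.
have hE' x f : h x f = phi (tact M f x) by rewrite hE ffunE.
by exists h => // g x; apply/ffunP => f; rewrite fmod_actE !hE' tactM.
Qed.

Lemma fmod_injective : injective_mod fmod.
Proof.
move=> A B i f ji hf; have [hi ki] := ji.
have l : linear (fun F : fmod => F (tid n) : k^o) by move=> c x y; rewrite !ffunE.
have [ev evE] := linear_hom l.
have [h hh hE] := fmod_hom (ev \o f \o i^-1)%VF.
exists h => //; apply/lfunP => a; apply/ffunP => t; rewrite lfunE /= hE.
rewrite -(ji.1 t a) !lfunE /= lfunE /= (lfunVK_inj _ ki) evE hf /=.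
by rewrite fmod_actE tcomp_1.
Qed.

Lemma fmod_embed (L : tmod k n) : simple_mod L -> exists i : 'Hom(L, fmod), inj_hom i.
Proof.
move=> sL; have [nz _] := sL; have [v _ nv] := vspace_neq0 nz.
have [j nj] : exists j, coord (vbasis (fullv : {vspace L})) j v != 0.
  apply: NNPP => no; case/negP: nv; apply/eqP; rewrite (coord_vbasis (memvf v)).
  apply: big1 => j _; have [-> | nj] := eqVneq (coord (vbasis fullv) j v) 0.
    by rewrite scale0r.
  by case: no; exists j.
have l : linear (fun x : L => coord (vbasis fullv) j x : k^o).
  by move=> c x y; rewrite linearP.
have [phi phiE] := linear_hom l; have [h hh hE] := fmod_hom phi.
exists h; apply: simple_hom_inj => //; exists v; apply: contraNneq nj => e.
by rewrite -phiE -[v]tact1 -hE e ffunE.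
Qed.

End FunctionModule.

(** * The permutation modules k Hom([r], [n]) *)

Section PermutationModule.
Variables (k : fieldType) (n r : nat).
Local Notation tp := {ffun 'I_r -> 'I_n}.
Implicit Types (f g : trans n) (h : tp).

Definition pcomp g h : tp := [ffun i => g (h i)].

Definition kmap_car : vectType k := {ffun tp -> k^o}.
Definition delta h : kmap_car := [ffun h' => (h' == h)%:R].

Definition kmap_act0 g (F : kmap_car) : kmap_car := \sum_h F h *: delta (pcomp g h).

Lemma kmap_act_linear g : linear (kmap_act0 g).
Proof.
move=> c x y; rewrite /kmap_act0 scaler_sumr -big_split /=; apply: eq_bigr => h _.
by rewrite !ffunE scalerDl scalerA.
Qed.
HB.instance Definition _ g := GRing.isLinear.Build k _ _ _ (kmap_act0 g) (kmap_act_linear g).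

Definition kmap_act g : 'End(kmap_car) := linfun (kmap_act0 g).

Lemma delta_sum (F : kmap_car) : F = \sum_h F h *: delta h.
Proof.
apply/ffunP => h; rewrite sum_ffunE (bigD1 h) //= big1 => [|h' ne].
  by rewrite !ffunE eqxx addr0 /GRing.scale /= mulr1.
by rewrite !ffunE eq_sym (negPf ne) scaler0.
Qed.

Lemma kmap_act_delta g h : kmap_act g (delta h) = delta (pcomp g h).
Proof.
rewrite lfunE /= /kmap_act0 (bigD1 h) //= big1 => [|h' ne].
  by rewrite ffunE eqxx scale1r addr0.
by rewrite ffunE (negPf ne) scale0r.
Qed.

Lemma kmap_act1 F : kmap_act (tid n) F = F.
Proof.
rewrite {1}(delta_sum F) linear_sum /= [RHS]delta_sum; apply: eq_bigr => h _.
rewrite linearZ /= kmap_act_delta; congr (_ *: delta _).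
by apply/ffunP => i; rewrite !ffunE.
Qed.

Lemma kmap_actM f g F : kmap_act (tcomp f g) F = kmap_act f (kmap_act g F).
Proof.
rewrite (delta_sum F) !linear_sum /=; apply: eq_bigr => h _.
rewrite !linearZ /= !kmap_act_delta; congr (_ *: delta _).
by apply/ffunP => i; rewrite !ffunE.
Qed.

(* The permutation module k Hom([r], [n]). *)
Definition kmap : tmod k n := TMod kmap_act1 kmap_actM.

Lemma delta_sub (U : {vspace kmap}) (F : kmap) :
  (forall h, F h != 0 -> delta h \in U) -> F \in U.
Proof.
move=> dU; rewrite (delta_sum F); apply: memv_suml => h _.
by have [-> | nz] := eqVneq (F h) 0; rewrite ?scale0r ?mem0v // memvZ // dU.
Qed.

End PermutationModule.

Section Regular.
Variables (k : fieldType) (n : nat).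

(** For [r = n] the basis is [T_n] itself: [kmap k n n] is the regular module, free on the
    identity. *)
Lemma kmap_hom (M : tmod k n) (m : M) :
  exists2 h : 'Hom(kmap k n n, M), is_hom h & forall f, h (delta k f) = tact M f m.
Proof.
have l : linear (fun F : kmap k n n => \sum_h F h *: tact M h m).
  move=> c x y; rewrite scaler_sumr -big_split /=; apply: eq_bigr => h _.
  by rewrite !ffunE scalerDl scalerA.
have [h hE] := linear_hom l.
have hd f : h (delta k f) = tact M f m.
  rewrite hE (bigD1 f) //= big1 => [|f' ne]; first by rewrite ffunE eqxx scale1r addr0.
  by rewrite ffunE (negPf ne) scale0r.
exists h => // g F; rewrite (delta_sum F) !linear_sum /=; apply: eq_bigr => f _.
by rewrite !linearZ /= kmap_act_delta !hd -tactM.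
Qed.

Lemma kmap_projective : projective (kmap k n n).
Proof.
move=> M P p f sp hf; have [hp _] := sp.
have [m em] := surj_homP sp (f (delta k (tid n))).
have [h hh hE] := kmap_hom m; exists h => //; apply/lfunP => F; rewrite lfunE /=.
rewrite (delta_sum F) !linear_sum /=; apply: eq_bigr => t _; rewrite !linearZ /= hE hp em.
rewrite -hf /= kmap_act_delta; congr (_ *: f (delta k _)).
by apply/ffunP => i; rewrite !ffunE.
Qed.

Lemma kmap_onto (L : tmod k n) : simple_mod L -> exists p : 'Hom(kmap k n n, L), surj_hom p.
Proof.
move=> sL; have [nz _] := sL; have [v _ nv] := vspace_neq0 nz.
have [h hh hE] := kmap_hom v; exists h; apply: simple_hom_surj => //.
by exists (delta k (tid n)); rewrite hE tact1.
Qed.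

End Regular.

(** * Existence of standard and simple modules *)

Section ExistsStandard.
Variables (k : fieldType) (n : nat).
Hypothesis k_char0 : [pchar k] =i pred0.
Local Notation N := n.+1.
Implicit Types (S : {set 'I_N}).

Section Kmap.
Variable r : nat.
Hypothesis rb : (0 < r <= N)%N.
Let r0 : (0 < r)%N. Proof. by case/andP: rb. Qed.
Let rN : (r <= N)%N. Proof. by case/andP: rb. Qed.
Local Notation X := (kmap k N r).
Local Notation tp := {ffun 'I_r -> 'I_N}.

Definition pim (h : tp) : {set 'I_N} := [set h i | i : 'I_r].

Lemma kmap_act_nz g (F : X) h : tact X g F h != 0 -> exists h', h = pcomp g h'.
Proof.
rewrite /= {1}(delta_sum F) linear_sum /= sum_ffunE => nz; apply: NNPP => no.
case/negP: nz; apply/eqP/big1 => h' _; rewrite linearZ /= kmap_act_delta !ffunE.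
by case: eqP => [e|]; [case: no; exists h' | rewrite scaler0].
Qed.

Lemma kmap_supp S (F : X) h : F \in supp X S -> F h != 0 -> pim h \subset S.
Proof.
have l : linear (fun F : X => F h : k^o) by move=> c x y; rewrite !ffunE.
have [ev evE] := linear_hom l => FS nz; apply: contraNT nz => ns.
rewrite -evE; apply/eqP/lfun_kerP; apply: subvP FS; apply: supp_sub => g x gS.
apply/lfun_kerP; rewrite evE; apply: contraNeq ns => /kmap_act_nz[h' ->].
by apply/subsetP => _ /imsetP[i _ ->]; rewrite ffunE (subsetP gS) ?mem_tim.
Qed.

Lemma kmap_rad (F : X) h : F \in rad r X -> F h != 0 -> (#|pim h| < r)%N.
Proof.
have l : linear (fun F : X => F h : k^o) by move=> c x y; rewrite !ffunE.
have [ev evE] := linear_hom l => FS nz; apply: contraNT nz => ns.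
rewrite -evE; apply/eqP/lfun_kerP; apply: subvP FS; apply: rad_sub => g x gS.
apply/lfun_kerP; rewrite evE; apply: contraNeq ns => /kmap_act_nz[h' ->].
apply: leq_ltn_trans gS; apply/subset_leq_card/subsetP => _ /imsetP[i _ ->].
by rewrite ffunE mem_tim.
Qed.

Lemma kmap_radI (F : X) : (forall h, F h != 0 -> (#|pim h| < r)%N) -> F \in rad r X.
Proof.
move=> Fr; apply: delta_sub => h /Fr lt.
pose i0 := Ordinal r0.
(* A retraction onto the image of [h]; it fixes [delta h] and has the same rank as [h]. *)
pose g : trans N := [ffun i => if i \in pim h then i else h i0].
have -> : delta k h = tact X g (delta k h).
  rewrite /= kmap_act_delta; congr (delta k _); apply/ffunP => i.
  by rewrite !ffunE imset_f.
apply: rad_img; apply: leq_ltn_trans lt; apply/subset_leq_card/subsetP => _ /imsetP[i _ ->].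
by rewrite ffunE; case: ifP => // _; apply: imset_f.
Qed.

Definition incl (s : 'S_r) : tp := [ffun i => widen_ord rN (s i)].

Lemma pim_incl s : #|pim (incl s)| = r.
Proof.
rewrite card_imset ?card_ord // => i j; rewrite !ffunE => /(congr1 val) /= /val_inj.
exact: perm_inj.
Qed.

Lemma incl_inj : injective incl.
Proof.
move=> s t /ffunP e; apply/permP => i; have := e i; rewrite !ffunE.
by move=> /(congr1 val) /= /val_inj.
Qed.

Lemma up_incl (s u : 'S_r) : pcomp (up n u) (incl s) = incl (s * u)%g.
Proof.
apply/ffunP => i; rewrite [LHS]ffunE [incl s i]ffunE [RHS]ffunE; apply: val_inj => /=.
by rewrite permM; apply: up_val.
Qed.

Lemma incl_eidem (s : 'S_r) : pcomp (eidem N r) (incl s) = incl s.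
Proof. by rewrite -(up1 rb) up_incl mulg1. Qed.

(** [Y] is k Inj([r], [n]). Its image under [e_r] contains a regular representation of the symmetric
    group, spanned by the classes of [incl s], and this contains every Specht module. *)
Lemma kmap_quot_specht lam (e : sumn lam = r) : is_part r lam ->
  exists (Y : tmod k N) (W : {vspace Y}),
  [/\ kil r Y, direct r Y, (W <= eim r Y)%VS, gstable (@gact k n r Y) W &
      giso (sact k e) (specht k lam) (@gact k n r Y) W].
Proof.
move=> part; have [Y [p [sp kp]]] := exists_quot (rad_submod r X).
have [hp _] := sp; exists Y.
have [x0 x0S nx0] := vspace_neq0 (specht_neq0 k lam).
have [w0 nw0] : exists w0, x0 w0 != 0.
  apply: NNPP => no; case/negP: nx0; apply/eqP/ffunP => w; rewrite ffunE.
  by apply: NNPP => /eqP nz; apply: no; exists w.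
(* The embedding into the regular representation by matrix coefficients at [w0]; it is nonzero
   because the coefficient of the identity is [x w0]. *)
pose phi (x : perm_space k lam) : Y :=
  \sum_(s : 'S_r) (sact k e s^-1%g x w0) *: p (delta k (incl s)).
have philin : linear phi.
  move=> c x y; rewrite /phi scaler_sumr -big_split /=; apply: eq_bigr => s _.
  by rewrite linearP !ffunE scalerDl scalerA.
have [Phi PhiE] := linear_hom philin.
have [stS a1 aM] := sact_rep k e.
have PhiM s x : x \in specht k lam -> Phi (sact k e s x) = gact Y s (Phi x).
  move=> xS; rewrite !PhiE /phi linear_sum /= [LHS](reindex_inj (mulIg s)) /=.
  apply: eq_bigr => t _; rewrite linearZ /= -(gact_hom s _ hp) /gact /= kmap_act_delta up_incl.
  congr (_ *: _); rewrite aM // invMg mulKVg //.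
exists (Phi @: specht k lam)%VS.
have kY : kil r Y.
  move=> f y lt; have [x <-] := surj_homP sp y; rewrite -hp.
  by apply/lfun_kerP; rewrite kp rad_img.
split=> //.
- move=> z zS z0 S cS.
  have lift (T : {set 'I_N}) : exists y, #|T| = r -> y \in supp X T /\ p y = z T.
    have [cT|nT] := eqVneq #|T| r; last by exists 0 => cT; rewrite cT eqxx in nT.
    by have [y yT ey] := supp_surj sp (zS T cT); exists y.
  have [y yP] := fin_all_exists lift; have [yS <-] := yP S cS.
  have sumr : \sum_(T : {set 'I_N} | #|T| == r) y T \in rad r X.
    rewrite -kp; apply/lfun_kerP; rewrite linear_sum /= (eq_bigr z) // => T /eqP cT.
    by case: (yP T cT).
  apply/lfun_kerP; rewrite kp; apply: kmap_radI => h nh.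
  have hS := kmap_supp yS nh; rewrite ltnNge; apply/negP => ge.
  have eS : pim h = S by apply/eqP; rewrite eqEcard hS cS.
  have : (#|pim h| < r)%N; last by rewrite ltnNge ge.
  apply: (kmap_rad sumr); rewrite sum_ffunE (bigD1 S) ?cS //= big1 ?addr0 // => T /andP[/eqP cT ne].
  apply/eqP; apply: contraNT ne => nT; have [yT _] := yP T cT.
  have := kmap_supp yT nT; rewrite eS => ST.
  by rewrite eq_sym eqEcard ST cS cT /=.
- apply/subvP => _ /memv_imgP[x xS ->]; rewrite PhiE; apply: memv_suml => s _.
  rewrite memvZ //; apply/(eimP rb); rewrite -hp /= kmap_act_delta incl_eidem //.
- by move=> s _ /memv_imgP[x xS ->]; rewrite -PhiM // memv_img // stS.
apply: gsimple_giso_img => //; first by apply: sact_simple => //; case/and3P: part.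
apply/eqP => W0; case/negP: nw0.
have : Phi x0 = 0 by apply/eqP; rewrite -memv0 -W0 memv_img.
rewrite PhiE /phi.
have -> : \sum_(s : 'S_r) sact k e s^-1%g x0 w0 *: p (delta k (incl s)) =
  p (\sum_(s : 'S_r) sact k e s^-1%g x0 w0 *: (delta k (incl s) : X)).
  by rewrite linear_sum; apply: eq_bigr => s _; rewrite linearZ.
move/lfun_kerP; rewrite kp => inr; apply/negPn/negP => nz.
have := kmap_rad (h := incl 1%g) inr; rewrite pim_incl ltnn => h.
suff : false by []; apply: h.
rewrite sum_ffunE (bigD1 1%g) //= big1 => [|s ne].
  rewrite addr0 !ffunE eqxx invg1 a1 // /GRing.scale /= mulr1; exact: nz.
rewrite !ffunE; case: eqP => [/incl_inj es|]; last by rewrite scaler0.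
by rewrite es eqxx in ne.
Qed.

End Kmap.

Lemma exists_std lam : in_Lambda N lam -> exists D : tmod k N, std lam D.
Proof.
case/andP=> part rb; have [Y [W [kY dY sW stW isoW]]] := kmap_quot_specht rb erefl part.
have [D [i [ji imi]]] := exists_sub (gen_submod W).
by exists D; apply: sub_std rb kY dY sW stW isoW ji imi.
Qed.

Lemma exists_L lam : in_Lambda N lam -> exists L : tmod k N, is_L lam L.
Proof.
case/andP=> part rb; have [Y [W [kY dY sW stW isoW]]] := kmap_quot_specht rb erefl part.
have [D [L [i [p [LL _ _ _]]]]] := L_of_gen k_char0 rb part kY sW stW isoW.
by exists L.
Qed.

End ExistsStandard.

(** * Fitting's lemma, projective covers and injective envelopes *)

Section Fitting.
Variables (k : fieldType) (n : nat).
Implicit Types M P Q L I : tmod k n.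

Definition hpow M (h : 'End(M)) m : 'End(M) := iter m (fun f => (h \o f)%VF) \1%VF.

Lemma hpowE M (h : 'End(M)) m x : hpow h m x = iter m h x.
Proof. by elim: m => [|m IH] /=; rewrite ?id_lfunE // lfunE /= IH. Qed.

Lemma hpow_hom M (h : 'End(M)) m : is_hom h -> is_hom (hpow h m).
Proof. by move=> hh; elim: m => [|m IH]; [apply: is_hom_id | apply: is_hom_comp]. Qed.

(** A positive power with image of least dimension works. Positivity matters later: the kernel of
    the power contains that of [h], and its image lies in that of [h]. *)
Lemma fitting M (h : 'End(M)) : is_hom h -> exists m,
  (lker (hpow h m.+1) :&: limg (hpow h m.+1))%VS = 0%VS /\
  (lker (hpow h m.+1) + limg (hpow h m.+1))%VS = fullv.
Proof.
move=> hh; have [m mmin] : exists m, forall m', (\dim (limg (hpow h m.+1)) <= \dim (limg (hpow h m'.+1)))%N.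
  have [d] := ubnP (\dim (limg (hpow h 1))).
  elim: d 0%N => // d IH m lt.
  have [min|] := classic (forall m', (\dim (limg (hpow h m.+1)) <= \dim (limg (hpow h m'.+1)))%N).
    by exists m.
  move=> nmin; have [m' lt'] : exists m', (\dim (limg (hpow h m'.+1)) < \dim (limg (hpow h m.+1)))%N.
    apply: NNPP => no; apply: nmin => m'; rewrite leqNgt; apply/negP => lt'.
    by apply: no; exists m'.
  by apply: (IH m'); apply: leq_trans lt' _.
exists m; set f := hpow h m.+1; have ff : (f @: limg f)%VS = limg f.
  apply/eqP; rewrite eqEdim limgS ?subvf //=.
  have -> : (f @: limg f)%VS = limg (hpow h (m.+1 + m).+1); last exact: mmin.
  rewrite -limg_comp; congr (_ @: _)%VS; apply/lfunP => x.
  by rewrite [LHS]lfunE -[LHS]/(hpow h m.+1 (hpow h m.+1 x)) !hpowE -iterD addnS.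
have d0 : (lker f :&: limg f)%VS = 0%VS.
  apply/eqP; rewrite -dimv_eq0 capvC; have := limg_ker_dim f (limg f).
  by rewrite ff => /eqP; rewrite -[X in _ == X]add0n eqn_add2r.
split=> //; apply/eqP; rewrite eqEdim subvf /=.
have := dimv_sum_cap (lker f) (limg f); rewrite d0 dimv0 addn0 => ->.
by have := limg_ker_dim f fullv; rewrite capfv => ->.
Qed.

Lemma complement_retract M (K V : {vspace M}) : submod K -> submod V ->
  (K :&: V)%VS = 0%VS -> (K + V)%VS = fullv ->
  exists Q (s : 'Hom(Q, M)) (p : 'Hom(M, Q)),
    [/\ is_hom s, is_hom p, forall x, p (s x) = x, limg s = V & lker p = K].
Proof.
move=> sK sV d0 KV; have [Q [p [sp kp]]] := exists_quot sK; have [hp _] := sp.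
have [|| s [hs ps simg]] := compl_section (Z := V) sp sV.
- by rewrite kp capvC.
- apply/eqP; rewrite eqEsubv subvf; apply/subvP => y _; have [x <-] := surj_homP sp y.
  have : x \in (K + V)%VS by rewrite KV memvf.
  case/memv_addP=> u; rewrite -kp => /lfun_kerP pu [v vV ->].
  by rewrite linearD /= pu add0r memv_img.
by exists Q, s, p; split.
Qed.

Lemma retract_projective M Q (s : 'Hom(Q, M)) (p : 'Hom(M, Q)) :
  is_hom s -> is_hom p -> (forall x, p (s x) = x) -> projective M -> projective Q.
Proof.
move=> hs hp ps pM A B q f sq hf.
have [h hh e] := pM A B q (f \o p)%VF sq (is_hom_comp hp hf).
exists (h \o s)%VF; first exact: is_hom_comp.
apply/lfunP => x; move/lfunP/(_ (s x)): e; rewrite !comp_lfunE ps => <-.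
by [].
Qed.

Lemma retract_injective M Q (s : 'Hom(Q, M)) (p : 'Hom(M, Q)) :
  is_hom s -> is_hom p -> (forall x, p (s x) = x) -> injective_mod M -> injective_mod Q.
Proof.
move=> hs hp ps iM A B i f ji hf.
have [h hh e] := iM A B i (s \o f)%VF ji (is_hom_comp hf hs).
exists (p \o h)%VF; first exact: is_hom_comp.
apply/lfunP => x; move/lfunP/(_ x): e; rewrite !comp_lfunE => ->.
exact: ps.
Qed.

(** If a proper submodule [U] still maps onto [L], projectivity gives an endomorphism [h] with image
    in [U] and [p h = p]. The image of its Fitting power is a smaller summand that maps onto [L]. *)
Lemma exists_proj_cover L Q (p : 'Hom(Q, L)) : projective Q -> surj_hom p ->
  exists P, proj_cover L P.
Proof.
have [d] := ubnP (\dim (fullv : {vspace Q})); elim: d Q p => // d IH Q p ltd pQ sp.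
have [ess|ness] := classic (forall U : {vspace Q}, submod U ->
  (U + lker p)%VS = fullv -> U = fullv); first by exists Q; split=> //; exists p.
have [U [sU UK nU]] : exists U : {vspace Q}, [/\ submod U, (U + lker p)%VS = fullv & U <> fullv].
  apply: NNPP => no; apply: ness => U sU UK; apply: NNPP => nU; apply: no.
  by exists U.
have [hp _] := sp; have [U' [i [ji imi]]] := exists_sub sU; have [hi _] := ji.
have spi : surj_hom (p \o i)%VF.
  apply: surj_homI; first exact: is_hom_comp.
  move=> y; have [x <-] := surj_homP sp y.
  have : x \in (U + lker p)%VS by rewrite UK memvf.
  case/memv_addP=> u; rewrite -imi => /memv_imgP[u' _ ->] [v /lfun_kerP pv ->].
  by exists u'; rewrite lfunE /= linearD /= pv addr0.
have [h0 hh0 e] := pQ _ _ (p \o i)%VF p spi hp.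
pose h := (i \o h0)%VF; have hh : is_hom h by apply: is_hom_comp.
have ph x : p (h x) = p x by move/lfunP/(_ x): e; rewrite !lfunE /= lfunE.
have [m [d0 fl]] := fitting hh; set f := hpow h m.+1 in d0 fl.
have hf : is_hom f by apply: hpow_hom.
have pf x : p (f x) = p x.
  by rewrite /f hpowE; elim: m.+1 => //= q IHq; rewrite ph IHq.
have fU : (limg f <= U)%VS.
  by apply/subvP => _ /memv_imgP[x _ ->]; rewrite /f /= lfunE /= /h lfunE /= -imi memv_img ?memvf.
have [P [s [t [hs ht ts simg kt]]]] := complement_retract (submod_ker hf)
  (submod_img hf (submod_full Q)) d0 fl.
apply: (IH P (p \o s)%VF).
- rewrite ltnS in ltd; apply: leq_trans ltd.
  have -> : \dim (fullv : {vspace P}) = \dim (limg s).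
    by rewrite limg_dim_eq // capfv; apply: vspace0P => x /lfun_kerP sx; rewrite -(ts x) sx linear0.
  rewrite simg; apply: leq_ltn_trans (dimvS fU) _; apply: ltn_dimv; first exact: subvf.
  exact/eqP.
- exact: retract_projective hs ht ts pQ.
apply: surj_homI; first exact: is_hom_comp.
move=> y; have [x <-] := surj_homP sp y; have : f x \in limg s.
  by rewrite simg memv_img ?memvf.
by case/memv_imgP=> z _ e'; exists z; rewrite lfunE /= -e' pf.
Qed.

(** Dually, a nonzero submodule missing [L] yields an endomorphism that kills it and fixes [L]; its
    Fitting power has a smaller summand containing [L] as image. *)
Lemma exists_inj_envelope L Q (i : 'Hom(L, Q)) : injective_mod Q -> inj_hom i ->
  exists I, inj_envelope L I.
Proof.
have [d] := ubnP (\dim (fullv : {vspace Q})); elim: d Q i => // d IH Q i ltd iQ ji.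
have [ess|ness] := classic (forall U : {vspace Q}, submod U ->
  (U :&: limg i)%VS = 0%VS -> U = 0%VS); first by exists Q; split=> //; exists i.
have [U [sU UK nU]] : exists U : {vspace Q}, [/\ submod U, (U :&: limg i)%VS = 0%VS & U <> 0%VS].
  apply: NNPP => no; apply: ness => U sU UK; apply: NNPP => nU; apply: no.
  by exists U.
have [hi _] := ji; have [Q' [p [sp kp]]] := exists_quot sU; have [hp _] := sp.
have jpi : inj_hom (p \o i)%VF.
  apply: inj_homI; first exact: is_hom_comp.
  move=> x; rewrite lfunE /= => /lfun_kerP; rewrite kp => ixU.
  by apply: (inj_homP ji); rewrite linear0; apply: (capv0E UK ixU); rewrite memv_img ?memvf.
have [h0 hh0 e] := iQ _ _ (p \o i)%VF i jpi hi.
pose h := (h0 \o p)%VF; have hh : is_hom h by apply: is_hom_comp.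
have ph x : h (i x) = i x by move/lfunP/(_ x): e; rewrite !lfunE /= lfunE.
have [m [d0 fl]] := fitting hh; set f := hpow h m.+1 in d0 fl.
have hf : is_hom f by apply: hpow_hom.
have pf x : f (i x) = i x.
  by rewrite /f hpowE; elim: m.+1 => //= q IHq; rewrite IHq ph.
have fU : (U <= lker f)%VS.
  apply/subvP => x; rewrite -kp => /lfun_kerP px; apply/lfun_kerP.
  by rewrite /f hpowE iterSr /h lfunE /= px linear0 -hpowE linear0.
have [P [s [t [hs ht ts simg kt]]]] := complement_retract (submod_ker hf)
  (submod_img hf (submod_full Q)) d0 fl.
have js : inj_hom s by apply: inj_homI => // x sx; rewrite -(ts x) sx linear0.
apply: (IH P (t \o i)%VF).
- rewrite ltnS in ltd; apply: leq_trans ltd.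
  have -> : \dim (fullv : {vspace P}) = \dim (limg s).
    by rewrite limg_dim_eq // capfv; case: js.
  rewrite simg; have := limg_ker_dim f fullv; rewrite capfv => <-.
  rewrite -[ltnLHS]add0n ltn_add2r lt0n dimv_eq0; apply: contra_notN nU => /eqP k0.
  by apply/eqP; rewrite -subv0 -k0.
- exact: retract_injective hs ht ts iQ.
apply: inj_homI; first exact: is_hom_comp.
move=> x; rewrite lfunE /= => tx.
have : i x \in limg s by rewrite simg -pf memv_img ?memvf.
case/memv_imgP=> z _ ez; apply: (inj_homP ji); rewrite linear0 ez.
by move: tx; rewrite ez ts => ->; rewrite linear0.
Qed.

Lemma cover_max L P (p : 'Hom(P, L)) (U : {vspace P}) : simple_mod L -> surj_hom p ->
  (forall V : {vspace P}, submod V -> (V + lker p)%VS = fullv -> V = fullv) ->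
  submod U -> (U <= lker p)%VS \/ U = fullv.
Proof.
move=> [_ sL] sp ess sU; have [hp _] := sp.
case: (sL _ (submod_img hp sU)) => e; [left|right].
  apply/subvP => x xU; apply/lfun_kerP/eqP; rewrite -memv0 -e memv_img //.
apply: ess => //; apply/eqP; rewrite eqEsubv subvf; apply/subvP => x _.
have : p x \in (p @: U)%VS by rewrite e memvf.
case/memv_imgP=> u uU epx; rewrite -(subrK u x) addrC memv_add //.
by apply/lfun_kerP; rewrite linearB /= epx subrr.
Qed.

End Fitting.

(** * Standard modules as quotients of projective covers *)

Section Standard.
Variables (k : fieldType) (n : nat).
Hypothesis k_char0 : [pchar k] =i pred0.
Local Notation N := n.+1.
Implicit Types (M X Y D E C L P Q : tmod k N).

Lemma exists_P mu : in_Lambda N mu -> exists P : tmod k N, is_P mu P.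
Proof.
move=> muL; have [L LL] := exists_L k_char0 muL; have [sL _ _] := LL.
have [p sp] := kmap_onto sL; have [P cP] := exists_proj_cover (kmap_projective (n := N)) sp.
by exists P, L.
Qed.

Lemma std_iso lam D D' : in_Lambda N lam -> std lam D' -> iso D D' -> std lam D.
Proof.
case/andP=> _ rb [[kD gD dD] _ isoD] [f [jf sf]].
apply: (sub_std (e := erefl (sumn lam)) rb kD dD (subvv _) (eim_gstable rb (M := D')) _ jf).
  by case: isoD => phi [a b c]; exists phi; split=> // s x xS; rewrite sact_id c.
by rewrite gD; case: sf.
Qed.

Lemma std_gen lam D (U : {vspace D}) : in_Lambda N lam -> std lam D -> submod U ->
  (exists2 x, x \in U & tact D (eidem N (sumn lam)) x != 0) -> U = fullv.
Proof.
case/andP=> part rb [[kD gD dD] _ isoD] sU [x xU nx].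
have simD := eim_simple k_char0 rb part isoD.
have eU : (eim (sumn lam) D <= U)%VS.
  rewrite -(gsimple_gen simD (capvSr U _) (submod_gstable rb sU)) ?capvSl //.
  apply: contraNneq nx => e0; rewrite -memv0 -e0 memv_cap memv_img ?memvf // andbT.
  by move/submodP: sU; apply.
by apply/eqP; rewrite eqEsubv subvf -gD; apply: gen_le.
Qed.

Lemma std_top lam D : in_Lambda N lam -> std lam D ->
  exists L (t : 'Hom(D, L)), is_L lam L /\ surj_hom t.
Proof.
move=> lamL stD; have /andP[part rb] := lamL; have [[kD gD dD] _ isoD] := stD.
have [|D' [L [i [p [LL ji imi sp]]]]] := L_of_gen (e := erefl (sumn lam)) k_char0 rb part kD
  (subvv _) (eim_gstable rb (M := D)).
  by case: isoD => phi [a b c]; exists phi; split=> // s x xS; rewrite sact_id c.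
have /iso_sym[f [jf sf]] : iso D' D by exists i; split=> //; split; [case: ji | rewrite imi gD].
by exists L, (p \o f)%VF; split=> //; apply: surj_hom_comp.
Qed.

Lemma cover_onto_std lam P D : in_Lambda N lam -> is_P lam P -> std lam D ->
  exists p : 'Hom(P, D), surj_hom p.
Proof.
move=> lamL [L1 LL1 [prP [p1 sp1 ess]]] stD; have /andP[part rb] := lamL.
have [L2 [t [LL2 st]]] := std_top lamL stD; have [ht _] := st.
have [f [jf sf]] := iso_L rb LL1 LL2.
have sfp := surj_hom_comp sp1 sf; have [hfp _] := sfp.
have [p hp e] := prP _ _ t _ st hfp; exists p; split=> //.
apply: (std_gen lamL stD (submod_img hp (submod_full P))).
have [y ny] := is_L_apex rb LL2; have [x ex] := surj_homP sfp y.
exists (p x); rewrite ?memv_img ?memvf //; apply: contraNneq ny => e0.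
by rewrite -ex -e lfunE /= -ht e0 linear0.
Qed.

(** L(mu) is the head of [Q], hence a quotient of the nonzero image of [f], on which [e_r] for
    [r = sumn mu] therefore does not vanish. A simple local module of [D] must then be the one of
    L(mu). *)
Lemma hom_from_P mu Q D (f : 'Hom(Q, D)) r : in_Lambda N mu -> is_P mu Q -> is_hom f ->
  (exists x, f x != 0) -> kil r D -> (sumn mu <= r)%N ->
  sumn mu = r /\ forall lam, in_Lambda N lam -> sumn lam = r ->
  giso (pact k (lam := lam)) (specht k lam) (@gact k n (sumn lam) D) (eim (sumn lam) D) ->
  lam = mu.
Proof.
move=> muL [L LL [_ [p sp ess]]] hf [x0 nx0] kD le; have /andP[part rb] := muL.
have [sL kL isoL] := proj1 (is_LP L rb) LL; have [hp _] := sp.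
have fp : (lker f <= lker p)%VS.
  case: (cover_max sL sp ess (submod_ker hf)) => // e; move: nx0.
  by have /lfun_kerP -> : x0 \in lker f; rewrite ?e ?memvf ?eqxx.
have [y ny] := is_L_apex rb LL; have [x ex] := surj_homP sp y.
have nfx : f (tact Q (eidem N (sumn mu)) x) != 0.
  apply: contraNneq ny => /lfun_kerP/(subvP fp)/lfun_kerP.
  by rewrite hp ex => ->.
have eqr : sumn mu = r.
  apply/eqP; rewrite eqn_leq le leqNgt; apply: contra nfx => lt.
  by rewrite hf kD ?trank_eidem.
split=> // lam lamL; rewrite -eqr => es isoD; have /andP[partl rbl] := lamL.
have simD := eim_simple k_char0 rbl partl isoD.
have fK := lfun_factor fp; pose g := (p \o f^-1)%VF.
have fe : (f @: eim (sumn lam) Q)%VS = eim (sumn lam) D.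
  apply: (gsimple_gen simD).
  - by apply/subvP => _ /memv_imgP[z ze ->]; apply: eim_hom.
  - move=> s _ /memv_imgP[z ze ->]; rewrite -(gact_hom _ _ hf) memv_img //.
    exact: eim_gstable.
  apply: contraNneq nfx => e0; rewrite -memv0 -e0 -es memv_img // es.
  by rewrite memv_img ?memvf.
have ge : (g @: eim (sumn lam) D)%VS = eim (sumn lam) L.
  rewrite -fe -limg_comp -(eim_surj _ sp); apply: eq_in_limg => z _.
  by rewrite lfunE /= fK.
have isoDL : giso (@gact k n (sumn lam) D) (eim (sumn lam) D)
    (@gact k n (sumn lam) L) (eim (sumn lam) L).
  rewrite -ge; apply: gsimple_giso_img => //; first exact: eim_gstable.
    move=> s z; rewrite -fe => /memv_imgP[q qe ->].
    by rewrite -(gact_hom _ _ hf) !fK (gact_hom _ _ hp).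
  rewrite ge es; apply: contraNneq ny => e0; rewrite -memv0 -e0.
  by rewrite memv_img ?memvf.
have isoLL := giso_trans isoD isoDL.
have partm : is_part (sumn lam) mu by rewrite es.
apply: (specht_distinct k_char0 (e1 := erefl (sumn lam)) (e2 := esym es)) => //.
have isoL' : giso (sact k (esym es)) (specht k mu) (@gact k n (sumn lam) L) (eim (sumn lam) L).
  move: isoL; clear -es; case: (sumn lam) / (esym es) => -[phi [a b c]].
  by exists phi; split=> // s x xS; rewrite sact_id c.
have stm : gstable (sact k (esym es)) (specht k mu) by case: (sact_rep k (esym es)).
apply: giso_trans (giso_sym stm isoL').
by case: isoLL => phi [a b c]; exists phi; split=> // s z zS; rewrite sact_id c.
Qed.

Lemma Lambda_leN mu lam : ~~ Lambda_le mu lam -> (sumn mu <= sumn lam)%N /\ mu <> lam.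
Proof. by rewrite negb_or -leqNgt => /andP[le /eqP ne]. Qed.

(** Together the two halves say that the kernel is the trace of the P(mu) with mu not below [lam],
    which is the definition of the standard quotient. *)
Lemma std_kernel lam P D (p : 'Hom(P, D)) : in_Lambda N lam -> is_P lam P -> std lam D ->
  surj_hom p -> contains_images lam (lker p) /\
  forall U : {vspace P}, submod U -> contains_images lam U -> (lker p <= U)%VS.
Proof.
move=> lamL PP stD sp; have /andP[part rb] := lamL; have [[kD gD dD] _ isoD] := stD.
have [hp _] := sp; split.
  move=> mu Q f muL /Lambda_leN[le ne] QQ hf; apply/subvP => _ /memv_imgP[x _ ->].
  apply/lfun_kerP; apply: NNPP => nz; apply: ne.
  have ex : exists x, (p \o f)%VF x != 0 by exists x; rewrite lfunE /=; apply/eqP.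
  have [es h] := hom_from_P muL QQ (is_hom_comp hf hp) ex kD le.
  by rewrite (h lam).
move=> U sU cU; have [L1 LL1 [prP [p1 sp1 ess]]] := PP; have [sL1 _ _] := LL1.
(* Otherwise P/U has a subquotient L(mu) with [mu] smaller than [lam]; lifting P(mu) to it and then
   to P gives a homomorphism whose image is not in [U]. *)
have kU : forall f x, (trank f < sumn lam)%N -> tact P f x \in U.
  have [Y [q [sq kq]]] := exists_quot sU; have [hq _] := sq.
  suff kY : kil (sumn lam) Y.
    by move=> f x lt; rewrite -kq; apply/lfun_kerP; rewrite hq kY.
  have [Y0|nzY] := eqVneq (fullv : {vspace Y}) 0%VS.
    by move=> f x _; apply/eqP; rewrite -memv0 -Y0 memvf.
  have [mu [E [L [i [t [muL kmu LL [ji st]]]]]]] := L_subquot k_char0 nzY.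
  have [le|lt] := leqP (sumn lam) (sumn mu); first exact: kil_le kmu.
  have [Q QQ] := exists_P muL; have [L' LL' [prQ [t' st' _]]] := QQ.
  have /andP[_ rbm] := muL; have [g [jg sg]] := iso_L rbm LL' LL.
  have sgt := surj_hom_comp st' sg; have [hgt _] := sgt.
  have [h hh eh] := prQ _ _ t _ st hgt; have [hi _] := ji.
  have [h' hh' eh'] := prQ _ _ q (i \o h)%VF sq (is_hom_comp hh hi).
  have /subvP h'U : (limg h' <= U)%VS.
    apply: (cU mu Q) => //; rewrite negb_or -leqNgt (ltnW lt) /=.
    by apply: contraTneq lt => ->; rewrite ltnn.
  have [y ny] := is_L_apex rbm LL; have [x ex] := surj_homP sgt y.
  have : h' x \in U by apply: h'U; rewrite memv_img ?memvf.
  rewrite -kq => /lfun_kerP; move/lfunP/(_ x): eh'; rewrite !lfunE /= => -> ihx.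
  case/eqP: ny; rewrite -ex -eh lfunE /=.
  have -> : h x = 0 by apply: (inj_homP ji); rewrite ihx linear0.
  by rewrite !linear0.
have sUK : submod (U :&: lker p)%VS by apply: submod_cap => //; apply: submod_ker.
have [Y [q [sq kq]]] := exists_quot sUK; have [hq _] := sq.
have kY : kil (sumn lam) Y.
  move=> f y lt; have [x <-] := surj_homP sq y; rewrite -hq; apply/lfun_kerP.
  by rewrite kq memv_cap kU //=; apply/lfun_kerP; rewrite hp kD.
have le : (lker q <= lker p)%VS by rewrite kq capvSr.
have [p' hp' pq] := hom_factor sq hp le.
have sp' : surj_hom p'.
  by apply: surj_homI => // y; have [x <-] := surj_homP sp y; exists (q x); rewrite pq.
have [Z [sZ dZ fZ]] := induced_split k_char0 rb (And3 kD gD dD) kY sp'.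
(* The preimage of the complement [Z] maps onto [D], so it is not in the maximal submodule of the
   projective cover and must be everything. Thus the extension of [D] is trivial. *)
have full : (q @^-1: Z)%VS = fullv.
  case: (cover_max sL1 sp1 ess (submod_preim hq sZ)) => // ker1.
  have pd : (p @: (q @^-1: Z))%VS = fullv.
    apply/eqP; rewrite eqEsubv subvf; apply/subvP => y _.
    have : y \in (p' @: Z)%VS by rewrite fZ memvf.
    case/memv_imgP=> z zZ ->; have [x ex] := surj_homP sq z.
    by rewrite -ex pq memv_img // -memv_preim ex.
  have [L2 [t [LL2 st]]] := std_top lamL stD; have [ht _] := st; have [sL2 _ _] := LL2.
  have stp := surj_hom_comp sp st; have [htp _] := stp.
  have [le1|e] := cover_max sL1 sp1 ess (submod_ker htp); last first.
    have [y ny] := is_L_apex rb LL2; have [x ex] := surj_homP stp y.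
    case/eqP: ny; rewrite -ex; have /lfun_kerP -> : x \in lker (t \o p)%VF by rewrite e memvf.
    by rewrite linear0.
  have kk : (lker p1 <= lker (t \o p)%VF)%VS.
    have [hp1 _] := sp1; have [g hg eg] := hom_factor stp hp1 le1.
    have [|_ kg] := simple_hom_inj sL2 hg.
      have [y ny] := is_L_apex rb LL1; have [x ex] := surj_homP sp1 y.
      exists ((t \o p)%VF x); rewrite eg ex; apply: contraNneq ny => ->.
      by rewrite linear0.
    apply/subvP => x /lfun_kerP; rewrite -eg => /lfun_kerP; rewrite kg memv0 => /eqP.
    by move/lfun_kerP.
  have [y ny] := is_L_apex rb LL2; have [d ed] := surj_homP st y.
  have : d \in (p @: (q @^-1: Z))%VS by rewrite pd memvf.
  case/memv_imgP=> x xZ ex; case/eqP: ny; rewrite -ed ex.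
  have /lfun_kerP : x \in lker (t \o p)%VF by apply: (subvP kk); apply: (subvP ker1).
  by rewrite lfunE /= => ->; rewrite linear0.
apply/subvP => x /lfun_kerP px; have : q x \in Z by rewrite memv_preim full memvf.
move=> qZ; have : q x = 0 by apply: (capv0E dZ qZ); apply/lfun_kerP; rewrite pq.
by move/lfun_kerP; rewrite kq memv_cap => /andP[].
Qed.

Lemma is_DeltaP lam D : in_Lambda N lam -> is_Delta lam D <-> std lam D.
Proof.
move=> lamL; split=> [[P [p [PP sp cp mp]]] | stD].
  have [D0 stD0] := exists_std k_char0 lamL.
  have [p0 sp0] := cover_onto_std lamL PP stD0.
  have [c0 m0] := std_kernel lamL PP stD0 sp0.
  have [hp _] := sp; have [hp0 _] := sp0.
  have le1 := mp _ (submod_ker hp0) c0; have le2 := m0 _ (submod_ker hp) cp.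
  apply: (std_iso lamL stD0).
  have [f hf ef] := hom_factor sp hp0 le1; exists f; split.
    apply: inj_homI => // y; have [x <-] := surj_homP sp y; rewrite ef => /lfun_kerP px.
    by apply/lfun_kerP; apply: (subvP le2).
  by apply: surj_homI => // y; have [x <-] := surj_homP sp0 y; exists (p x).
have [P PP] := exists_P lamL; have [p sp] := cover_onto_std lamL PP stD.
by have [c m] := std_kernel lamL PP stD sp; exists P, p; split.
Qed.

Lemma std_unique lam D D' : in_Lambda N lam -> std lam D -> std lam D' -> iso D D'.
Proof.
move=> lamL sD sD'; have [P PP] := exists_P lamL.
have [p sp] := cover_onto_std lamL PP sD; have [p' sp'] := cover_onto_std lamL PP sD'.
have [c m] := std_kernel lamL PP sD sp; have [c' m'] := std_kernel lamL PP sD' sp'.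
have [hp _] := sp; have [hp' _] := sp'.
have le1 := m _ (submod_ker hp') c'; have le2 := m' _ (submod_ker hp) c.
have [f hf ef] := hom_factor sp hp' le1; exists f; split.
  apply: inj_homI => // y; have [x <-] := surj_homP sp y; rewrite ef => /lfun_kerP px.
  by apply/lfun_kerP; apply: (subvP le2).
by apply: surj_homI => // y; have [x <-] := surj_homP sp' y; exists (p x).
Qed.

End Standard.

(** * Costandard modules inside injective envelopes *)

Section Costandard.
Variables (k : fieldType) (n : nat).
Hypothesis k_char0 : [pchar k] =i pred0.
Local Notation N := n.+1.
Implicit Types (M X Y D E C L P Q I J : tmod k N) (f g h : trans N).

Lemma exists_I mu : in_Lambda N mu -> exists I : tmod k N, is_I mu I.
Proof.
move=> muL; have [L LL] := exists_L k_char0 muL; have [sL _ _] := LL.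
have [i ji] := fmod_embed sL.
have [I cI] := exists_inj_envelope (fmod_injective (n := N)) ji.
by exists I, L.
Qed.

Lemma env_min L I (i : 'Hom(L, I)) (U : {vspace I}) : simple_mod L -> is_hom i ->
  (forall V : {vspace I}, submod V -> (V :&: limg i)%VS = 0%VS -> V = 0%VS) ->
  submod U -> U != 0%VS -> (limg i <= U)%VS.
Proof.
move=> sL hi ess sU nzU; apply: simple_in => //.
by apply: contraNneq nzU => e; apply/eqP/ess.
Qed.

(** The embedding of L into [fmod] extends to I, stays injective by essentiality, and splits by
    injectivity: I is a summand of [fmod]. *)
Lemma env_fmod L I : simple_mod L -> inj_envelope L I ->
  exists (j : 'Hom(I, fmod k N)) (rho : 'Hom(fmod k N, I)),
    [/\ is_hom j, is_hom rho & forall x, rho (j x) = x].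
Proof.
move=> sL [iI [i ji ess]]; have [e0 je0] := fmod_embed sL; have [hi _] := ji.
have [he0 _] := je0.
have [j hj e] := fmod_injective ji he0.
have jj : inj_hom j.
  split=> //; apply: ess; first exact: submod_ker.
  apply: capv0P => x /lfun_kerP jx /memv_imgP[y _ ex]; subst x.
  have : e0 y = 0 by rewrite -e lfunE.
  by rewrite -(linear0 e0) => /(inj_homP je0) ->; rewrite linear0.
have [rho hrho e'] := iI _ _ j \1%VF jj (@is_hom_id _ _ I).
by exists j, rho; split=> // x; move/lfunP/(_ x): e'; rewrite comp_lfunE id_lfunE.
Qed.

Lemma ngood_retract X M (j : 'Hom(X, M)) (rho : 'Hom(M, X)) :
  is_hom j -> is_hom rho -> (forall x, rho (j x) = x) -> ngood M -> ngood X.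
Proof.
move=> hj hrho K gM d db Y Ye Yeq.
have [||x xann xP] := gM d db (fun h => j (Y h)).
- move=> h; have := Ye h; rewrite !memv_cap => /andP[he /annP ha].
  rewrite eim_hom //=; apply/annP => t lt; by rewrite -hj ha // linear0.
- by move=> h s eh rh; rewrite Yeq // (gact_hom _ _ hj).
exists (rho x); first by apply/annP => t lt; rewrite -hrho (proj1 (annP _ _) xann) // linear0.
by move=> h eh rh; rewrite -hrho xP.
Qed.

Lemma ngood_fmod : ngood (fmod k N).
Proof.
move=> d db Y Ye Yeq.
have act g (F : fmod k N) t : tact (fmod k N) g F t = F (tcomp t g) by exact: fmod_actE.
(* A map of rank [d] is [iot] after the surjection [kap g] onto [[d]], which forces the value.
   Equivariance of [Y] will absorb the choice of numbering of the image. *)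
pose F0 (g : trans N) : k^o :=
  if trank g == d then Y (tcomp (kap d (tim g)) g) (iot (tim g)) else 0.
pose F : fmod k N := [ffun g => F0 g].
exists F.
  apply/annP => t lt; apply/ffunP => g; rewrite act !ffunE /F0 ltn_eqF //.
  exact: leq_ltn_trans (trank_compr _ _) lt.
move=> h eh rh; apply/ffunP => g; rewrite act ffunE /F0.
have him : tim h = pref n d.
  apply/eqP; rewrite eqEcard -trankE rh card_pref ?leqnn ?andbT; last by case/andP: db.
  apply/subsetP => i /imsetP[j _ ->]; rewrite inE -eh tcompE eidem_lt //.
  by case/andP: db.
have ime : tim (tcomp g (eidem N d)) = tim (tcomp g h).
  by rewrite !tim_comp him tim_eidem //; case/andP: db.
have [/(eimP db) Yhe /annP Yha] := andP (etrans (esym (memv_cap _ _ _)) (Ye h)).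
have YgE : Y h g = Y h (tcomp g (eidem N d)) by rewrite -act Yhe.
case: eqP => [rg|nr]; last first.
  rewrite YgE -(tcomp_1 (tcomp g _)) -act Yha ?ffunE // trankE ime -trankE.
  rewrite ltn_neqAle; apply/andP; split; first exact/eqP.
  by apply: leq_trans (trank_compr _ _) _; rewrite rh.
set S := tim (tcomp g h); have cS : #|S| = d by rewrite -rg.
have kge : tcomp (kap d S) (tcomp g h) =
    tcomp (tcomp (eidem N d) (tcomp (tcomp (kap d S) g) (eidem N d))) h.
  by rewrite -!tcomp_assoc eh [RHS]tcomp_assoc eidem_kap.
have [lt|[s es]] := local_unit db (tcomp (kap d S) g).
  have : (trank (tcomp g h) < d)%N; last by rewrite rg ltnn.
  rewrite (factor_rank db rg) kge; apply: leq_ltn_trans (trank_compr _ _) _.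
  exact: leq_ltn_trans (trank_compl _ _) lt.
rewrite kge es Yeq // /gact act YgE; congr (Y h _); rewrite -es.
apply/ffunP => i; rewrite !tcompE.
have -> : eidem N d (kap d S (g (eidem N d i))) = kap d S (g (eidem N d i)).
  by rewrite -tcompE eidem_kap.
by rewrite iotK // /S -ime -tcompE mem_tim.
Qed.

Lemma ngood_I lam I : is_I lam I -> ngood I.
Proof.
move=> [L [sL _ _] env]; have [j [rho [hj hrho K]]] := env_fmod sL env.
exact: ngood_retract K ngood_fmod.
Qed.

(** Dual to [hom_from_P]: a nonzero image in I(mu) contains the socle L(mu). *)
Lemma hom_to_I mu J X (f : 'Hom(X, J)) r : in_Lambda N mu -> is_I mu J -> is_hom f ->
  (exists x, f x != 0) -> kil r X -> (sumn mu <= r)%N ->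
  sumn mu = r /\ forall lam, in_Lambda N lam -> sumn lam = r ->
  giso (pact k (lam := lam)) (specht k lam) (@gact k n (sumn lam) X) (eim (sumn lam) X) ->
  lam = mu.
Proof.
move=> muL [L LL [_ [i ji ess]]] hf [x0 nx0] kX le; have /andP[part rb] := muL.
have [sL kL isoL] := proj1 (is_LP L rb) LL; have [hi ki] := ji.
have sub : (limg i <= limg f)%VS.
  apply: env_min => //; first exact: submod_img (submod_full X).
  by apply: contraNneq nx0 => e; rewrite -memv0 -e memv_img ?memvf.
have [y ny] := is_L_apex rb LL.
have fe z : z \in eim (sumn mu) L -> exists2 x, x \in eim (sumn mu) X & i z = f x.
  move=> /(eimP rb) ze; have : i z \in limg f by rewrite (subvP sub) // memv_img ?memvf.
  case/memv_imgP=> x _ ex; exists (tact X (eidem N (sumn mu)) x).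
    by rewrite memv_img ?memvf.
  by rewrite hf -ex -hi ze.
pose z := tact L (eidem N (sumn mu)) y.
have ze : z \in eim (sumn mu) L by rewrite memv_img ?memvf.
have [x xe ex] := fe z ze.
have nfx : f x != 0.
  rewrite -ex; apply: contraNneq ny => e; rewrite -/z.
  by apply/eqP/(inj_homP ji); rewrite e linear0.
have eqr : sumn mu = r.
  apply/eqP; rewrite eqn_leq le leqNgt; apply: contra nfx => lt.
  by rewrite (kil_eim rb kX lt xe) linear0.
split=> // lam lamL; rewrite -eqr => es isoX; have /andP[partl rbl] := lamL.
have simX := eim_simple k_char0 rbl partl isoX.
have stX := eim_gstable rbl (M := X).
have nfX : (f @: eim (sumn lam) X)%VS != 0%VS.
  by apply: contraNneq nfx => e0; rewrite -memv0 -e0 memv_img // es.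
have isoXf := gsimple_giso_img stX simX (fun s x _ => gact_hom s x hf) nfX.
have simf := giso_simple stX isoXf simX.
have iL : (i @: eim (sumn lam) L)%VS = (f @: eim (sumn lam) X)%VS.
  apply: (gsimple_gen simf).
  - apply/subvP => _ /memv_imgP[w we ->]; rewrite es in we.
    by have [x' xe' ->] := fe w we; rewrite memv_img // es.
  - move=> s _ /memv_imgP[w we ->]; rewrite -(gact_hom _ _ hi) memv_img //.
    exact: eim_gstable.
  apply: contraNneq nfx => e0; rewrite -ex -memv0 -e0 memv_img //.
  by rewrite es.
have isoLi : giso (@gact k n (sumn lam) L) (eim (sumn lam) L)
    (@gact k n (sumn lam) J) (f @: eim (sumn lam) X)%VS.
  rewrite -iL; exists i; rewrite ki capv0; split=> // s w _; exact: gact_hom.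
have stL := eim_gstable rbl (M := L).
have isoXL := giso_trans (giso_trans isoX isoXf) (giso_sym stL isoLi).
have partm : is_part (sumn lam) mu by rewrite es.
apply: (specht_distinct k_char0 (e1 := erefl (sumn lam)) (e2 := esym es)) => //.
have isoL' : giso (sact k (esym es)) (specht k mu) (@gact k n (sumn lam) L) (eim (sumn lam) L).
  move: isoL; clear -es; case: (sumn lam) / (esym es) => -[phi [a b c]].
  by exists phi; split=> // s x xS; rewrite sact_id c.
have stm : gstable (sact k (esym es)) (specht k mu) by case: (sact_rep k (esym es)).
apply: giso_trans (giso_sym stm isoL').
by case: isoXL => phi [a b c]; exists phi; split=> // s w wS; rewrite sact_id c.
Qed.

Lemma costd_eim lam X (U : {vspace X}) : in_Lambda N lam -> costd lam X -> submod U ->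
  U != 0%VS -> (eim (sumn lam) X <= U)%VS.
Proof.
case/andP=> part rb [[kX sepX cX] _ isoX] sU nzU.
have simX := eim_simple k_char0 rb part isoX.
have [x xU nx] := vspace_neq0 nzU.
rewrite -(gsimple_gen simX (capvSr U _) (submod_gstable rb sU)) ?capvSl //.
apply: contraNneq nx => e0; apply/eqP/sepX => g; apply/eqP; rewrite -memv0 -e0 memv_cap.
rewrite memv_img ?memvf // andbT; move/submodP: sU => sU.
by rewrite !sU.
Qed.

Lemma costd_socle lam X : in_Lambda N lam -> costd lam X ->
  exists L (j : 'Hom(L, X)), is_L lam L /\ inj_hom j.
Proof.
move=> lamL coX; have /andP[part rb] := lamL; have [[kX sepX cX] _ isoX] := coX.
have [|D [L [i [p [LL ji imi sp]]]]] := L_of_gen (e := erefl (sumn lam)) k_char0 rb part kX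
  (subvv _) (eim_gstable rb (M := X)).
  by case: isoX => phi [a b c]; exists phi; split=> // s x xS; rewrite sact_id c.
have [hi _] := ji; have [hp _] := sp.
have jp : inj_hom p.
  split=> //; apply/eqP/negPn/negP => nk.
  have sub : (limg i <= i @: lker p)%VS.
    rewrite imi; apply: gen_le; first exact: submod_img (submod_ker hp).
    apply: (costd_eim lamL coX (submod_img hi (submod_ker hp))).
    apply: contraNneq nk => e; apply/eqP/vspace0P => x xk.
    by apply: (inj_homP ji); rewrite linear0; apply/eqP; rewrite -memv0 -e memv_img.
  have [y ny] := is_L_apex rb LL; have [x ex] := surj_homP sp y.
  have /memv_imgP[x' /lfun_kerP xk] : i x \in (i @: lker p)%VS.
    by rewrite (subvP sub) // memv_img ?memvf.
  by move/(inj_homP ji) => exx; move: ny; rewrite -ex exx xk linear0 eqxx.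
have /iso_sym[f [jf sf]] : iso D L by exists p.
by exists L, (i \o f)%VF; split=> //; apply: inj_hom_comp.
Qed.

(** Cofreeness is [ngood] at the rank of [lam]. Separation holds because every nonzero submodule
    contains the socle L(lam), which is not killed by [e_r]. *)
Lemma ann_costd lam I X (j : 'Hom(X, I)) : in_Lambda N lam -> is_I lam I -> inj_hom j ->
  limg j = ann (sumn lam) I -> costd lam X.
Proof.
move=> lamL II jj imj; have /andP[part rb] := lamL.
have gI := ngood_I II; have [L LL [_ [i ji ess]]] := II.
have [sL kL isoL] := proj1 (is_LP L rb) LL; have [hi ki] := ji; have [hj kj] := jj.
have kX : kil (sumn lam) X.
  move=> f x lt; apply: (inj_homP jj); rewrite hj linear0.
  by apply: (proj1 (annP (sumn lam) (j x))) => //; rewrite -imj memv_img ?memvf.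
have iin x : i x \in limg j.
  by rewrite imj; apply/annP => f lt; rewrite -hi kL // linear0.
have [i' hi' ei] := hom_corestrict jj hi iin.
have ji' : inj_hom i'.
  by apply: inj_homI => // x ix; apply: (inj_homP ji); rewrite -ei ix !linear0.
have meet (U : {vspace X}) : submod U -> U != 0%VS -> (limg i' <= U)%VS.
  move=> sU nzU; apply: simple_in => //; apply: contraNneq nzU => e; apply/eqP.
  have : (j @: U)%VS = 0%VS.
    apply: ess; first exact: submod_img.
    apply: capv0P => _ /memv_imgP[u uU ->] /memv_imgP[x _ ex].
    have eu : u = i' x by apply: (inj_homP jj); rewrite ei.
    by rewrite (capv0E e uU) ?linear0 // eu memv_img ?memvf.
  move=> jU0; apply: vspace0P => u uU; apply: (inj_homP jj); rewrite linear0.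
  by apply/eqP; rewrite -memv0 -jU0 memv_img.
have [y ny] := is_L_apex rb LL.
have sepX x : (forall g, tact X (eidem N (sumn lam)) (tact X g x) = 0) -> x = 0.
  move=> h; have xK : x \in coker_in (sumn lam) (0%VS : {vspace X}).
    by apply/coker_inP => g; rewrite h mem0v.
  apply: NNPP => /eqP nx; have nK : coker_in (sumn lam) (0%VS : {vspace X}) != 0%VS.
    by apply: contraNneq nx => e; rewrite -memv0 -e.
  have : i' y \in coker_in (sumn lam) (0%VS : {vspace X}).
    by apply: (subvP (meet _ (coker_in_submod _ _) nK)); rewrite memv_img ?memvf.
  move/coker_inP/(_ (tid N)); rewrite tact1 memv0 -hi' => /eqP e.
  by case/eqP: ny; apply: (inj_homP ji'); rewrite e linear0.
have cX : cofree_at (sumn lam) (fullv : {vspace X}).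
  move=> Y Ye Yeq; have [||x xann xP] := gI (sumn lam) rb (fun h => j (Y h)).
  - move=> h; have := Ye h; rewrite capvf memv_cap => he.
    by rewrite eim_hom //= -imj memv_img ?memvf.
  - by move=> h s eh rh; rewrite Yeq // (gact_hom _ _ hj).
  move: xann; rewrite -imj => /memv_imgP[x' _ ex]; exists x'; first exact: memvf.
  by move=> h eh rh; apply: (inj_homP jj); rewrite hj -ex xP.
split=> //.
have stX := eim_gstable rb (M := X).
have iX : (i' @: eim (sumn lam) L <= eim (sumn lam) X)%VS.
  by apply/subvP => _ /memv_imgP[x xe ->]; apply: eim_hom.
have sti : gstable (@gact k n (sumn lam) X) (i' @: eim (sumn lam) L)%VS.
  move=> s _ /memv_imgP[x xe ->]; rewrite -(gact_hom _ _ hi') memv_img //.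
  exact: eim_gstable.
have [W [sW stW iW dW]] := maschke k_char0 (gact_rep rb X) iX sti.
(* A nonzero [W] would generate a submodule containing the socle, whose local part would then lie
   both in [W] and in its complement. *)
have W0 : W = 0%VS.
  apply/eqP/negPn/negP => nW.
  have nG : gen W != 0%VS.
    by apply: contraNneq nW => e; rewrite -subv0 -e gen_sub.
  have yG : i' (tact L (eidem N (sumn lam)) y) \in gen W.
    by apply: (subvP (meet _ (gen_submod W) nG)); rewrite memv_img ?memvf.
  have ye : i' (tact L (eidem N (sumn lam)) y) \in (i' @: eim (sumn lam) L)%VS.
    by rewrite !memv_img ?memvf.
  have yW : i' (tact L (eidem N (sumn lam)) y) \in W.
    by rewrite -(gen_eim rb kX sW stW) memv_cap yG (subvP iX).
  case/eqP: ny; apply: (inj_homP ji'); rewrite linear0.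
  exact: capv0E dW ye yW.
rewrite -iW W0 addv0; apply: giso_trans isoL _.
have [_ ki'] := ji'.
by exists i'; rewrite ki' capv0; split=> // s x _; apply: gact_hom.
Qed.

(** A map of rank below that of [lam] acting nontrivially on the submodule generated by [x] yields a
    subquotient L(mu) of it with [mu] smaller, and injectivity of I(mu) extends the resulting map to
    one that does not kill [x]. *)
Lemma nabla_ann lam I (x : I) : in_Lambda N lam -> is_I lam I ->
  x \in ann (sumn lam) I <->
  (forall mu J (f : 'Hom(I, J)), in_Lambda N mu -> ~~ Lambda_le mu lam -> is_I mu J ->
     is_hom f -> f x = 0).
Proof.
move=> lamL II; split=> [xann mu J f muL /Lambda_leN[le ne] JJ hf | bad].
  have [X [j [jj imj]]] := exists_sub (@ann_submod k n (sumn lam) I).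
  have [[kX _ _] _ isoX] := ann_costd lamL II jj imj; have [hj _] := jj.
  apply: NNPP => /eqP nz; apply: ne.
  have ex : exists y, (f \o j)%VF y != 0.
    by move: xann; rewrite -imj => /memv_imgP[y _ exy]; exists y; rewrite lfunE /= -exy.
  have [es h] := hom_to_I muL JJ (is_hom_comp hj hf) ex kX le.
  by rewrite (h lam).
have [U [i [ji imi]]] := exists_sub (gen_submod <[x]>%VS).
have xU : x \in limg i by rewrite imi (subvP (gen_sub _)) // memv_line.
have [hi _] := ji; have [U0|nzU] := eqVneq (fullv : {vspace U}) 0%VS.
  have -> : x = 0; last exact: mem0v.
  apply/eqP; case/memv_imgP: xU => y _ ->; have : y \in fullv by rewrite memvf.
  by rewrite U0 memv0 => /eqP ->; rewrite linear0.
have [mu [E [L [j [t [muL kmu LL [jj st]]]]]]] := L_subquot k_char0 nzU.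
case/memv_imgP: xU => x' _ ex.
have [le|lt] := leqP (sumn lam) (sumn mu).
  apply/annP => f ltf; rewrite ex -hi kmu ?linear0 //; exact: leq_trans le.
have [J JJ] := exists_I muL; have [L' LL' [iJ [e je _]]] := JJ.
have /andP[_ rbm] := muL; have [g [jg sg]] := iso_L rbm LL LL'.
have [hj _] := jj; have [ht _] := st; have [hg _] := jg; have [he _] := je.
have jij := inj_hom_comp jj ji.
have [f hf ef] := iJ _ _ _ _ jij (is_hom_comp (is_hom_comp ht hg) he).
have fx : f x = 0.
  apply: (bad mu J) => //; rewrite negb_or -leqNgt (ltnW lt) /=.
  by apply: contraTneq lt => ->; rewrite ltnn.
have fU : (limg i <= lker f)%VS.
  rewrite imi; apply: gen_le; first exact: submod_ker.
  by apply/subvP => _ /vlineP[c ->]; apply/lfun_kerP; rewrite linearZ /= fx scaler0.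
have [y ny] := is_L_apex rbm LL; have [d ed] := surj_homP st y.
case/eqP: ny; rewrite -ed; suff -> : t d = 0 by rewrite linear0.
apply: (inj_homP jg); apply: (inj_homP je); rewrite !linear0.
move/lfunP/(_ d): ef; rewrite !comp_lfunE => <-.
by apply/lfun_kerP; apply: (subvP fU); rewrite memv_img ?memvf.
Qed.

Lemma is_NablaP lam X : in_Lambda N lam -> is_Nabla lam X <-> costd lam X.
Proof.
move=> lamL; have /andP[part rb] := lamL; split=> [[I [i [II ji imi]]] | coX].
  apply: (ann_costd lamL II ji); apply/eqP; rewrite eqEsubv.
  apply/andP; split; apply/subvP => x.
    by move/(proj1 (imi x))/(proj2 (nabla_ann x lamL II)).
  by move/(proj1 (nabla_ann x lamL II))/(proj2 (imi x)).
have [L [j [LL jj]]] := costd_socle lamL coX; have [sL _ _] := LL.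
have [e0 je0] := fmod_embed sL.
have [I env] := exists_inj_envelope (fmod_injective (n := N)) je0.
have II : is_I lam I by exists L.
have [iI [e je ess]] := env; have [he _] := je; have [hj _] := jj.
have [i hi ei] := iI _ _ j e jj he; have eiE y : i (j y) = e y by rewrite -ei lfunE.
have [y ny] := is_L_apex rb LL; have ny0 : y != 0.
  by apply: contraNneq ny => ->; rewrite linear0.
have ji : inj_hom i.
  split=> //; apply/eqP/negPn/negP => nk.
  have := costd_eim lamL coX (submod_ker hi) nk => /subvP sub.
  have : j (tact L (eidem N (sumn lam)) y) \in lker i.
    by apply: sub; rewrite hj memv_img ?memvf.
  move/lfun_kerP; rewrite eiE -(linear0 e) => /(inj_homP je) e0y.
  by rewrite e0y eqxx in ny.
have [cX _ _] := coX; have [kX _ _] := cX.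
have [K [u [ju imu]]] := exists_sub (@ann_submod k n (sumn lam) I); have [hu _] := ju.
have iin x : i x \in limg u.
  by rewrite imu; apply/annP => f lt; rewrite -hi kX // linear0.
have [i' hi' ei2] := hom_corestrict ju hi iin.
have ji' : inj_hom i'.
  by apply: inj_homI => // x ix; apply: (inj_homP ji); rewrite -ei2 ix !linear0.
have kK : kil (sumn lam) K.
  move=> f x lt; apply: (inj_homP ju); rewrite hu linear0.
  by apply: (proj1 (annP (sumn lam) (u x))) => //; rewrite -imu memv_img ?memvf.
(* [X] splits off from the annihilator [K], but already contains the essential socle, so the
   complement is zero and [X] is all of [K]. *)
have [Z [sZ dZ fZ]] := coinduced_split k_char0 rb cX kK ji'.
have uZ : (u @: Z)%VS = 0%VS.
  apply: ess; first exact: submod_img.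
  apply: capv0P => _ /memv_imgP[z zZ ->] /memv_imgP[w _ ew].
  have ez : z = i' (j w) by apply: (inj_homP ju); rewrite ei2 eiE.
  by rewrite (capv0E dZ zZ) ?linear0 // ez memv_img ?memvf.
have Z0 : Z = 0%VS.
  apply: vspace0P => z zZ; apply: (inj_homP ju); rewrite linear0.
  by apply/eqP; rewrite -memv0 -uZ memv_img.
have imi : limg i = ann (sumn lam) I.
  rewrite -imu; apply/eqP; rewrite eqEsubv; apply/andP; split; apply/subvP => w.
    by case/memv_imgP=> x _ ->; rewrite -ei2 memv_img ?memvf.
  case/memv_imgP=> z _ ->; have : z \in (Z + limg i')%VS by rewrite fZ memvf.
  rewrite Z0 add0v => /memv_imgP[x _ ->]; by rewrite ei2 memv_img ?memvf.
exists I, i; split=> // x; rewrite imi; exact: nabla_ann.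
Qed.

End Costandard.

(** * Filtrations and uniqueness of tilting modules *)

Section Filtrations.
Variables (k : fieldType) (n : nat).
Implicit Types (M X C D : tmod k n) (F : tmod k n -> Prop).

(** Layers are added on top, so extension arguments run by induction on modules instead of chains of
    subspaces. *)
Inductive filt F : tmod k n -> Prop :=
| filt_zero M : fullv = 0%VS :> {vspace M} -> filt F M
| filt_snoc M M' C (j : 'Hom(M', M)) (q : 'Hom(M, C)) :
    filt F M' -> F C -> inj_hom j -> surj_hom q -> lker q = limg j -> filt F M.

Lemma filtered_filt F M : filtered F M -> filt F M.
Proof.
case=> m [U [U0 Um sU step]]; elim: m M U U0 Um sU step => [|m IH] M U U0 Um sU step.
  by apply: filt_zero; rewrite -Um U0.
have [_ [C FC [f [fhom fim fker]]]] := step m (ltnSn m).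
rewrite Um in fhom fim fker; rewrite capfv in fker.
have mono i : (i <= m)%N -> (U i <= U m)%VS.
  move=> le; rewrite -(subnKC le); have := leqnn (m - i)%N.
  elim: {-2}(m - i)%N => [|d IHd] led; first by rewrite addn0 subvv.
  apply: subv_trans (IHd (ltnW led)) _; rewrite addnS; case: (step (i + d)%N) => //.
  by rewrite ltnS -(subnKC le) leq_add2l ltnW.
have [M' [j [jj imj]]] := exists_sub (sU m (leqnSn m)); have [hj kj] := jj.
apply: (filt_snoc (j := j) (q := f) _ FC jj); last 2 first.
- by split=> // g v; apply: fhom; rewrite memvf.
- by rewrite fker imj.
have mem (i : nat) x : (x \in (j @^-1: U i)%VS) = (j x \in U i) by rewrite memv_preim.
apply: (IH M' (fun i => j @^-1: U i)%VS).
- rewrite U0; apply: vspace0P => x; rewrite -memv_preim memv0 => /eqP jx.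
  by apply: (inj_homP jj); rewrite jx linear0.
- apply/eqP; rewrite eqEsubv subvf; apply/subvP => x _.
  by rewrite mem -imj memv_img ?memvf.
- by move=> i le; apply: submod_preim => //; apply: sU; apply: leqW.
move=> i lt; have [le [C' FC' [f' [fhom' fim' fker']]]] := step i (leqW lt); split.
  by apply/subvP => x; rewrite !mem; apply: (subvP le).
exists C' => //; exists (f' \o j)%VF; split.
- by move=> g v; rewrite mem => jv; rewrite !lfunE /= hj fhom'.
- apply/eqP; rewrite eqEsubv subvf -fim'; apply/subvP => _ /memv_imgP[x xU ->].
  have : x \in limg j by rewrite imj; apply: (subvP (mono _ lt)).
  case/memv_imgP=> y _ ey; apply/memv_imgP; exists y; first by rewrite mem -ey.
  by rewrite lfunE /= ey.
apply/eqP; rewrite eqEsubv; apply/andP; split; apply/subvP => x.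
  rewrite memv_cap !mem => /andP[xU /lfun_kerP]; rewrite lfunE /= => fx.
  by rewrite -fker' memv_cap xU; apply/lfun_kerP.
move=> jxU; have /andP[xU /lfun_kerP fx] : (j x \in U i.+1) && (j x \in lker f').
  by rewrite -memv_cap fker' -mem.
by rewrite memv_cap mem xU; apply/lfun_kerP; rewrite lfunE.
Qed.

Lemma filtered_zero F M : fullv = 0%VS :> {vspace M} -> filtered F M.
Proof.
move=> M0; exists 0%N, (fun=> 0%VS); split=> // i _; exact: submod_0.
Qed.

Lemma filtered_cons F D M C (i : 'Hom(D, M)) (q : 'Hom(M, C)) : F D -> filtered F C ->
  inj_hom i -> surj_hom q -> lker q = limg i -> filtered F M.
Proof.
move=> FD [m [U [U0 Um sU step]]] ji sq ex; have [hi ki] := ji; have [hq _] := sq.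
exists m.+1, (fun a => if a is b.+1 then q @^-1: U b else 0)%VS; split=> //.
- by apply/eqP; rewrite eqEsubv subvf; apply/subvP => x _; rewrite -memv_preim Um memvf.
- by case=> [|b] le; [apply: submod_0 | apply: submod_preim => //; apply: sU].
case=> [|b] lt.
  have q0 : (q @^-1: U 0%N)%VS = limg i.
    rewrite -ex U0; apply/eqP; rewrite eqEsubv; apply/andP; split; apply/subvP => x.
      by rewrite -memv_preim memv0 => /eqP /lfun_kerP.
    by move/lfun_kerP=> qx; rewrite -memv_preim memv0 qx.
  rewrite q0 sub0v; split=> //; exists D => //; exists (i^-1)%VF; split.
  - by move=> g _ /memv_imgP[x _ ->]; rewrite -hi !lfunVK_inj.
  - apply/eqP; rewrite eqEsubv subvf; apply/subvP => x _; apply/memv_imgP.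
    by exists (i x); rewrite ?memv_img ?memvf ?lfunVK_inj.
  apply: capv0P => _ /memv_imgP[x _ ->] /lfun_kerP.
  by rewrite lfunVK_inj // => ->; rewrite linear0.
have [le [C' FC' [f [fhom fim fker]]]] := step b lt; split.
  by apply/subvP => x; rewrite -!memv_preim; apply: (subvP le).
exists C' => //; exists (f \o q)%VF; split.
- by move=> g v; rewrite -memv_preim => qv; rewrite !lfunE /= hq fhom.
- apply/eqP; rewrite eqEsubv subvf -fim; apply/subvP => _ /memv_imgP[y yU ->].
  have [x exy] := surj_homP sq y; apply/memv_imgP; exists x; rewrite ?lfunE /= ?exy //.
  by rewrite -memv_preim exy.
apply/eqP; rewrite eqEsubv; apply/andP; split; apply/subvP => x.
  rewrite memv_cap -!memv_preim => /andP[xU /lfun_kerP]; rewrite lfunE /= => fx.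
  by rewrite -fker memv_cap xU; apply/lfun_kerP.
move=> qxU; have /andP[xU /lfun_kerP fx] : (q x \in U b.+1) && (q x \in lker f).
  by rewrite -memv_cap fker memv_preim.
by rewrite memv_cap -memv_preim xU; apply/lfun_kerP; rewrite lfunE.
Qed.

Lemma filtered_snoc F D M C (i : 'Hom(D, M)) (q : 'Hom(M, C)) : filtered F D -> F C ->
  inj_hom i -> surj_hom q -> lker q = limg i -> filtered F M.
Proof.
move=> [m [U [U0 Um sU step]]] FC ji sq ex; have [hi ki] := ji; have [hq qf] := sq.
exists m.+1, (fun a => if (a <= m)%N then i @: U a else fullv)%VS; split.
- by rewrite leq0n U0 limg0.
- by rewrite ltnn.
- move=> a _; case: ifP => [le|_]; [exact/submod_img/sU | exact: submod_full].
move=> a lta; have /orP[/eqP ->|lt] : (a == m) || (a < m)%N by rewrite -leq_eqVlt.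
  rewrite /= leqnn ltnn subvf; split=> //; exists C => //; exists q; split=> //.
  by rewrite capfv ex Um.
have [le [C' FC' [f [fhom fim fker]]]] := step a lt.
rewrite /= (ltnW lt) lt; split; first exact: limgS.
exists C' => //; exists (f \o i^-1)%VF; split.
- by move=> g _ /memv_imgP[x xU ->]; rewrite -hi !lfunE /= !lfunVK_inj // fhom.
- apply/eqP; rewrite eqEsubv subvf -fim; apply/subvP => _ /memv_imgP[x xU ->].
  by apply/memv_imgP; exists (i x); rewrite ?memv_img // lfunE /= lfunVK_inj.
apply/eqP; rewrite eqEsubv; apply/andP; split; apply/subvP => y.
  rewrite memv_cap => /andP[/memv_imgP[x xU ->] /lfun_kerP].
  rewrite lfunE /= lfunVK_inj // => fx.
  by rewrite memv_img // -fker memv_cap xU; apply/lfun_kerP.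
case/memv_imgP=> x; rewrite -fker memv_cap => /andP[xU /lfun_kerP fx] ->.
rewrite memv_cap memv_img //=; apply/lfun_kerP.
by rewrite lfunE /= lfunVK_inj.
Qed.

End Filtrations.

(** * Splitting of extensions and uniqueness of T(lam) *)

Section Extensions.
Variables (k : fieldType) (n : nat).
Hypothesis k_char0 : [pchar k] =i pred0.
Local Notation N := n.+1.
Implicit Types (A B C D E M X T : tmod k N).

Lemma splits_zero_r C X : fullv = 0%VS :> {vspace X} -> splits C X.
Proof.
move=> X0 E i q ji sq ex; exists fullv; split; first exact: submod_full.
  rewrite ex capfv; apply: vspace0P => _ /memv_imgP[x _ ->].
  have : x \in fullv by rewrite memvf.
  by rewrite X0 memv0 => /eqP ->; rewrite linear0.
by case: sq.
Qed.

Lemma splits_zero_l C X : fullv = 0%VS :> {vspace C} -> splits C X.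
Proof.
move=> C0 E i q ji sq ex; exists 0%VS; split; first exact: submod_0.
  by rewrite cap0v.
by rewrite limg0 C0.
Qed.

(** Divide the extension by X' and split off [D]; the preimage of the resulting complement is an
    extension of [C] by X', which splits in turn. *)
Lemma splits_ext_r C X X' D (j : 'Hom(X', X)) (p : 'Hom(X, D)) :
  inj_hom j -> surj_hom p -> lker p = limg j -> splits C X' -> splits C D -> splits C X.
Proof.
move=> jj sp exX spX' spD E i q ji sq ex.
have [hj _] := jj; have [hp _] := sp; have [hi _] := ji; have [hq _] := sq.
have qi x : q (i x) = 0 by apply/lfun_kerP; rewrite ex memv_img ?memvf.
have [E1 [p1 [sp1 kp1]]] := exists_quot (submod_img hi (submod_img hj (submod_full X'))).
have [hp1 _] := sp1.
have p1P x : p1 (i (j x)) = 0 by apply/lfun_kerP; rewrite kp1 !memv_img ?memvf.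
have [|q1 hq1 eq1] := hom_factor sp1 hq.
  by apply/subvP => x; rewrite kp1 => /memv_imgP[y _ ->]; apply/lfun_kerP.
have [|i1 hi1 ei1] := hom_factor sp (is_hom_comp hi hp1).
  apply/subvP => x; rewrite exX => /memv_imgP[y _ ->]; apply/lfun_kerP.
  by rewrite lfunE /= p1P.
have ei1' x : i1 (p x) = p1 (i x) by rewrite ei1 lfunE.
have ji1 : inj_hom i1.
  apply: inj_homI => // d; have [x <-] := surj_homP sp d; rewrite ei1' => /lfun_kerP.
  rewrite kp1 => /memv_imgP[y yj /(inj_homP ji) exy].
  by apply/lfun_kerP; rewrite exX exy.
have sq1 : surj_hom q1.
  by apply: surj_homI => // c; have [e <-] := surj_homP sq c; exists (p1 e); rewrite eq1.
have ex1 : lker q1 = limg i1.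
  apply/eqP; rewrite eqEsubv; apply/andP; split; apply/subvP => y.
    have [e <-] := surj_homP sp1 y; move/lfun_kerP; rewrite eq1 => /lfun_kerP.
    by rewrite ex => /memv_imgP[x _ ->]; rewrite -ei1' memv_img ?memvf.
  case/memv_imgP=> d _ ->; have [x <-] := surj_homP sp d.
  by apply/lfun_kerP; rewrite ei1' eq1 qi.
have [Z1 [sZ1 dZ1 fZ1]] := spD _ _ _ ji1 sq1 ex1.
have [E2 [u [ju imu]]] := exists_sub (submod_preim hp1 sZ1); have [hu _] := ju.
have memu e : p1 e \in Z1 -> exists y, u y = e.
  by rewrite memv_preim -imu => /memv_imgP[y _ ->]; exists y.
have uZ y : p1 (u y) \in Z1 by rewrite memv_preim -imu memv_img ?memvf.
have ijin x : (i \o j)%VF x \in limg u.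
  by rewrite imu -memv_preim lfunE /= p1P mem0v.
have [i2 hi2 ei2] := hom_corestrict ju (is_hom_comp hj hi) ijin.
have ei2' x : u (i2 x) = i (j x) by rewrite ei2 lfunE.
have ji2 : inj_hom i2.
  apply: inj_homI => // x i2x; apply: (inj_homP jj); apply: (inj_homP ji).
  by rewrite -ei2' i2x !linear0.
have sq2 : surj_hom (q \o u)%VF.
  apply: surj_homI; first exact: is_hom_comp.
  move=> c; have : c \in (q1 @: Z1)%VS by rewrite fZ1 memvf.
  case/memv_imgP=> z zZ ->; have [e ee] := surj_homP sp1 z.
  have [y ey] := memu e (etrans (congr1 (fun w => w \in Z1) ee) zZ).
  by exists y; rewrite lfunE /= ey -ee eq1.
have ex2 : lker (q \o u)%VF = limg i2.
  apply/eqP; rewrite eqEsubv; apply/andP; split; apply/subvP => y.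
    move/lfun_kerP; rewrite lfunE /= => quy.
    have : p1 (u y) = 0.
      by apply: (capv0E dZ1 (uZ y)); apply/lfun_kerP; rewrite eq1.
    move/lfun_kerP; rewrite kp1 => /memv_imgP[_ /memv_imgP[x _ ->] e].
    have -> : y = i2 x by apply: (inj_homP ju); rewrite ei2'.
    by rewrite memv_img ?memvf.
  by case/memv_imgP=> x _ ->; apply/lfun_kerP; rewrite lfunE /= ei2' qi.
have [Z [sZ dZ fZ]] := spX' _ _ _ ji2 sq2 ex2.
exists (u @: Z)%VS; split; first exact: submod_img.
  apply: capv0P => _ /memv_imgP[z zZ ->] /lfun_kerP quz.
  by rewrite (capv0E dZ zZ) ?linear0 //; apply/lfun_kerP; rewrite lfunE.
by rewrite -limg_comp.
Qed.

(** First split the preimage of C', then divide by the complement found there; what is left is an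
    extension of [D] by [X]. *)
Lemma splits_ext_l C C' D X (j : 'Hom(C', C)) (p : 'Hom(C, D)) :
  inj_hom j -> surj_hom p -> lker p = limg j -> splits C' X -> splits D X -> splits C X.
Proof.
move=> jj sp exC spC' spD E i q ji sq ex.
have [hj _] := jj; have [hp _] := sp; have [hi _] := ji; have [hq _] := sq.
have qi x : q (i x) = 0 by apply/lfun_kerP; rewrite ex memv_img ?memvf.
have pj x : p (j x) = 0 by apply/lfun_kerP; rewrite exC memv_img ?memvf.
have hpq := is_hom_comp hq hp; have spq := surj_hom_comp sq sp.
have [E2 [u [ju imu]]] := exists_sub (submod_ker hpq); have [hu _] := ju.
have pqu y : p (q (u y)) = 0.
  by rewrite -comp_lfunE; apply/lfun_kerP; rewrite -imu memv_img ?memvf.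
have memu e : p (q e) = 0 -> exists y, u y = e.
  rewrite -comp_lfunE => /lfun_kerP; rewrite -imu => /memv_imgP[y _ ->].
  by exists y.
have iin x : i x \in limg u.
  by rewrite imu; apply/lfun_kerP; rewrite lfunE /= qi linear0.
have [i2 hi2 ei2] := hom_corestrict ju hi iin.
have ji2 : inj_hom i2.
  by apply: inj_homI => // x i2x; apply: (inj_homP ji); rewrite -ei2 i2x !linear0.
have quin y : (q \o u)%VF y \in limg j.
  by rewrite -exC; apply/lfun_kerP; rewrite lfunE /= pqu.
have [q2 hq2 eq2] := hom_corestrict jj (is_hom_comp hu hq) quin.
have eq2' y : j (q2 y) = q (u y) by rewrite eq2 lfunE.
have sq2 : surj_hom q2.
  apply: surj_homI => // c; have [e ee] := surj_homP sq (j c).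
  have [y ey] : exists y, u y = e by apply: memu; rewrite ee pj.
  by exists y; apply: (inj_homP jj); rewrite eq2' ey.
have ex2 : lker q2 = limg i2.
  apply/eqP; rewrite eqEsubv; apply/andP; split; apply/subvP => y.
    move/lfun_kerP=> q2y; have : u y \in lker q.
      by apply/lfun_kerP; rewrite -eq2' q2y linear0.
    rewrite ex => /memv_imgP[x _ e].
    have -> : y = i2 x by apply: (inj_homP ju); rewrite ei2.
    by rewrite memv_img ?memvf.
  case/memv_imgP=> x _ ->; apply/lfun_kerP; apply: (inj_homP jj).
  by rewrite eq2' ei2 qi linear0.
have [Z' [sZ' dZ' fZ']] := spC' _ _ _ ji2 sq2 ex2.
have [E1 [p1 [sp1 kp1]]] := exists_quot (submod_img hu sZ'); have [hp1 _] := sp1.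
have p1u z : z \in Z' -> p1 (u z) = 0.
  by move=> zZ; apply/lfun_kerP; rewrite kp1 memv_img.
have ji1 : inj_hom (p1 \o i)%VF.
  apply: inj_homI; first exact: is_hom_comp.
  move=> x; rewrite lfunE /= => /lfun_kerP; rewrite kp1 => /memv_imgP[z zZ e].
  have z0 : z = 0.
    apply: (capv0E dZ' zZ); apply/lfun_kerP; apply: (inj_homP jj).
    by rewrite eq2' -e qi linear0.
  by apply: (inj_homP ji); rewrite e z0 !linear0.
have le1 : (lker p1 <= lker (p \o q)%VF)%VS.
  by apply/subvP => y; rewrite kp1 => /memv_imgP[z _ ->]; apply/lfun_kerP; rewrite lfunE /= pqu.
have [q1 hq1 eq1] := hom_factor sp1 hpq le1.
have eq1' e : q1 (p1 e) = p (q e) by rewrite eq1 lfunE.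
have sq1 : surj_hom q1.
  apply: surj_homI => // d; have [e <-] := surj_homP spq d.
  by exists (p1 e); rewrite eq1.
have ex1 : lker q1 = limg (p1 \o i)%VF.
  apply/eqP; rewrite eqEsubv; apply/andP; split; apply/subvP => y.
    have [e <-] := surj_homP sp1 y; move/lfun_kerP; rewrite eq1' => /memu[y' <-].
    have : q2 y' \in (q2 @: Z')%VS by rewrite fZ' memvf.
    case/memv_imgP=> z zZ eqz; have : y' - z \in limg i2.
      by rewrite -ex2; apply/lfun_kerP; rewrite linearB /= eqz subrr.
    case/memv_imgP=> x _ exz; rewrite -[y'](subrK z) exz !linearD /= ei2 p1u // addr0.
    by apply/memv_imgP; exists x; rewrite ?memvf // lfunE.
  by case/memv_imgP=> x _ ->; apply/lfun_kerP; rewrite lfunE /= eq1' qi linear0.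
have [Z1 [sZ1 dZ1 fZ1]] := spD _ _ _ ji1 sq1 ex1.
exists (p1 @^-1: Z1)%VS; split; first exact: submod_preim.
  apply: capv0P => e; rewrite -memv_preim => eZ /lfun_kerP qe.
  have p1e : p1 e = 0.
    by apply: (capv0E dZ1 eZ); apply/lfun_kerP; rewrite eq1' qe linear0.
  move/lfun_kerP: (qe); rewrite ex => /memv_imgP[x _ exx].
  rewrite exx; suff -> : x = 0 by rewrite linear0.
  by apply: (inj_homP ji1); rewrite linear0 lfunE /= -exx.
apply/eqP; rewrite eqEsubv subvf; apply/subvP => c _.
have : p c \in (q1 @: Z1)%VS by rewrite fZ1 memvf.
case/memv_imgP=> z1; have [e <-] := surj_homP sp1 z1 => eZ; rewrite eq1' => epc.
have : c - q e \in limg j.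
  by rewrite -exC; apply/lfun_kerP; rewrite linearB /= epc subrr.
case/memv_imgP=> c' _ ec'; have : c' \in (q2 @: Z')%VS by rewrite fZ' memvf.
case/memv_imgP=> z zZ ez; apply/memv_imgP; exists (u z + e).
  by rewrite -memv_preim linearD /= p1u // add0r.
by rewrite linearD /= -eq2' -ez -ec' subrK.
Qed.

Lemma splits_filt C X : filt (standard (n := N)) C -> filt (costandard (n := N)) X -> splits C X.
Proof.
move=> fC; elim: fC X => {C} [C C0 X _|C C' D j p _ IH [mu muL /(is_DeltaP k_char0 _ muL) stD] jj sp ex X fX].
  exact: splits_zero_l.
apply: splits_ext_l jj sp ex (IH _ fX) _.
have [iD rb _] := stD.
elim: fX => {X} [X X0|X X' Y j' p' _ IHX [nu nuL /(is_NablaP k_char0 _ nuL) coY] jj' sp' ex'].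
  exact: splits_zero_r.
apply: splits_ext_r jj' sp' ex' IHX _; have [cY sb _] := coY.
exact: splits_induced_coinduced k_char0 _ _ _ _ rb sb iD cY.
Qed.

(** The pushout of [i] and [f] is an extension of [C] by [X]; a splitting retracts it onto [X], and
    the composite with [B] is the extension of [f]. *)
Lemma hom_extend A B C X (i : 'Hom(A, B)) (q : 'Hom(B, C)) (f : 'Hom(A, X)) :
  splits C X -> inj_hom i -> surj_hom q -> lker q = limg i -> is_hom f ->
  exists2 h : 'Hom(B, X), is_hom h & forall x, h (i x) = f x.
Proof.
move=> sp ji sq ex hf; have [hi _] := ji; have [hq _] := sq.
have qi x : q (i x) = 0 by apply/lfun_kerP; rewrite ex memv_img ?memvf.
have [Q [i1 [i2 [p1 [p2 [[h1 h2 hp1 hp2] [i1K i2K] [p12 p21] Qsplit]]]]]] := exists_dsum B X.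
pose g : 'Hom(A, Q) := ((i1 \o i) - (i2 \o f))%VF.
have gE x : g x = i1 (i x) - i2 (f x).
  by rewrite /g add_lfunE opp_lfunE !comp_lfunE.
have hg : is_hom g by move=> t x; rewrite !gE hi hf h1 h2 linearB.
have [E [pi [spi kpi]]] := exists_quot (submod_img hg (submod_full A)); have [hpi _] := spi.
have jv : inj_hom (pi \o i2)%VF.
  apply: inj_homI; first exact: is_hom_comp.
  move=> x; rewrite lfunE /= => /lfun_kerP; rewrite kpi => /memv_imgP[a _ e].
  have := congr1 p1 e; rewrite gE linearB /= i1K !p12 subr0 => e1.
  have a0 : a = 0 by apply: (inj_homP ji); rewrite -e1 linear0.
  by rewrite -(i2K x) e a0 linear0 linear0.
have le : (lker pi <= lker (q \o p1)%VF)%VS.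
  apply/subvP => y; rewrite kpi => /memv_imgP[a _ ->]; apply/lfun_kerP.
  by rewrite lfunE /= gE linearB /= i1K p12 subr0 qi.
have hqp := is_hom_comp hp1 hq; have [qb hqb eqb] := hom_factor spi hqp le.
have eqb' y : qb (pi y) = q (p1 y) by rewrite eqb lfunE.
have sqb : surj_hom qb.
  apply: surj_homI => // c; have [b <-] := surj_homP sq c.
  by exists (pi (i1 b)); rewrite eqb' i1K.
have exb : lker qb = limg (pi \o i2)%VF.
  apply/eqP; rewrite eqEsubv; apply/andP; split; apply/subvP => w.
    have [y <-] := surj_homP spi w; move/lfun_kerP; rewrite eqb' => /lfun_kerP.
    rewrite ex => /memv_imgP[a _ e]; apply/memv_imgP; exists (f a + p2 y); rewrite ?memvf //.
    rewrite lfunE /=; apply/eqP; rewrite -subr_eq0 -linearB /=; apply/eqP/lfun_kerP.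
    rewrite kpi; apply/memv_imgP; exists a; rewrite ?memvf // gE {1}(Qsplit y) e linearD /=.
    by rewrite opprD addrACA subrr addr0.
  by case/memv_imgP=> x _ ->; apply/lfun_kerP; rewrite lfunE /= eqb' p12 linear0.
have [Z [sZ dZ fZ]] := sp _ _ _ jv sqb exb.
have d0 : (Z :&: limg (pi \o i2)%VF)%VS = 0%VS by rewrite -exb.
have full : (Z + limg (pi \o i2)%VF)%VS = fullv.
  apply/eqP; rewrite eqEsubv subvf; apply/subvP => w _.
  have : qb w \in (qb @: Z)%VS by rewrite fZ memvf.
  case/memv_imgP=> z zZ e; rewrite -(subrK z w) addrC memv_add // -exb.
  by apply/lfun_kerP; rewrite linearB /= e subrr.
have [hv _] := jv.
have [Q' [s [t [hs ht ts simg kt]]]] :=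
  complement_retract sZ (submod_img hv (submod_full X)) d0 full.
have stv x : s (t ((pi \o i2)%VF x)) = (pi \o i2)%VF x.
  have : (pi \o i2)%VF x \in limg s by rewrite simg memv_img ?memvf.
  by case/memv_imgP=> y _ ->; rewrite ts.
have sin' w : (s \o t)%VF w \in limg (pi \o i2)%VF.
  by rewrite -simg comp_lfunE memv_img ?memvf.
have [rho hrho erho] := hom_corestrict jv (is_hom_comp ht hs) sin'.
have hh := is_hom_comp h1 (is_hom_comp hpi hrho).
exists (rho \o pi \o i1)%VF; first exact: hh.
move=> x; rewrite !comp_lfunE; apply: (inj_homP jv); rewrite erho comp_lfunE.
have -> : pi (i1 (i x)) = (pi \o i2)%VF (f x); last exact: stv.
rewrite lfunE /=; apply/eqP; rewrite -subr_eq0 -linearB /=; apply/eqP/lfun_kerP.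
by rewrite kpi -gE memv_img ?memvf.
Qed.

Lemma hpow_fix M (h : 'End(M)) m x : h x = x -> hpow h m x = x.
Proof. by move=> hx; rewrite hpowE; elim: m => //= m ->. Qed.

(** The identification of the standard submodules extends in both directions. The composite fixes
    the nonzero standard submodule of [T], so it is not nilpotent; by Fitting and indecomposability
    it is injective, hence so is [f]. *)
Lemma is_T_embed lam T T' : in_Lambda N lam -> is_T lam T -> is_T lam T' ->
  exists f : 'Hom(T, T'), inj_hom f.
Proof.
move=> lamL [[_ indT] [_ tT] [D [C [i [q [/(is_DeltaP k_char0 _ lamL) stD ji sq ex fC]]]]]].
move=> [_ [_ tT'] [D' [C' [i' [q' [/(is_DeltaP k_char0 _ lamL) stD' ji' sq' ex' fC']]]]]].
have [phi [jphi sphi]] := std_unique k_char0 lamL stD stD'.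
have [hphi kphi] := jphi; have [hi _] := ji; have [hi' _] := ji'.
have [psi hpsi epsi] : exists2 psi : 'Hom(D', D), is_hom psi & forall x, psi (phi x) = x.
  have [|psi hpsi e] := hom_factor sphi (@is_hom_id _ _ D); first by rewrite kphi sub0v.
  by exists psi => // x; rewrite e id_lfunE.
have [f hf ef] := hom_extend (splits_filt (filtered_filt fC) (filtered_filt tT'))
  ji sq ex (is_hom_comp hphi hi').
have [g hg eg] := hom_extend (splits_filt (filtered_filt fC') (filtered_filt tT))
  ji' sq' ex' (is_hom_comp hpsi hi).
have hh := is_hom_comp hf hg; have hfix x : (g \o f)%VF (i x) = i x.
  by rewrite lfunE /= ef lfunE /= eg lfunE /= epsi.
have [m [d0 full]] := fitting hh; set e := hpow _ _ in d0 full.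
have he : is_hom e by apply: hpow_hom.
exists f; split=> //; apply: vspace0P => x /lfun_kerP fx.
case: (indT _ _ (submod_ker he) (submod_img he (submod_full T)) full d0) => e0.
  apply/eqP; rewrite -memv0 -e0; apply/lfun_kerP.
  by rewrite /e hpowE iterSr lfunE /= fx linear0 -hpowE linear0.
have [[kD gD dD] rb isoD] := stD.
have /vspace_neq0[y _ ny] : eim (sumn lam) D != 0%VS.
  apply: (@giso_neq0 k n lam _ D _ erefl).
  by case: isoD => xi [a b c]; exists xi; split=> // s z zS; rewrite sact_id c.
case/eqP: ny; apply: (inj_homP ji); rewrite linear0 -(hpow_fix m.+1 (hfix y)).
by apply/eqP; rewrite -memv0 -e0 memv_img ?memvf.
Qed.

Lemma is_T_unique lam T T' : in_Lambda N lam -> is_T lam T -> is_T lam T' -> iso T T'.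
Proof.
move=> lamL tT tT'; have [f jf] := is_T_embed lamL tT tT'.
have [g jg] := is_T_embed lamL tT' tT; exists f; split=> //.
have [hf kf] := jf; have [_ kg] := jg; split=> //.
apply/eqP; rewrite eqEdim subvf /= limg_dim_eq ?kf ?capv0 //.
by rewrite -(limg_dim_eq (f := g) (U := fullv)) ?kg ?capv0 // dimvS // subvf.
Qed.
End Extensions.

(** * Standard filtrations of injective envelopes *)

Section DifferenceOperators.
Variables (k : fieldType) (n : nat).
Local Notation N := n.+1.
Local Notation X := (fmod k N).
Implicit Types (S A : {set 'I_N}) (f g h : trans N) (F : X).

Definition dep A F : Prop := forall f g, {in A, f =1 g} -> F f = F g.

Definition reset (i : 'I_N) f : trans N := [ffun j => if j == i then ord0 else f j].

Lemma exists_reset i : {E : 'End(X) | forall F f, E F f = F (reset i f)}.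
Proof.
have l : linear (fun F : X => [ffun f => F (reset i f)] : X).
  by move=> c x y; apply/ffunP => f; rewrite !ffunE.
by have [E HE] := linear_hom l; exists E => F f; rewrite HE ffunE.
Qed.

Definition rst i : 'End(X) := sval (exists_reset i).

Lemma rstE i F f : rst i F f = F (reset i f).
Proof. exact: svalP (exists_reset i) F f. Qed.

(** The mixed difference: the product over [s] of the operators [1 - rst i], where [rst i] resets
    the value at [i] to the base point [ord0]. These operators are only linear, not
    homomorphisms. *)
Fixpoint diff (s : seq 'I_N) (F : X) : X :=
  if s is i :: s' then diff s' F - rst i (diff s' F) else F.

Lemma diff_linear s : linear (diff s).
Proof.
elim: s => //= i s IH c x y; rewrite IH linearP scalerBr opprD.
by rewrite addrACA.
Qed.

Lemma dep_rst A i F : dep A F -> dep (A :\ i) (rst i F).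
Proof.
move=> dF f g e; rewrite !rstE; apply: dF => j jA; rewrite !ffunE.
by case: eqP => // /eqP ne; apply: e; rewrite !inE ne.
Qed.

Lemma dep_mono A A' F : A \subset A' -> dep A F -> dep A' F.
Proof. by move=> /subsetP sA dF f g e; apply: dF => i /sA; apply: e. Qed.

Lemma dep_diff A s F : dep A F -> dep A (diff s F).
Proof.
move=> dF; elim: s => //= i s IH f g e; rewrite !ffunE (IH f g) //.
by congr (_ - _); apply: (dep_mono (subsetDl A [set i]) (dep_rst IH)).
Qed.

Lemma diff_indep A s i F : i \in s -> i \notin A -> dep A F -> diff s F = 0.
Proof.
move=> + iA dF; elim: s => //= j s IH; rewrite inE => /orP[/eqP <-|/IH ->].
  apply/eqP; rewrite subr_eq0; apply/eqP/ffunP => f; rewrite rstE.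
  apply: (dep_diff s dF) => l lA; rewrite ffunE; case: eqP => // el.
  by rewrite -el lA in iA.
by rewrite linear0 subrr.
Qed.

(** Expanding the product, every term other than the identity contains some reset and so no longer
    depends on that point. *)
Lemma diff_rest A s F (V : {vspace X}) : dep A F -> {subset s <= A} ->
  (forall i G, i \in A -> dep (A :\ i) G -> G \in V) -> F - diff s F \in V.
Proof.
move=> dF sA HV; elim: s sA => [|i s IH] sA /=; first by rewrite subrr mem0v.
rewrite opprB addrCA addrC memvD //; last first.
  by apply: (HV i); rewrite ?sA ?mem_head //; apply: dep_rst; apply: dep_diff.
by apply: IH => j js; rewrite sA // inE js orbT.
Qed.

Lemma supp_dep S F : F \in supp X S -> dep S F.
Proof.
move=> FS f g e; apply/eqP; rewrite -subr_eq0.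
have l : linear (fun F : X => F f - F g : k^o).
  by move=> c x y; rewrite !ffunE scalerBr opprD addrACA.
have [D DE] := linear_hom l; rewrite -DE; apply/eqP/lfun_kerP; apply: subvP FS.
apply: supp_sub => h x hS; apply/lfun_kerP; rewrite DE !fmod_actE.
rewrite (_ : tcomp f h = tcomp g h) ?subrr //; apply/ffunP => i.
by rewrite !tcompE e // (subsetP hS) ?mem_tim.
Qed.

(** Only a nonempty [S] is the image of a retraction of [[n]]; for the empty set the statement
    fails, the constants being the counterexample. *)
Lemma dep_supp S F i : i \in S -> dep S F -> F \in supp X S.
Proof.
move=> iS dF; pose h : trans N := [ffun j => if j \in S then j else i].
have -> : F = tact X h F.
  apply/ffunP => f; rewrite fmod_actE; apply: dF => j jS; by rewrite !ffunE jS.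
by apply: supp_img; apply/subsetP => _ /imsetP[j _ ->]; rewrite ffunE; case: ifP.
Qed.

Definition one : X := [ffun=> 1].

Lemma dep0_one F : dep set0 F -> F \in <[one]>%VS.
Proof.
move=> dF; apply/vlineP; exists (F (tid N)); apply/ffunP => f; rewrite !ffunE /GRing.scale /= mulr1.
by apply: dF => i; rewrite inE.
Qed.

Lemma one_fix g : tact X g one = one.
Proof. by apply/ffunP => f; rewrite fmod_actE !ffunE. Qed.

Lemma one_submod : submod (<[one]>%VS : {vspace X}).
Proof. by apply/submodP => g _ /vlineP[c ->]; rewrite linearZ /= one_fix memvZ ?memv_line. Qed.

Lemma rad_diff S F : F \in rad #|S| X -> diff (enum S) F = 0.
Proof.
have [D DE] := linear_hom (diff_linear (enum S)); rewrite -DE => Fr; apply/lfun_kerP.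
apply: subvP Fr; apply: rad_sub => f x lt; apply/lfun_kerP; rewrite DE.
have /subsetPn[i iS inf] : ~~ (S \subset tim f).
  by apply: contraL lt => /subset_leq_card; rewrite -leqNgt.
apply: (diff_indep (A := tim f) (i := i)); rewrite ?mem_enum //.
by apply: supp_dep; apply: supp_img.
Qed.

(** The mixed difference over [S] kills constants, functions of other [d]-sets and [rad d], so it
    kills the component [y S]. That component is then equal to its own correction terms, which
    depend on proper subsets of [S]. *)
Lemma dgood_quot (M : tmod k N) (q : 'Hom(X, M)) : surj_hom q -> lker q = <[one]>%VS -> dgood M.
Proof.
move=> sq kq d db z zS zrad S cS; have [hq _] := sq.
have lift (T : {set 'I_N}) : exists y, #|T| = d -> y \in supp X T /\ q y = z T.
  have [cT|nT] := eqVneq #|T| d; last by exists 0 => cT; rewrite cT eqxx in nT.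
  by have [y yT ey] := supp_surj sq (zS T cT); exists y.
have [y yP] := fin_all_exists lift.
have [u urad qu] := rad_surj sq zrad.
have d0 : (0 < d)%N by case/andP: db.
have [i0 i0S] : exists i, i \in S by apply/set0Pn; rewrite -card_gt0 cS.
have dif_one (w : X) : w \in <[one]>%VS -> diff (enum S) w = 0.
  case/vlineP=> c ->; apply: (diff_indep (A := set0) (i := i0)); rewrite ?mem_enum ?inE //.
  by move=> f g _; rewrite !ffunE.
have sumk : \sum_(T : {set 'I_N} | #|T| == d) y T - u \in <[one]>%VS.
  rewrite -kq; apply/lfun_kerP; rewrite linearB /= qu linear_sum /= (eq_bigr z) ?subrr //.
  by move=> T /eqP cT; case: (yP T cT).
have [D DE] := linear_hom (diff_linear (enum S)).
have dif0 : diff (enum S) (y S) = 0.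
  have := dif_one _ sumk; rewrite -!DE linearB /= [D u]DE rad_diff ?cS // subr0.
  rewrite linear_sum /= (bigD1 S) ?cS //= big1 ?addr0 // => T /andP[/eqP cT ne].
  have [yT _] := yP T cT; rewrite DE.
  have /subsetPn[i iS iT] : ~~ (S \subset T).
    by apply: contra ne => sST; rewrite eq_sym eqEcard sST cT cS /=.
  by apply: (diff_indep (A := T) (i := i)); rewrite ?mem_enum //; apply: supp_dep.
have [yS <-] := yP S cS.
have : y S - diff (enum S) (y S) \in (rad d X + <[one]>)%VS.
  apply: (diff_rest (A := S)); first exact: supp_dep.
    by move=> i; rewrite mem_enum.
  (* When [S] is a single point nothing is left to depend on, and the term is constant; this is
     where the quotient by constants is used. *)
  move=> i G iS dG; have [e0|/set0Pn[j jS]] := eqVneq (S :\ i) set0.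
    rewrite -[G]add0r memv_add ?mem0v //; apply: dep0_one; by rewrite -e0.
  rewrite -[G]addr0 memv_add ?mem0v //; have := dep_supp jS dG.
  apply: subvP; apply: supp_sub => h x hS; apply: rad_img.
  apply: leq_ltn_trans (subset_leq_card hS) _.
  by rewrite -cS [in ltnRHS](cardsD1 i) iS.
rewrite dif0 subr0 => /memv_addP[a ar [b]]; rewrite -kq => /lfun_kerP qb ->.
by rewrite linearD /= qb addr0; exact: (rad_hom hq ar).
Qed.

End DifferenceOperators.

(** * Filtrations of injective envelopes *)

Section StandardFiltrations.
Variables (k : fieldType) (n : nat).
Hypothesis k_char0 : [pchar k] =i pred0.
Local Notation N := n.+1.
Implicit Types (M X Y D C L I J T : tmod k N) (S : {set 'I_N}).

Lemma dgood_retract X M (j : 'Hom(X, M)) (rho : 'Hom(M, X)) :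
  is_hom j -> is_hom rho -> (forall x, rho (j x) = x) -> dgood M -> dgood X.
Proof.
move=> hj hrho K gM d db z zS zrad S cS; rewrite -(K (z S)); apply: rad_hom => //.
apply: (gM d db (fun S => j (z S))) => // [T cT|]; first exact/supp_hom/zS.
by rewrite -linear_sum rad_hom.
Qed.

Lemma part1 mu : is_part 1 mu -> mu = [:: 1%N].
Proof. by case/and3P=> _; case: mu => [|[|[|a]] [|[|b] s]]. Qed.

(* For [mu = (1)] the envelope is the space of constant functions itself. *)
Lemma dgood_I mu I : in_Lambda N mu -> mu <> [:: 1%N] -> is_I mu I -> dgood I.
Proof.
move=> muL ne1 [L LL env]; have [sL _ _] := LL; have /andP[part rb] := muL.
have [j [rho [hj hrho K]]] := env_fmod sL env; have [iI [e je ess]] := env.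
have [he _] := je; have [M' [q [sq kq]]] := exists_quot (@one_submod k n); have [hq _] := sq.
have hw := is_hom_comp hj hq.
have jw : inj_hom (q \o j)%VF.
  split=> //; apply/eqP/negPn/negP => nk.
  (* If the envelope did not embed modulo constants, its socle would consist of constants, on which
     every map acts as the identity. *)
  have sub := env_min sL he ess (submod_ker hw) nk.
  have fixL g y : tact L g y = y.
    apply: (inj_homP je); rewrite he -[LHS]K -[RHS]K hj; congr (rho _).
    have : e y \in lker (q \o j)%VF by rewrite (subvP sub) // memv_img ?memvf.
    move/lfun_kerP; rewrite lfunE /= => /lfun_kerP; rewrite kq => /vlineP[c ->].
    by rewrite linearZ /= one_fix.
  have [y ny] := is_L_apex rb LL.
  (* The map [e_1] of rank one acts both as the identity and, if [mu] had size above one, as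
     zero. *)
  have le1 : (sumn mu <= 1)%N.
    rewrite leqNgt; apply: contra ny => lt; rewrite fixL -(fixL (eidem N 1) y).
    by rewrite (is_L_kil LL) // trank_eidem.
  case: ne1; apply: part1; move: part; rewrite (_ : sumn mu = 1%N) //.
  by apply/eqP; rewrite eqn_leq le1; case/andP: rb.
have [rho' hrho' er] := iI _ _ _ _ jw (@is_hom_id _ _ I).
apply: (dgood_retract hw hrho' _ (dgood_quot sq kq)) => x.
by move/lfunP/(_ x): er; rewrite comp_lfunE id_lfunE.
Qed.

Lemma std_neq0 lam D : std lam D -> exists2 x : D, x \in eim (sumn lam) D & x != 0.
Proof.
case=> _ rb [phi [a b c]]; apply: vspace_neq0.
apply: (@giso_neq0 k n lam _ D _ erefl).
by exists phi; split=> // s z zS; rewrite sact_id c.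
Qed.

Lemma costd_neq0 lam X : costd lam X -> exists2 x : X, x \in eim (sumn lam) X & x != 0.
Proof.
case=> _ rb [phi [a b c]]; apply: vspace_neq0.
apply: (@giso_neq0 k n lam _ X _ erefl).
by exists phi; split=> // s z zS; rewrite sact_id c.
Qed.

Lemma dim_exact X M C (i : 'Hom(X, M)) (q : 'Hom(M, C)) :
  inj_hom i -> surj_hom q -> lker q = limg i ->
  \dim (fullv : {vspace M}) = (\dim (fullv : {vspace X}) + \dim (fullv : {vspace C}))%N.
Proof.
move=> [hi ki] [hq fq] ex; have := limg_ker_dim q fullv; rewrite capfv fq ex => <-.
by rewrite limg_dim_eq // ki capv0.
Qed.

Lemma dim_gt0 M (x : M) : x != 0 -> (0 < \dim (fullv : {vspace M}))%N.
Proof.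
move=> nx; rewrite lt0n dimv_eq0; apply: contraNneq nx => e.
by rewrite -memv0 -e memvf.
Qed.

Lemma dgood_filtered X : dgood X -> filtered (standard (n := N)) X.
Proof.
have [d] := ubnP (\dim (fullv : {vspace X})); elim: d X => // d IH X lt gX.
have [X0|nX] := eqVneq (fullv : {vspace X}) 0%VS; first exact: filtered_zero.
have [lam [D [C [i [q [part stD _ [ji sq ex gC]]]]]]] := peel_dgood k_char0 gX nX.
have lamL : in_Lambda N lam by rewrite /in_Lambda part; case: stD.
have [x _ nx] := std_neq0 stD.
apply: (filtered_cons (D := D) (C := C) _ _ ji sq ex).
  by exists lam => //; apply/is_DeltaP.
apply: IH gC; rewrite ltnS (dim_exact ji sq ex) in lt; apply: leq_trans lt.
by rewrite -[ltnLHS]add0n ltn_add2r (dim_gt0 nx).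
Qed.

Lemma ngood_filtered X : ngood X -> filtered (costandard (n := N)) X.
Proof.
have [d] := ubnP (\dim (fullv : {vspace X})); elim: d X => // d IH X lt gX.
have [X0|nX] := eqVneq (fullv : {vspace X}) 0%VS; first exact: filtered_zero.
have [lam [C [X' [i [q [part coC [ji sq ex gX']]]]]]] := peel_ngood k_char0 gX nX.
have lamL : in_Lambda N lam by rewrite /in_Lambda part; case: coC.
have [x _ nx] := costd_neq0 coC.
apply: (filtered_snoc (D := X') (C := C) _ _ ji sq ex); last first.
  by exists lam => //; apply/is_NablaP.
apply: IH gX'; rewrite ltnS (dim_exact ji sq ex) in lt; apply: leq_trans lt.
by rewrite -[ltnLHS]addn0 ltn_add2l (dim_gt0 nx).
Qed.

Lemma env_indecomposable L I : simple_mod L -> inj_envelope L I -> indecomposable I.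
Proof.
move=> sL [iI [e je ess]]; have [he _] := je; have [nzL _] := sL.
have [y _ ny] := vspace_neq0 nzL.
have ney : e y != 0 by apply: contraNneq ny => e0; apply/eqP/(inj_homP je); rewrite e0 linear0.
split; first by apply: contraNneq ney => e0; rewrite -memv0 -e0 memvf.
move=> U V sU sV _ UV; have [->|nU] := eqVneq U 0%VS; first by left.
have [->|nV] := eqVneq V 0%VS; first by right.
case/eqP: ney; apply: (capv0E UV).
  by apply: (subvP (env_min sL he ess sU nU)); rewrite memv_img ?memvf.
by apply: (subvP (env_min sL he ess sV nV)); rewrite memv_img ?memvf.
Qed.

End StandardFiltrations.

(** * Socles of standard modules *)

Section Socle.
Variables (k : fieldType) (n : nat).
Hypothesis k_char0 : [pchar k] =i pred0.
Local Notation N := n.+1.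
Implicit Types (M X Y D C L I J : tmod k N) (S T : {set 'I_N}).

Lemma tact_sum_supp r D (v : {set 'I_N} -> D) (g : trans N) : kil r D ->
  (forall T, #|T| = r -> v T \in supp D T) ->
  tact D g (\sum_(T : {set 'I_N} | #|T| == r) v T) =
  \sum_(S : {set 'I_N} | #|S| == r)
    \sum_(T : {set 'I_N} | (#|T| == r) && (g @: T == S)) tact D g (v T).
Proof.
move=> kD vS; rewrite linear_sum /= [LHS](bigID (fun T : {set 'I_N} => #|g @: T| == r)) /=.
rewrite [X in _ + X = _]big1 ?addr0.
  rewrite [LHS](partition_big (fun T : {set 'I_N} => g @: T) (fun S : {set 'I_N} => #|S| == r)) /=.
    apply: eq_bigr => S /eqP cS; apply: eq_bigl => T.
    by case: (g @: T =P S) => [->|]; rewrite ?andbF // cS eqxx !andbT.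
  by move=> T /andP[].
move=> T /andP[/eqP cT ne]; apply: (supp_kil (r := r) kD _ (supp_act g (vS T cT))).
by rewrite ltn_neqAle ne -cT leq_imset_card.
Qed.

Lemma direct_img r D (v : {set 'I_N} -> D) (g : trans N) S : kil r D -> direct r D ->
  (forall T, #|T| = r -> v T \in supp D T) ->
  tact D g (\sum_(T : {set 'I_N} | #|T| == r) v T) = 0 -> #|S| = r ->
  \sum_(T : {set 'I_N} | (#|T| == r) && (g @: T == S)) tact D g (v T) = 0.
Proof.
move=> kD dD vS; rewrite tact_sum_supp // => g0.
move: S; apply: (dD _ _ g0) => S cS.
apply: memv_suml => T /andP[/eqP cT /eqP <-]; exact/supp_act/vS.
Qed.

Definition collapse (i j : 'I_N) : trans N := [ffun l => if l == i then j else l].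

Lemma collapse_id i j S : i \notin S -> {in S, collapse i j =1 id}.
Proof. by move=> iS l lS; rewrite ffunE; case: eqP => // e; rewrite -e lS in iS. Qed.

Lemma collapse_img_id i j S : i \notin S -> collapse i j @: S = S.
Proof.
by move=> iS; rewrite -[RHS]imset_id; apply: eq_in_imset => l; apply: collapse_id.
Qed.

Lemma collapse_img i j S : i \in S -> collapse i j @: S = j |: (S :\ i).
Proof.
move=> iS; rewrite -{1}(setD1K iS) imsetU1 ffunE eqxx collapse_img_id //.
by rewrite !inE eqxx.
Qed.

Lemma collapse_preim i j S (T : {set 'I_N}) : #|T| = #|S| -> i \notin S -> i != j ->
  (collapse i j @: T == S) = (T == S) || ((j \in S) && (T == i |: (S :\ j))).
Proof.
move=> cTS iS ij; have [iT|iT] := boolP (i \in T); last first.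
  rewrite collapse_img_id //; case: (T == S) => //=; apply/esym/negbTE.
  by apply: contra iT => /andP[_ /eqP ->]; rewrite !inE eqxx.
have /negbTE -> /= : T != S by apply: contraNneq iS => <-.
rewrite collapse_img //; apply/eqP/andP => [e|[jS /eqP ->]].
  have jS : j \in S by rewrite -e !inE eqxx.
  split=> //; have jT : j \notin T.
    apply/negP => jT; have : (#|S| < #|T|)%N.
      rewrite -e (cardsD1 i T) iT; have jTi : j \in T :\ i by rewrite !inE eq_sym ij.
      by rewrite (setUidPr _) ?sub1set.
    by rewrite cTS ltnn.
  rewrite -e; apply/eqP/setP => l; rewrite !inE.
  case: (l =P i) => [->|_] //=; case: (l =P j) => [->|_] //=.
  by rewrite (negPf jT).
apply/setP => l; rewrite !inE; case: (l =P j) => [->|_] //=.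
by case: (l =P i) => [->|_]; rewrite ?(negPf iS).
Qed.

Lemma rank_collapse m (i j : 'I_N) : (0 < m <= N)%N -> (i < m)%N -> (j < m)%N -> i != j ->
  (trank (tcomp (collapse i j) (eidem N m)) < m)%N.
Proof.
move=> mb im jm ij; have m0 : (0 < m)%N by case/andP: mb.
rewrite trankE tim_comp tim_eidem // collapse_img ?inE //.
rewrite (setUidPr _); last by rewrite sub1set !inE eq_sym ij.
have := cardsD1 i (pref n m); rewrite card_pref; last by case/andP: mb.
by rewrite inE im => {2}->.
Qed.

Definition sw (a b : 'I_N) : trans N := [ffun i => tperm a b i].

Lemma up_tperm m (mb : (0 < m <= N)%N) (a b : 'I_m) :
  let w := widen_ord (proj2 (andP mb)) in
  {in pref n m, up n (tperm a b) =1 sw (w a) (w b)}.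
Proof.
move=> w i; rewrite inE => im; apply: val_inj; rewrite /= [sw _ _ i]ffunE.
have ei : i = w (Ordinal im) by apply: val_inj.
rewrite (@up_val _ _ mb _ (Ordinal im)) // {2}ei.
have winj : injective w by move=> x y /(congr1 val) /= /val_inj.
by rewrite -[tperm (w a) _ _](inj_tperm _ _ _ winj).
Qed.

Lemma sign_nseq m M (v : M) : (0 < m <= N)%N -> gsimple (@gact k n m M) (eim m M) ->
  v \in eim m M -> v != 0 ->
  (forall a b : 'I_N, (a < m)%N -> (b < m)%N -> a != b -> tact M (sw a b) v = - v) ->
  giso (sact k (sumn_nseq1 m)) (specht k (nseq m 1%N)) (@gact k n m M) (eim m M).
Proof.
move=> mb simM vM nv sgn; apply: (sign_giso _ (gact_rep mb M) simM vM nv) => a b ab.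
have vS : v \in supp M (pref n m) by rewrite -eim_supp.
rewrite /gact (supp_eq vS (up_tperm mb a b)); apply: sgn => //=.
Qed.

(* Let [x] span a copy of the apex of L(mu) inside Delta(lam), with components
   [v S], [#|S| = r], and [m = |mu| > r]. Collapsing [a] to [b] kills [x]; on the
   component [S] this reads [v S = 0] if [S] misses both [a] and [b], whence
   [m = r.+1], and then that transpositions negate [x] and its components. *)
Lemma socle_std lam mu D L (i : 'Hom(L, D)) : in_Lambda N lam -> in_Lambda N mu ->
  std lam D -> is_L mu L -> inj_hom i ->
  lam = mu \/ (lam = nseq (sumn lam) 1%N /\ mu = nseq (sumn lam).+1 1%N).
Proof.
move=> lamL muL stD LL ji; have [[kD gD dD] rb isoD] := stD.
have /andP[partm mb] := muL; have /andP[partl _] := lamL; have [hi _] := ji.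
have [sL kL isoL] := proj1 (is_LP L mb) LL.
have [y0 ny0] := is_L_apex mb LL.
set r := sumn lam in rb kD gD dD isoD *; set m := sumn mu in mb kL isoL ny0 *.
pose y := tact L (eidem N m) y0.
have ye : y \in eim m L by rewrite memv_img ?memvf.
have [le|lt] := leqP m r.
  left; have [sL' _ _] := LL; have [e0 je0] := fmod_embed sL'.
  have [J env] := exists_inj_envelope (fmod_injective (n := N)) je0.
  have [iJ [e je ess]] := env; have [he _] := je.
  have [f hf ef] := iJ _ _ i e ji he.
  have nf : exists x, f x != 0.
    exists (i y); move/lfunP/(_ y): ef; rewrite comp_lfunE => ->.
    by apply: contraNneq ny0 => ey; apply/eqP/(inj_homP je); rewrite ey linear0.
  have JJ : is_I mu J by exists L.
  by have [_ h] := hom_to_I k_char0 muL JJ hf nf kD le; apply: h.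
right; pose x := i y; have nx : x != 0.
  by apply: contraNneq ny0 => ex; apply/eqP/(inj_homP ji); rewrite -/y -/x ex linear0.
have xe : x \in eim m D by apply: eim_hom.
have kx f : (trank f < m)%N -> tact D f x = 0 by move=> ltf; rewrite /x -hi kL // linear0.
have [v [vS vP ex]] : exists v : {set 'I_N} -> D,
    [/\ forall S, #|S| = r -> v S \in supp D S,
        forall S, #|S| = r -> ~~ (S \subset pref n m) -> v S = 0 &
        x = \sum_(S : {set 'I_N} | #|S| == r) v S].
  have xg : x \in gen (eim r D) by rewrite gD memvf.
  have [z [zP ez]] := gen_decomp rb kD (subvv _) (eim_gstable rb (M := D)) xg.
  pose e := eidem N m; have ime (T : {set 'I_N}) : e @: T \subset pref n m.
    apply/subsetP => _ /imsetP[j _ ->]; rewrite inE eidem_lt //.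
    by case/andP: mb.
  (* Since [e_m] fixes [x], its action regroups the components into ones supported on subsets of the
     first [m] points. *)
  pose v S := \sum_(T : {set 'I_N} | (#|T| == r) && (e @: T == S)) tact D e (z T).
  exists v; split.
  - move=> S cS; apply: memv_suml => T /andP[/eqP cT /eqP <-]; apply: supp_act.
    by case: (zP T cT).
  - move=> S cS nS; apply: big1 => T /andP[_ /eqP eT].
    by rewrite -eT ime in nS.
  have /(eimP mb) <- := xe; rewrite -/e ez tact_sum_supp // => T cT.
  by case: (zP T cT).
have coll (a b : 'I_N) : (a < m)%N -> (b < m)%N -> a != b -> tact D (collapse a b) x = 0.
  move=> am bm ab; have /(eimP mb) <- := xe; rewrite -tactM kx //.
  exact: rank_collapse.
(* The [S]-component of the collapsed vector: the [r]-sets with image [S] are [S] itself and, if [b]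
   lies in [S], the set with [b] replaced by [a]. *)
have rel (a b : 'I_N) S : (a < m)%N -> (b < m)%N -> a != b -> #|S| = r -> a \notin S ->
    v S + (if b \in S then tact D (collapse a b) (v (a |: (S :\ b))) else 0) = 0.
  move=> am bm ab cS aS; have := coll a b am bm ab; rewrite ex => c0.
  have := direct_img kD dD vS c0 cS; rewrite (bigD1 S) /=; last first.
    by rewrite cS eqxx collapse_img_id ?eqxx.
  rewrite (supp_id (vS S cS) (collapse_id b aS)) => e0; rewrite -[RHS]e0; congr (_ + _).
  case: ifP => bS; last first.
    rewrite big1 // => T /andP[/andP[/eqP cT]].
    by rewrite collapse_preim ?cT ?cS // bS orbF => /eqP ->; rewrite eqxx.
  have cS' : #|a |: (S :\ b)| = r.
    by rewrite cardsU1 !inE (negPf aS) andbF -cS (cardsD1 b S) bS.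
  rewrite (big_pred1 (a |: (S :\ b))) // => T /=; apply/andP/eqP.
    case=> /andP[/eqP cT]; rewrite collapse_preim ?cT ?cS // bS /=.
    by move=> + /negPf nS; rewrite nS => /eqP.
  move=> ->; rewrite cS' eqxx /= collapse_preim ?cS' ?cS // bS eqxx orbT /=.
  by split=> //; apply: contraNneq aS => <-; rewrite !inE eqxx.
have mN : (m <= N)%N by case/andP: mb.
have rm : m = r.+1.
  apply/eqP; rewrite eqn_leq lt andbT leqNgt; apply/negP => lt2.
  case/eqP: nx; rewrite ex; apply: big1 => S /eqP cS.
  have [sS|nS] := boolP (S \subset pref n m); last exact: vP.
  have : (1 < #|pref n m :\: S|)%N.
    by rewrite cardsD (setIidPr sS) card_pref // cS ltn_subRL addn1.
  case/card_gt1P=> a [b [+ + ab]]; rewrite !inE => /andP[aS am] /andP[bS bm].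
  by have := rel a b S am bm ab cS aS; rewrite (negPf bS) addr0.
(* With [m = r.+1] the relevant [r]-sets are the complements of single points of the prefix. *)
pose S_ (a : 'I_N) := pref n m :\ a; pose u a := v (S_ a).
have cS_ (a : 'I_N) : (a < m)%N -> #|S_ a| = r.
  move=> am; have := cardsD1 a (pref n m); rewrite card_pref // inE am add1n => e.
  by apply: succn_inj; rewrite -[RHS]rm [RHS]e.
have urel (a b : 'I_N) : (a < m)%N -> (b < m)%N -> a != b -> u a = - tact D (collapse a b) (u b).
  move=> am bm ab; apply/eqP; rewrite -addr_eq0; apply/eqP.
  have := rel a b (S_ a) am bm ab (cS_ a am); rewrite !inE eqxx /= => /(_ isT).
  rewrite eq_sym ab bm /= (_ : a |: (S_ a :\ b) = S_ b) //.
  apply/setP => l; rewrite !inE; case: (l =P a) => [->|_] //=.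
  by rewrite ab am.
have uS (a : 'I_N) : (a < m)%N -> u a \in supp D (S_ a) by move=> am; apply/vS/cS_.
have sw1 (a b : 'I_N) : (a < m)%N -> (b < m)%N -> a != b -> tact D (sw a b) (u b) = - u a.
  move=> am bm ab; rewrite (urel a b) // opprK; apply: (supp_eq (uS b bm)) => l.
  rewrite !inE !ffunE => /andP[lb _]; case: (l =P a) => [->|/eqP la]; first by rewrite tpermL.
  by rewrite tpermD // eq_sym.
(* The component [u c] reaches [u a] directly, with one sign, or through [u b], with two signs; off
   [c] the two routes differ by the transposition of [b] and [c]. *)
have sw2 (a b c : 'I_N) : (a < m)%N -> (b < m)%N -> (c < m)%N -> a != b -> a != c -> b != c ->
    tact D (sw b c) (u a) = - u a.
  move=> am bm cm ab ac bc.
  have e1 : u a = tact D (collapse a b) (tact D (collapse b c) (u c)).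
    by rewrite {1}(urel a b) // (urel b c) // linearN opprK.
  rewrite {1}(urel a c) // linearN /= e1; congr (- _); rewrite -!tactM.
  apply: (supp_eq (uS c cm)) => l; rewrite !inE !tcompE !ffunE => /andP[lc _].
  case: (l =P a) => [->|/eqP la]; first by rewrite tpermR (negPf ab) eqxx.
  case: (l =P b) => [->|/eqP lb].
    by rewrite tpermL eq_sym (negPf ac).
  by rewrite tpermD ?(negPf la) // eq_sym.
have xu : x = \sum_(a : 'I_N | (a < m)%N) u a.
  have Sinj : {in pref n m &, injective S_}.
    move=> a b; rewrite !inE => am bm eS; apply/eqP; apply: contraTT isT => ab.
    have : a \in S_ b by rewrite !inE ab am.
    by rewrite -eS !inE eqxx.
  rewrite ex (bigID (fun S => S \in [set S_ a | a in pref n m])) /=.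
  rewrite [X in _ + X]big1 ?addr0; last first.
    move=> S /andP[/eqP cS nS]; apply: vP => //; apply: contra nS => sS.
    have : #|pref n m :\: S| == 1%N.
      by rewrite cardsD (setIidPr sS) card_pref // cS rm subSnn.
    case/cards1P=> a ea; apply/imsetP; exists a.
      by have := set11 a; rewrite -ea inE => /andP[].
    by rewrite /S_ -ea setDDr setDv set0U (setIidPr sS).
  rewrite (eq_bigl (mem [set S_ a | a in pref n m])).
    rewrite big_imset //=; apply: eq_bigl => a; by rewrite inE.
  by move=> S; apply: andb_idl => /imsetP[a]; rewrite inE => am ->; rewrite cS_.
have swx (a b : 'I_N) : (a < m)%N -> (b < m)%N -> a != b -> tact D (sw a b) x = - x.
  move=> am bm ab; rewrite xu linear_sum /= -sumrN [RHS](reindex_inj (@perm_inj _ (tperm a b))) /=.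
  apply: eq_big => c; first by case: tpermP => [->|->|_ _]; rewrite ?am ?bm.
  move=> cm; have [->|ca] := eqVneq c a.
    rewrite tpermL -(sw1 b a) // 1?eq_sym //; congr (tact D _ _).
    by apply/ffunP => l; rewrite !ffunE tpermC.
  have [->|cb] := eqVneq c b; first by rewrite tpermR sw1.
  by rewrite tpermD 1?eq_sym // sw2.
have rN : (r < N)%N by rewrite -rm.
(* Omitting the last point of the prefix leaves the first [r] points, so [u c0] lies in the local
   module of [D], where [sw2] makes it a sign vector. *)
pose c0 : 'I_N := Ordinal rN; have c0m : (c0 < m)%N by rewrite rm /=.
have Sc0 : S_ c0 = pref n r.
  apply/setP => l; rewrite !inE rm ltnS [(l <= r)%N]leq_eqVlt -val_eqE /=.
  by case: (ltngtP l r).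
have nu : u c0 != 0.
  apply: contraNneq nx => u0; rewrite xu; apply/eqP/big1 => a am.
  have [->//|ac] := eqVneq a c0.
  by rewrite (urel a c0) // u0 linear0 oppr0.
have ue : u c0 \in eim r D by rewrite (eim_supp rb) -Sc0 uS.
have isoD1 : giso (sact k (sumn_nseq1 r)) (specht k (nseq r 1%N)) (@gact k n r D) (eim r D).
  apply: (sign_nseq rb (eim_simple k_char0 rb partl isoD) ue nu) => a b ar br ab.
  have [am bm] : (a < m)%N /\ (b < m)%N by rewrite rm; split; apply: ltnW.
  have ca : c0 != a by rewrite -val_eqE /= gtn_eqF.
  have cb : c0 != b by rewrite -val_eqE /= gtn_eqF.
  exact: sw2.
have ny : y != 0 by [].
have isoL1 : giso (sact k (sumn_nseq1 m)) (specht k (nseq m 1%N)) (@gact k n m L) (eim m L).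
  apply: (sign_nseq mb (eim_simple k_char0 mb partm isoL) ye ny) => a b am bm ab.
  by apply: (inj_homP ji); rewrite hi -/x swx // linearN.
have fin al q M (e : sumn al = q) : is_part q al ->
    giso (sact k e) (specht k al) (@gact k n q M) (eim q M) ->
    giso (sact k (sumn_nseq1 q)) (specht k (nseq q 1%N)) (@gact k n q M) (eim q M) ->
    al = nseq q 1%N.
  move=> part iso1 iso2; apply: (specht_distinct k_char0 (e1 := e) (e2 := sumn_nseq1 q) part (nseq1_part q)).
  have st2 : gstable (sact k (sumn_nseq1 q)) (specht k (nseq q 1%N)).
    by case: (sact_rep k (sumn_nseq1 q)).
  exact: giso_trans iso1 (giso_sym st2 iso2).
split; first by apply: (fin lam r D erefl).
by rewrite -rm; apply: (fin mu m L erefl).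
Qed.

End Socle.

(** * The envelopes of the sign weights *)

Section SignEnvelope.
Variables (k : fieldType) (n : nat).
Hypothesis k_char0 : [pchar k] =i pred0.
Local Notation N := n.+1.

Lemma eq_opp_0 (V : vectType k) (v : V) : v = - v -> v = 0.
Proof.
move/eqP; rewrite -subr_eq0 opprK -mulr2n -scaler_nat scaler_eq0.
by rewrite (negPf (natr_char0 k_char0 1)) => /eqP.
Qed.

Section Boundary.
Variable r : nat.
Hypothesis rb : (0 < r < N)%N.
Let rbN : (0 < r <= N)%N. Proof. by case/andP: rb => -> /ltnW. Qed.
Let mb : (0 < r.+1 <= N)%N. Proof. by case/andP: rb. Qed.
Let mN : (r.+1 <= N)%N. Proof. by case/andP: rb. Qed.
Local Notation X := (kmap k N r).
Local Notation tp := {ffun 'I_r -> 'I_N}.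

Definition face (s : 'S_r.+1) : tp := [ffun i => widen_ord mN (s (widen_ord (leqnSn r) i))].

(* The boundary of an (r+1)-simplex: it spans a sign representation of S_{r+1}
   killed by all maps of rank at most r. *)
Definition bdry : X := \sum_(s : 'S_r.+1) (-1) ^+ s *: (delta k (face s) : X).

Lemma face_inj : injective face.
Proof.
move=> s t /ffunP e; apply/permP.
have eqi (i : 'I_r) : s (widen_ord (leqnSn r) i) = t (widen_ord (leqnSn r) i).
  by have := e i; rewrite !ffunE => /(congr1 val) /= /val_inj.
have eqj (j : 'I_r.+1) : j != ord_max -> s j = t j.
  move=> nj; have lt : (j < r)%N.
    by rewrite ltn_neqAle -ltnS ltn_ord andbT; apply: contraNneq nj => ej; apply/eqP/val_inj.
  by have := eqi (Ordinal lt); congr (s _ = t _); apply: val_inj.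
move=> j; have [->|] := eqVneq j ord_max; last exact: eqj.
apply/eqP; apply: contraT => ne.
have ne2 : (t^-1%g (s ord_max)) != ord_max.
  by apply: contraNneq ne => e2; rewrite -{2}e2 permKV.
have := eqj _ ne2; rewrite permKV => /perm_inj e2.
by rewrite e2 eqxx in ne2.
Qed.

Lemma act_bdry f : tact X f bdry = \sum_(s : 'S_r.+1) (-1) ^+ s *: (delta k (pcomp f (face s)) : X).
Proof.
rewrite linear_sum /=; apply: eq_bigr => s _; rewrite linearZ /=.
by rewrite kmap_act_delta.
Qed.

Lemma bdry_kil f : (trank f < r.+1)%N -> tact X f bdry = 0.
Proof.
move=> lt; pose w := widen_ord mN.
have [i [j [ne e]]] : exists i j : 'I_r.+1, i != j /\ f (w i) = f (w j).
  apply: NNPP => no; have inj : injective (f \o w).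
    by move=> i j /= e; apply: NNPP => /eqP ne; apply: no; exists i, j.
  have : (r.+1 <= trank f)%N; last by rewrite leqNgt lt.
  rewrite -[X in (X <= _)%N](card_ord r.+1) -(card_imset _ inj) trankE.
  by apply/subset_leq_card/subsetP => _ /imsetP[l _ ->]; apply: mem_tim.
(* [f] identifies two of the first [r.+1] points; precomposing each face with their transposition
   changes the sign but not the image under [f]. *)
apply: eq_opp_0; rewrite act_bdry {1}(reindex_inj (mulIg (tperm i j))) /= -sumrN.
apply: eq_bigr => s _; rewrite odd_permM odd_tperm ne addbT signrN scaleNr; congr (- (_ *: _)).
congr (delta k _); apply/ffunP => a; rewrite !ffunE permM.
by case: tpermP => [->|->|].
Qed.

Lemma up_face (s u : 'S_r.+1) : pcomp (up n u) (face s) = face (s * u)%g.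
Proof.
apply/ffunP => i; rewrite [LHS]ffunE [face s i]ffunE [RHS]ffunE; apply: val_inj => /=.
by rewrite permM; apply: up_val.
Qed.

Lemma up_bdry (u : 'S_r.+1) : tact X (up n u) bdry = (-1) ^+ u *: bdry.
Proof.
rewrite act_bdry scaler_sumr [RHS](reindex_inj (mulIg u)) /=; apply: eq_bigr => s _.
rewrite up_face scalerA; congr (_ *: _).
by rewrite odd_permM signr_addb mulrC -mulrA -signr_addb addbb expr0 mulr1.
Qed.

Lemma bdry_neq0 : bdry != 0.
Proof.
apply/eqP => /ffunP/(_ (face 1%g)); rewrite sum_ffunE (bigD1 1%g) //= big1 => [|s ne].
  by rewrite !ffunE eqxx odd_perm1 addr0 /GRing.scale /= mulr1 => /eqP; rewrite oner_eq0.
rewrite !ffunE; case: eqP => [/face_inj es|]; last by rewrite scaler0.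
by rewrite es eqxx in ne.
Qed.

(** The module is generated by the inclusion of [[r]], a vector fixed by [e_r]. *)
Lemma kmap_gen (M : tmod k N) (f : 'Hom(X, M)) : is_hom f -> (forall w : M, tact M (eidem N r) w = 0) ->
  f = 0.
Proof.
move=> hf e0; apply/lfunP => F; rewrite lfunE /= (delta_sum F) linear_sum /=.
apply: big1 => h _; rewrite linearZ /=.
pose t : trans N := [ffun i : 'I_N => if insub (val i) is Some a then h (a : 'I_r) else i].
have -> : delta k h = tact X t (delta k (incl rbN 1%g)).
  rewrite /= kmap_act_delta; congr (delta k _); apply/ffunP => a; rewrite !ffunE perm1 /=.
  by rewrite insubT //= => lt; congr (h _); apply: val_inj.
rewrite hf -(incl_eidem rbN) -kmap_act_delta.
have := hf (eidem N r) (delta k (incl rbN 1%g)); rewrite e0 => /= ->.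
by rewrite linear0 scaler0.
Qed.

(** The submodule generated by the boundary has L((1^{r+1})) as a quotient. Injectivity extends the
    resulting nonzero map into I to all of k Hom([r], [n]), and such a map vanishes if [e_r] kills
    I. *)
Lemma sign_env_apex (I : tmod k N) : is_I (nseq r.+1 1%N) I -> exists w : I, tact I (eidem N r) w != 0.
Proof.
move=> [L LL [iI [e je ess]]]; apply: NNPP => no.
have e0 w : tact I (eidem N r) w = 0 by apply: NNPP => /eqP nz; apply: no; exists w.
have es := sumn_nseq1 r.+1.
have [Y [i [ji imi]]] := exists_sub (gen_submod <[bdry]>%VS); have [hi _] := ji.
have kY : kil r.+1 Y.
  move=> f y lt; apply: (inj_homP ji); rewrite hi linear0; apply/lfun_kerP.
  have : i y \in limg i by rewrite memv_img ?memvf.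
  apply: subvP; rewrite imi; apply/subv_sumP => h _.
  apply/subvP => _ /memv_imgP[_ /vlineP[c ->] ->]; apply/lfun_kerP.
  transitivity (c *: tact X (tcomp f h) bdry); first by rewrite -tactM linearZ.
  rewrite bdry_kil ?scaler0 //; exact: leq_ltn_trans (trank_compl _ _) lt.
have bin : bdry \in limg i by rewrite imi (subvP (gen_sub _)) // memv_line.
case/memv_imgP: bin => y _ ey.
have yu (u : 'S_r.+1) : gact Y u y = (-1) ^+ u *: y.
  by apply: (inj_homP ji); rewrite hi linearZ /= -ey -up_bdry.
have ny : y != 0 by apply: contraNneq bdry_neq0 => y0; rewrite ey y0 linear0.
have yem : y \in eim r.+1 Y.
  by apply/(eimP mb); rewrite -(up1 mb) -/(gact Y _) yu odd_perm1 scale1r.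
have sW : (<[y]> <= eim r.+1 Y)%VS by rewrite -memvE.
have stW : gstable (@gact k n r.+1 Y) <[y]>%VS.
  by move=> s _ /vlineP[c ->]; rewrite linearZ /= yu !memvZ ?memv_line.
have simW : gsimple (@gact k n r.+1 Y) <[y]>%VS.
  split; first by apply: contraNneq ny => W0; rewrite -memv0 -W0 memv_line.
  move=> W sWy _; have [->|nW] := eqVneq W 0%VS; [by left | right].
  apply/eqP; rewrite eqEdim sWy dim_vline ny lt0n dimv_eq0 //.
have repW := grep_sub (gact_rep mb Y) sW stW.
have isoW : giso (sact k es) (specht k (nseq r.+1 1%N)) (@gact k n r.+1 Y) <[y]>%VS.
  apply: (sign_giso es repW simW (memv_line y) ny) => a b ab.
  by rewrite yu odd_tperm ab scaleN1r.
have [D [L' [j [p [LL' jj _ sp]]]]] := L_of_gen k_char0 mb (nseq1_part r.+1) kY sW stW isoW.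
have mb' : (0 < sumn (nseq r.+1 1%N) <= N)%N by rewrite es.
have [g [jg sg]] := iso_L mb' LL' LL.
have [hp _] := sp; have [hg _] := jg; have [he _] := je.
have [f hf ef] := iI _ _ _ _ (inj_hom_comp jj ji) (is_hom_comp (is_hom_comp hp hg) he).
have f0 := kmap_gen hf e0.
have [z nz] := is_L_apex mb' LL'; have [d ed] := surj_homP sp z.
case/eqP: nz; rewrite -ed; suff -> : p d = 0 by rewrite linear0.
apply: (inj_homP jg); apply: (inj_homP je); rewrite !linear0.
by move/lfunP/(_ d): ef; rewrite !comp_lfunE f0 lfunE.
Qed.

End Boundary.
End SignEnvelope.

(** * Tilting modules *)

Section Tilting.
Variables (k : fieldType) (n : nat).
Hypothesis k_char0 : [pchar k] =i pred0.
Local Notation N := n.+1.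
Implicit Types (X D C L I T : tmod k N).

Lemma peel_is_T lam X D C (i : 'Hom(D, X)) (q : 'Hom(X, C)) : in_Lambda N lam ->
  std lam D -> inj_hom i -> surj_hom q -> lker q = limg i -> dgood C ->
  dgood X -> ngood X -> indecomposable X -> is_T lam X.
Proof.
move=> lamL stD ji sq ex gC gX nX indX; split=> //.
  by split; [apply: dgood_filtered | apply: ngood_filtered].
exists D, C, i, q; split=> //; first exact/is_DeltaP.
exact: dgood_filtered.
Qed.

Lemma is_I_peel mu I : in_Lambda N mu -> mu <> [:: 1%N] -> is_I mu I ->
  exists lam, [/\ in_Lambda N lam, is_T lam I, kil (sumn lam) I &
    lam = mu \/ (lam = nseq (sumn lam) 1%N /\ mu = nseq (sumn lam).+1 1%N)].
Proof.
move=> muL ne1 II; have gI := dgood_I muL ne1 II; have nI := ngood_I II.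
have [L LL env] := II; have [sL _ _] := LL.
have indI := env_indecomposable sL env; have [nzI _] := indI.
have [lam [D [C [i [q [part stD kI [ji sq ex gC]]]]]]] := peel_dgood k_char0 gI nzI.
have lamL : in_Lambda N lam by rewrite /in_Lambda part; case: stD.
exists lam; split=> //; first exact: (peel_is_T lamL stD ji sq ex).
have [iI [e je ess]] := env; have [he _] := je; have [hi _] := ji.
have [x _ nx] := std_neq0 stD.
have sub : (limg e <= limg i)%VS.
  apply: (env_min sL he ess); first exact: submod_img (submod_full D).
  apply: contraNneq nx => i0; apply/eqP/(inj_homP ji); rewrite linear0.
  by apply/eqP; rewrite -memv0 -i0 memv_img ?memvf.
have ein y : e y \in limg i by rewrite (subvP sub) // memv_img ?memvf.
have [u hu eu] := hom_corestrict ji he ein.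
apply: (socle_std k_char0 lamL muL stD LL (i := u)).
by apply: inj_homI => // y uy; apply: (inj_homP je); rewrite -eu uy !linear0.
Qed.

Lemma nseq_inj_size a b : nseq a 1%N = nseq b 1%N -> a = b.
Proof. by move/(congr1 size); rewrite !size_nseq. Qed.

Lemma is_I_T lam I : in_Lambda N lam -> lam <> nseq (sumn lam) 1%N -> is_I lam I -> is_T lam I.
Proof.
move=> lamL ne II; have ne1 : lam <> [:: 1%N] by move=> e; apply: ne; rewrite e.
have [al [alL tI _ [<-//|[_ e]]]] := is_I_peel lamL ne1 II.
by case: ne; rewrite {1}e; congr (nseq _ _); rewrite e sumn_nseq1.
Qed.

(** Were the bottom layer of weight (1^{r+1}), all maps of rank [r] would act as zero, against
    [sign_env_apex]. *)
Lemma is_I_T_sign r I : (0 < r < N)%N -> is_I (nseq r.+1 1%N) I -> is_T (nseq r 1%N) I.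
Proof.
move=> rb II; have muL : in_Lambda N (nseq r.+1 1%N).
  by rewrite /in_Lambda sumn_nseq1 nseq1_part; case/andP: rb.
have ne1 : nseq r.+1 1%N <> [:: 1%N] by case: r rb {II muL} => [|r] //= _ [].
have [al [alL tI kI h]] := is_I_peel muL ne1 II.
case: h => [eal|[eal /nseq_inj_size [er]]]; last by rewrite er -eal.
have [w] := sign_env_apex k_char0 rb II; rewrite kI ?eqxx // eal sumn_nseq1 trank_eidem //.
by case/andP: rb => -> /ltnW.
Qed.

Lemma top_act L x : tact L (eidem N N) x = x.
Proof. by rewrite eidem_full tact1. Qed.

Lemma full_rank_up (h : trans N) : trank h = N -> exists s : 'S_N, h = up n s.
Proof.
move=> rh; have NN : (0 < N <= N)%N by rewrite /= leqnn.
apply: (up_of NN) => [i|i|]; rewrite ?rh //.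
by rewrite eidem_id.
Qed.

(** At size [N] only permutations act nontrivially and there is a single set of that size, so both
    the induced and the coinduced conditions are trivially met by L. *)
Lemma is_L_T_sign L : is_L (nseq N 1%N) L -> is_T (nseq N 1%N) L.
Proof.
move=> LL; have lamL : in_Lambda N (nseq N 1%N).
  by rewrite /in_Lambda sumn_nseq1 nseq1_part /= leqnn.
have /andP[part rb] := lamL; have [sL kL isoL] := proj1 (is_LP L rb) LL.
have es : sumn (nseq N 1%N) = N by apply: sumn_nseq1.
have eF : eim (sumn (nseq N 1%N)) L = fullv.
  by rewrite es; apply/limg_fullP => y; exists y; apply: top_act.
have stL : std (nseq N 1%N) L.
  have full (S : {set 'I_N}) : #|S| = sumn (nseq N 1%N) -> S = setT.
    by rewrite es => cS; apply/eqP; rewrite eqEcard subsetT cardsT card_ord cS ltnSn.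
  split=> //; split=> //.
    apply/eqP; rewrite eqEsubv subvf -{1}eF; exact: gen_sub.
  move=> z zS z0 S cS; rewrite -[RHS]z0 (big_pred1 S) // => T.
  apply/eqP/eqP => [cT|->//]; by rewrite (full S cS) (full T cT).
have coL : costd (nseq N 1%N) L.
  split=> //; split=> //.
    by move=> x /(_ (tid N)); rewrite es top_act tact1.
  move=> Y Ye Yeq; exists (Y (tid N)); first exact: memvf.
  rewrite es in Yeq *; move=> h eh rh; have [s hs] := full_rank_up rh.
  have := Yeq (tid N) s; rewrite eidem_full tcomp_1 => /(_ erefl).
  rewrite tcomp1 -hs => -> //; first by rewrite /gact -hs.
  by rewrite -eidem_full trank_eidem // /= leqnn.
have [C [q [sq kq]]] := exists_quot (@submod_full k N L).
have C0 : (fullv : {vspace C}) = 0%VS.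
  apply: vspace0P => y _; have [x <-] := surj_homP sq y.
  by apply/lfun_kerP; rewrite kq memvf.
have ji : inj_hom (\1%VF : 'Hom(L, L)).
  by apply: inj_homI; [exact: is_hom_id | move=> x; rewrite id_lfunE].
have ex : lker q = limg (\1%VF : 'Hom(L, L)) by rewrite kq lim1g.
have fC F : filtered F C by apply: filtered_zero.
have [nzL simL] := sL.
split.
- split=> // U V sU sV _ UV; case: (simL U sU) => [|eU]; [by left | right].
  by rewrite -UV eU capfv.
- split.
    apply: (filtered_cons (F := standard (n := N)) _ (fC _) ji sq ex).
    by exists (nseq N 1%N) => //; apply/is_DeltaP.
  apply: (filtered_cons (F := costandard (n := N)) _ (fC _) ji sq ex).
  by exists (nseq N 1%N) => //; apply/is_NablaP.
by exists L, C, \1%VF, q; split=> //; apply/is_DeltaP.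
Qed.

Lemma is_L_iso lam L X : in_Lambda N lam -> is_L lam L -> iso X L -> is_L lam X.
Proof.
case/andP=> _ rb /(is_LP _ rb)[[nzL sL] kL isoL] [f [jf sf]].
have [hf kf] := jf; have [_ ff] := sf.
apply/(is_LP _ rb); split.
- split.
    by apply: contraNneq nzL => e; rewrite -ff e limg0.
  move=> U sU; case: (sL _ (submod_img hf sU)) => e; [left|right].
    apply: vspace0P => x xU; apply: (inj_homP jf); rewrite linear0.
    by apply/eqP; rewrite -memv0 -e memv_img.
  apply/eqP; rewrite eqEsubv subvf; apply/subvP => x _.
  have : f x \in (f @: U)%VS by rewrite e memvf.
  by case/memv_imgP=> y yU /(inj_homP jf) ->.
- exact: kil_sub jf kL.
apply: giso_trans isoL _; apply: giso_sym; first exact: eim_gstable.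
exists f; rewrite kf capv0 (eim_surj _ sf); split=> // s x _; exact: gact_hom.
Qed.

Lemma is_I_iso mu I X : is_I mu I -> iso X I -> is_I mu X.
Proof.
move=> [L LL [iI [e je ess]]] isoX; have /iso_sym[g [jg sg]] := isoX.
have [f [jf sf]] := isoX; have [hf kf] := jf; have [hg kg] := jg; have [he _] := je.
exists L => //; split.
  have [hff _] := jf; have le : (lker f <= lker (\1%VF : 'Hom(X, X)))%VS by rewrite kf sub0v.
  have [f' hf' ef'] := hom_factor sf (@is_hom_id _ _ X) le.
  apply: (retract_injective hf hf' _ iI) => x.
  by rewrite ef' id_lfunE.
exists (g \o e)%VF; first exact: inj_hom_comp.
move=> U sU UV; have [h hh eh] : exists2 h : 'Hom(X, I), is_hom h & forall x, h (g x) = x.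
  have le : (lker g <= lker (\1%VF : 'Hom(I, I)))%VS by rewrite kg sub0v.
  have [h hh eh] := hom_factor sg (@is_hom_id _ _ I) le.
  by exists h => // x; rewrite eh id_lfunE.
have : (g @^-1: U)%VS = 0%VS.
  apply: ess; first exact: submod_preim.
  apply: capv0P => x; rewrite -memv_preim => gU /memv_imgP[y _ ex].
  apply: (inj_homP jg); rewrite linear0; apply: (capv0E UV gU).
  by apply/memv_imgP; exists y; rewrite ?memvf // lfunE /= ex.
move=> p0; apply: vspace0P => z zU; have [x ex] := surj_homP sg z.
have : x \in (g @^-1: U)%VS by rewrite -memv_preim ex.
by rewrite p0 memv0 => /eqP x0; rewrite -ex x0 linear0.
Qed.

End Tilting.

Theorem theoremA4 (k : fieldType) (k_char0 : [pchar k] =i pred0)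
    (n : nat) (n_ge1 : (1 <= n)%N) (r : nat) (r_bounds : (1 <= r <= n)%N)
    (lam : seq nat) (lam_part : is_part r lam) :
  let rhs (X : tmod k n) : Prop :=
    if lam == nseq n 1%N then is_L (nseq n 1%N) X
    else if (lam == nseq r 1%N) && (r <= n - 1)%N then is_I (nseq r.+1 1%N) X
    else is_I lam X in
  (exists X : tmod k n, rhs X) /\
  (forall X T : tmod k n, rhs X -> (is_T lam T <-> iso T X)).
Proof.
case: n n_ge1 r_bounds => // n _ rb rhs.
have sr : sumn lam = r by case/and3P: lam_part => _ _ /eqP.
have lamL : in_Lambda n.+1 lam by rewrite /in_Lambda sr lam_part.
(* By uniqueness of T(lam) it is enough that the candidates are tilting of weight [lam] and that
   their class is closed under isomorphism. *)
suff [ex toT inv] : [/\ exists X, rhs X, forall X, rhs X -> is_T lam X &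
    forall X T, rhs X -> iso T X -> rhs T].
  split=> // X T rX; split=> [tT | isoT]; last exact: toT (inv _ _ rX isoT).
  exact: is_T_unique k_char0 _ _ _ lamL tT (toT _ rX).
rewrite /rhs; case: eqP => [e|ne].
  rewrite e in lamL *; split; first exact: exists_L.
    by move=> X; apply: is_L_T_sign.
  by move=> X T; apply: is_L_iso.
case: andP => [[/eqP e le]|nsign].
  have rb' : (0 < r < n.+1)%N by case/andP: rb => -> _; rewrite ltnS -[n in (_ <= n)%N](subn1 n.+1).
  split; last by move=> X T; apply: is_I_iso.
    by apply: exists_I => //; rewrite /in_Lambda sumn_nseq1 nseq1_part; case/andP: rb'.
  by move=> X; rewrite e; apply: is_I_T_sign.
(* A sign weight that fails the second test has [r] equal to [n.+1], which the first case has
   already treated. *)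
have ns : lam <> nseq (sumn lam) 1%N.
  rewrite sr => e; apply: nsign; rewrite e eqxx; split=> //.
  rewrite subn1 /=; case/andP: rb => _; rewrite leq_eqVlt => /orP[/eqP en|//].
  by case: ne; rewrite e en.
split; first exact: exists_I.
  by move=> X; apply: is_I_T.
by move=> X T; apply: is_I_iso.
Qed.
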